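(* Under the canonical identification between $T^*\mathrm{Bun}^{\boldsymbol\mu}(C,T)$ and $\mathrm{Higgs}^{\boldsymbol\mu}(C,T)$, one has the correspondence $\mathrm{d}z\mapsto\boldsymbol\Theta_z$, $\mathrm{d}w\mapsto\boldsymbol\Theta_w$, and so the symplectic structure of $\mathrm{Con}^{\boldsymbol\mu}_{\boldsymbol\nu}(C,T)$ is given, in the coordinates $(z,w,\kappa_1,\kappa_2)$, by the $2$-form $$\omega_C=\mathrm{d}\kappa_1\wedge\mathrm{d}z+\mathrm{d}\kappa_2\wedge\mathrm{d}w.$$
   Context: Curves. Let $\lambda\in\mathbb{C}\setminus\{0,1\}$, $C\subset\mathbb{P}^2$ the elliptic curve $y^2=x(x-1)(x-\lambda)$, $\pi\colon C\to\mathbb{P}^1$, $(x,y)\mapsto x$, with ramification points $\mathbf{w}_0,\mathbf{w}_1,\mathbf{w}_\lambda,\mathbf{w}_\infty$. Let $t\in\mathbb{P}^1\setminus\{0,1,\lambda,\infty\}$, $\pi^{-1}(t)=\{\mathbf{t}_1,\mathbf{t}_2\}$, $W=0+1+\lambda+\infty$, $D=W+t$, $\mathbf{W}=\mathbf{w}_0+\mathbf{w}_1+\mathbf{w}_\lambda+\mathbf{w}_\infty$, $T=\mathbf{t}_1+\mathbf{t}_2$. Fix $\nu\in\mathbb{C}$ with $2\nu\notin\mathbb{Z}$ and real $0<\mu<1$. Moduli spaces. A rank 2 parabolic bundle on $(X,Z)$ is a rank 2 bundle $E$ with a line $\ell_p\subset E|_p$ and weight $\mu_p\in[0,1]$ for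 each $p\in Z$. A parabolic connection is a parabolic bundle with a logarithmic connection with poles on $Z$ whose residue at $p$ has prescribed eigenvalues $\nu_p^\pm$ and acts on $\ell_p$ by $\nu_p^+$; a parabolic Higgs bundle has instead an $\mathcal{O}_X$-linear $\Theta\colon E\to E\otimes\Omega^1_X(Z)$ with nilpotent residues with null space $\ell_p$. Determinants are trivial and traces zero. On $(\mathbb{P}^1,D)$: $\bar\nu=(\pm\frac14,\pm\frac14,\pm\frac14,\pm\frac14,\pm\nu)$, $\bar\mu=(\frac12,\frac12,\frac12,\frac12,\mu)$; on $(C,T)$: $\boldsymbol\nu=(\pm\nu,\pm\nu)$, $\boldsymbol\mu=(\mu,\mu)$. Semistability: $\deg E-2\deg L+\sum_{\ell_p\not\subset L}\mu_p-\sum_{\ell_p\subset L}\mu_p\ge0$ for all line subbundles $L$ (invariant ones, for connections). $\mathrm{Con}$, $\mathrm{Higgs}$, $\mathrm{Bun}$ are the corresponding moduli spaces. The maps. The negative elementary transformation at $p$ replaces $E$ by $\ker(E\to E|_p/\ell_p)$, with new line $\ker(E^-|_p\to E|_p)$; the positive one is the twist by $\mathcal{O}(p)$ followed by it. $\Phi$: pull back by $\pi$, positive elementary transformations at $\mathbf{W}$, tensor with $(\mathcal{O}_C(-2\mathbf{w}_\infty),\xi)$, $\xi$ the pullback of $\mathrm{d}+\frac14\frac{\mathrm{d}P}{P}$ on $\mathcal{O}_{\mathbb{P}^1}(-\infty)$, $P=x(x-1)(x-\lambda)$, and forget $\mathbf{W}$. The same on bundles gives $\phi\colon\mathrm{Bun}^{\bar\mu}(\mathbb{P}^1,D)\to\mathrm{Bun}^{\boldsymbol\mu}(C,T)$,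 and the linear part gives $\Phi$ on Higgs bundles. $\Psi$ (resp. $\psi$): positive elementary transformations at $0,1,\lambda,\infty$ followed by the twist by $(\mathcal{O}_{\mathbb{P}^1}(-2),\eta)$, $\eta$ with poles at $W$ of residue $\frac12$ (resp. by $\mathcal{O}_{\mathbb{P}^1}(-2)$). Coordinates on $\mathrm{Bun}$. On $\mathbb{P}^1$: generic parabolic bundles are trivial with parabolic structure $\zeta=0,1,u_\lambda,\infty,u_t$ over $0,1,\lambda,\infty,t$, $\zeta$ denoting the line spanned by $(\zeta,1)^\top$; put $u=(u_\lambda,u_t)$. On $C$: $\mathrm{Bun}^{\boldsymbol\mu}(C,T)\cong\mathbb{P}^1_z\times\mathbb{P}^1_w$, where $z=x(\mathbf{p})$ if the underlying bundle is $S$-equivalent to $\mathbf{L}\oplus\mathbf{L}^{-1}$, $\mathbf{L}=\mathcal{O}_C(\mathbf{p}-\mathbf{w}_\infty)$, and $w$ is the $z$-coordinate of the parabolic bundle obtained by positive elementary transformations at $\mathbf{t}_1,\mathbf{t}_2$ and the twist by $\mathcal{O}_C(-\mathbf{w}_\infty)$. The map $\phi$ makes $z,w$ functions of $u$. Family. Let $$\nabla_0(u)=\mathrm{d}+\tfrac14\begin{pmatrix}-1&0\\-2-4\nu&1\end{pmatrix}\tfrac{\mathrm{d}x}{x}+\tfrac14\begin{pmatrix}1+4\nu&-4\nu\\2+4\nu&-1-4\nu\end{pmatrix}\tfrac{\mathrm{d}x}{x-1}+\tfrac14\begin{pmatrix}-1&2u_\lambda\\0&1\end{pmatrix}\tfrac{\mathrm{d}x}{x-\lambda}+\nu\begin{pmatrix}-1&2u_t\\0&1\end{pmatrix}\tfrac{\mathrm{d}x}{x-t},$$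 $$\Theta_1(u)=\begin{pmatrix}0&0\\1-u_t&0\end{pmatrix}\tfrac{\mathrm{d}x}{x}+\begin{pmatrix}u_t&-u_t\\ u_t&-u_t\end{pmatrix}\tfrac{\mathrm{d}x}{x-1}+\begin{pmatrix}-u_t&u_t^2\\-1&u_t\end{pmatrix}\tfrac{\mathrm{d}x}{x-t},$$ $$\Theta_2(u)=\begin{pmatrix}0&0\\1-u_\lambda&0\end{pmatrix}\tfrac{\mathrm{d}x}{x}+\begin{pmatrix}u_\lambda&-u_\lambda\\ u_\lambda&-u_\lambda\end{pmatrix}\tfrac{\mathrm{d}x}{x-1}+\begin{pmatrix}-u_\lambda&u_\lambda^2\\-1&u_\lambda\end{pmatrix}\tfrac{\mathrm{d}x}{x-\lambda}.$$ Put $\nabla_0^\psi(u)=\frac12(\nabla_0(u)+\Psi\nabla_0(\psi u))$, $\Theta_z=\frac12\big(\frac{\partial z}{\partial u_t}\Theta_1+\frac{\partial z}{\partial u_\lambda}\Theta_2\big)$, $\Theta_w=\frac12\big(\frac{\partial w}{\partial u_t}\Theta_1+\frac{\partial w}{\partial u_\lambda}\Theta_2\big)$, and let $\boldsymbol\nabla_0^\psi,\boldsymbol\Theta_z,\boldsymbol\Theta_w$ be their images under $\Phi$. These depend only on $\phi(u)=(z,w)$, and a generic element of $\mathrm{Con}^{\boldsymbol\mu}_{\boldsymbol\nu}(C,T)$ is uniquely $\boldsymbol\nabla_0^\psi+\kappa_1\boldsymbol\Theta_z+\kappa_2\boldsymbol\Theta_w$; this gives birational coordinates $(z,w,\kappa_1,\kappa_2)$.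 Identification and symplectic forms. $\mathrm{Higgs}^{\boldsymbol\mu}(C,T)\cong T^*\mathrm{Bun}^{\boldsymbol\mu}(C,T)$ (over stable bundles) is induced by the perfect pairing $H^0(\mathrm{End}(E,\bar\ell)\otimes\Omega^1(T))\times H^1(\mathrm{End}(E,\bar\ell))\to H^1(\Omega^1)\cong\mathbb{C}$, $(\Theta,\eta_{ij})\mapsto \mathrm{tr}(\Theta\,\eta_{ij})$; on $\mathbb{P}^1$ the analogous identification sends $\Theta_1,\Theta_2$ to $\mathrm{d}u_t,\mathrm{d}u_\lambda$. The natural (Atiyah--Bott/Goldman--Iwasaki) symplectic structure on $\mathrm{Con}^{\bar\mu}_{\bar\nu}(\mathbb{P}^1,D)$ is $\omega_{\mathbb{P}^1}=\mathrm{d}c_1\wedge\mathrm{d}u_t+\mathrm{d}c_2\wedge\mathrm{d}u_\lambda$ in the coordinates $\nabla=\nabla_0(u)+c_1\Theta_1(u)+c_2\Theta_2(u)$; $\omega_C$ denotes the natural symplectic structure on $\mathrm{Con}^{\boldsymbol\mu}_{\boldsymbol\nu}(C,T)$, which satisfies $\Phi^*\omega_C=2\omega_{\mathbb{P}^1}$. *)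

(* Defs.v *)
From HB Require Import structures.
From mathcomp Require Import all_boot all_order all_algebra all_field.
From mathcomp Require Import fraction qpoly complex.
From mathcomp Require Import all_classical all_reals all_analysis.

Set Implicit Arguments.
Unset Strict Implicit.
Unset Printing Implicit Defensive.

Import Order.TTheory GRing.Theory Num.Theory numFieldNormedType.Exports.

Local Open Scope classical_set_scope.
Local Open Scope ring_scope.

Definition mx2 (K : nmodType) (a b c d : K) : 'M[K]_2 :=
  \matrix_(i < 2, j < 2)
    if i == 0 then (if j == 0 then a else b) else (if j == 0 then c else d).

(* A smooth projective curve over F, given by its function field and its
   places.  A rational 1-form is written f dx and represented by f, for a fixed
   separating function x; ddx is the derivation d/dx. *)
Record curve (F : numClosedFieldType) := Curve {
  ffield : fieldType;
  cst : F -> ffield;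
  ddx : ffield -> ffield;
  place : choiceType;
  regular : place -> ffield -> Prop;
  unif : place -> ffield }.
Arguments regular {F c} p f.
Arguments unif {F c} p.
Arguments ddx {F c} f.

Section LocalNotions.
Variables (F : numClosedFieldType) (X : curve F).
Local Notation K := (ffield X).
Implicit Types (p : place X) (f : K).

Definition vanishes_at p f := regular p (f / unif p).

Definition unit_at p f := [/\ f != 0, regular p f & regular p f^-1].

Definition mx_regular p m n (A : 'M[K]_(m, n)) := forall i j, regular p (A i j).

Definition mx_primitive p m n (A : 'M[K]_(m, n)) :=
  mx_regular p A /\ exists i j, unit_at p (A i j).

Definition GL2_at p (G : 'M[K]_2) := mx_regular p G /\ unit_at p (\det G).

(* The residue at p of the form f dx, read off the polar part of its expansion
   in the local parameter. *)
Definition is_residue p f (a : F) :=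
  exists (n : nat) (c : nat -> F) (h : K),
    [/\ regular p h,
        f = (\sum_(k < n.+1) cst X (c k) * unif p ^- k.+1 + h) * ddx (unif p)
      & a = c 0%N].

Definition residue p f : F := xget 0 [set a | is_residue p f a].

(* Divisors are functions on places (with finite support in all uses). *)
Definition pt_div p : place X -> int := fun q => (q == p)%:Z.

End LocalNotions.

Section ParabolicBundles.
Variables (F : numClosedFieldType) (X : curve F).
Local Notation K := (ffield X).

(* Adelic description of rank 2 parabolic bundles: the generic fibre is K^2
   (column vectors), the stalk at p is the O_p-lattice spanned by the columns
   of frame p, and for p in ppts the line l_p in the fibre at p is spanned by
   the first column.  Thus frame p matters only up to right multiplication by
   GL_2(O_p), or by its upper triangular mod m_p elements when p is in ppts.
   For instance O(D) has local generators unif p ^ (- D p). *)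
Record pbundle := PBundle {
  frame : place X -> 'M[K]_2;
  ppts : pred (place X) }.

Implicit Types (E : pbundle) (p : place X) (A : 'M[K]_2).

Definition is_pbundle E :=
  [/\ forall p, \det (frame E p) != 0,
      finite_set [set p | ~ GL2_at p (frame E p)]
    & finite_set [set p | ppts E p]].

Definition pb_iso (M : 'M[K]_2) E E' :=
  [/\ \det M != 0, ppts E =1 ppts E' &
      forall p, let G := invmx (frame E' p) *m M *m frame E p in
        GL2_at p G /\ (ppts E p -> vanishes_at p (G 1 0))].

(* The connection d + A dx is represented by A; this is its image under M. *)
Definition gauge (M A : 'M[K]_2) : 'M[K]_2 :=
  (M *m A - map_mx ddx M) *m invmx M.

(* Positive elementary transformations at the places of S: from the basis
   e1, e2 of the stalk (e1 spanning the line) to e2, unif^-1 e1, and the new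
   line is spanned by e2. *)
Definition elm_plus (S : pred (place X)) E : pbundle :=
  PBundle (fun p => if S p then frame E p *m mx2 0 (unif p)^-1 1 0
                    else frame E p)
          (ppts E).

Definition twist (D : place X -> int) E : pbundle :=
  PBundle (fun p => unif p ^ (- D p) *: frame E p) (ppts E).

(* For v != 0 the vector v spans a line subbundle L of E (saturated), of which
   it is a rational section: line_order E v p n says that v has order n at p. *)
Definition line_order E (v : 'cV[K]_2) p (n : int) :=
  exists w : 'cV[K]_2,
    mx_primitive p w /\ invmx (frame E p) *m v = unif p ^ n *: w.

(* There is an exact sequence 0 -> O(D1) -> E -> O(D2) -> 0. *)
Definition extension E (D1 D2 : place X -> int) :=
  exists (v : 'cV[K]_2) (f : 'rV[K]_2),
    [/\ v != 0, f != 0, f *m v = 0 &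
        forall p, line_order E v p (D1 p) /\
          exists w : 'rV[K]_2,
            mx_primitive p w /\ f *m frame E p = unif p ^ (- D2 p) *: w].

Definition S_equivalent_sum E (D1 D2 : place X -> int) :=
  extension E D1 D2 \/ extension E D2 D1.

Definition has_degree E (d : int) :=
  exists n : place X -> int,
    (forall p, exists2 f : K, unit_at p f & \det (frame E p) = unif p ^ n p * f)
    /\ d = - \sum_(p \in [set: place X]) n p.

Definition line_has_degree E (v : 'cV[K]_2) (d : int) :=
  exists n : place X -> int,
    (forall p, line_order E v p (n p)) /\ d = \sum_(p \in [set: place X]) n p.

Definition pline_in E (v : 'cV[K]_2) p :=
  exists (n : int) (w : 'cV[K]_2),
    [/\ mx_primitive p w, invmx (frame E p) *m v = unif p ^ n *: w
      & vanishes_at p (w 1 0)].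

(* deg E - 2 deg L + sum of +mu or -mu over ppts, all weights being mu. *)
Definition par_index (mu : F) E (v : 'cV[K]_2) (x : F) :=
  exists d dL : int, [/\ has_degree E d, line_has_degree E v dL &
    x = (d - 2 * dL)%:~R
        + \sum_(p \in [set p | ppts E p]) (if `[< pline_in E v p >]
                                           then - mu else mu)].

Definition pb_stable (mu : F) E :=
  forall (v : 'cV[K]_2) (x : F), v != 0 -> par_index mu E v x -> 0 < x.

Definition conn_semistable (mu : F) E A :=
  forall (v : 'cV[K]_2) (x : F), v != 0 ->
    (exists c : K, map_mx ddx v + A *m v = c *: v) ->
    par_index mu E v x -> 0 <= x.

(* Matrix, with respect to d(unif p), of d + A dx in the frame of E at p. *)
Definition local_conn E A p : 'M[K]_2 :=
  let g := frame E p in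
  (ddx (unif p))^-1 *: (invmx g *m A *m g + invmx g *m map_mx ddx g).

Definition local_higgs E (Th : 'M[K]_2) p : 'M[K]_2 :=
  let g := frame E p in (ddx (unif p))^-1 *: (invmx g *m Th *m g).

(* B, multiplied by d(unif p), has at most a simple pole, and its residue is
   upper triangular with diagonal entries a, d. *)
Definition log_pole p (B : 'M[K]_2) (a d : F) :=
  let N := unif p *: B in
  [/\ regular p (N 0 1), vanishes_at p (N 1 0),
      vanishes_at p (N 0 0 - cst X a) & vanishes_at p (N 1 1 - cst X d)].

(* (det E, trace of the connection) is isomorphic to (O, d). *)
Definition trivial_det E A :=
  exists h : K, [/\ h != 0, (forall p, unit_at p (\det (frame E p) / h))
                  & \tr A * h + ddx h = 0].

(* (E, d + A dx) is a semistable parabolic connection with eigenvalues +nu and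
   -nu at all points of ppts, +nu on the parabolic line. *)
Definition is_Con (mu nu : F) E A :=
  [/\ is_pbundle E, trivial_det E A,
      (forall p, ~~ ppts E p -> mx_regular p (local_conn E A p)),
      (forall p, ppts E p -> log_pole p (local_conn E A p) nu (- nu))
    & conn_semistable mu E A].

Definition is_Higgs_field E (Th : 'M[K]_2) :=
  [/\ \tr Th = 0,
      (forall p, ~~ ppts E p -> mx_regular p (local_higgs E Th p))
    & (forall p, ppts E p -> log_pole p (local_higgs E Th p) 0 0)].

(* Derivative at s0 of a family of rational functions on X that lies, near s0,
   in a fixed finite-dimensional space of functions. *)
Definition is_fderive (f : F -> K) (s0 : F) (f' : K) :=
  exists (n : nat) (e : 'I_n -> K) (c : 'I_n -> F -> F) (c' : 'I_n -> F),
    [/\ forall i, is_derive s0 (1 : F) (c i) (c' i),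
        (\forall s \near s0, f s = \sum_i cst X (c i s) * e i)
      & f' = \sum_i cst X (c' i) * e i].

(* First order deformations of E are represented by families eta of elements
   eta_p of End(K^2), the lattice (with line) at p becoming (1 + s eta_p) times
   itself.  The class of eta in the quotient of the adeles of End(K^2) by
   End(K^2) and the End(E, l)_p is the class in H^1(X, End(E, l)). *)
Definition is_kodaira_spencer (E : F -> pbundle) (s0 : F)
    (eta : place X -> 'M[K]_2) :=
  forall p i j,
    is_fderive (fun s => frame (E s) p i j) s0 ((eta p *m frame (E s0) p) i j).

(* Minus the sum of residues: with the action of eta fixed above, this is the
   sign for which Theta_1, Theta_2 correspond to du_t, du_lambda on P^1. *)
Definition serre_pairing (Th eta : place X -> 'M[K]_2) : F :=
  - \sum_(p \in [set: place X]) residue p (\tr (Th p *m eta p)).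

(* Tangent vectors to the moduli of connections: a deformation eta of the
   bundle together with a deformation A + s beta of the connection. *)
Definition is_tangent (E : F -> pbundle) (A : F -> 'M[K]_2) (s0 : F)
    (T : (place X -> 'M[K]_2) * 'M[K]_2) :=
  is_kodaira_spencer E s0 T.1 /\
  forall i j, is_fderive (fun s => A s i j) s0 (T.2 i j).

Definition nabla_End A (eta : 'M[K]_2) : 'M[K]_2 :=
  map_mx ddx eta + A *m eta - eta *m A.

(* Atiyah-Bott form: cup product and trace on the first hypercohomology of
   nabla : End(E, l) -> End(E, l) (x) Omega^1(log), whose classes are the
   (eta, beta) with beta + nabla eta_p nilpotent logarithmic at every p, modulo
   (h, - nabla h) for h in End(K^2) and modulo local endomorphisms in eta. *)
Definition atiyah_bott A (T T' : (place X -> 'M[K]_2) * 'M[K]_2) : F :=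
  serre_pairing (fun=> T.2) T'.1 - serre_pairing (fun=> T'.2) T.1
  + serre_pairing (fun p => nabla_End A (T.1 p)) T'.1.

End ParabolicBundles.

Local Notation "x %:F" := (@FracField.tofrac _ x).

Section ProjectiveLine.
Variable F : numClosedFieldType.

Definition ratfun : fieldType := {fraction {poly F}}.

Definition ratfun_cst (a : F) : ratfun := (a%:P)%:F.

Definition ratfun_x : ratfun := ('X : {poly F})%:F.

Definition ratfun_deriv (f : ratfun) : ratfun :=
  let n := (frac (repr f)).1 in let d := (frac (repr f)).2 in
  (n^`() * d - n * d^`())%:F / (d ^+ 2)%:F.

Lemma ratfun_numden (f : ratfun) : f * ((frac (repr f)).2)%:F = ((frac (repr f)).1)%:F.
Proof.
rewrite -{1}[f]reprK; set r := repr f; unlock FracField.tofrac.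
rewrite -[LHS]FracField.pi_mul; apply/eqmodP => /=.
rewrite FracField.equivfE /FracField.mulf /=.
by rewrite !numden_Ratio ?mulf_neq0 ?oner_eq0 ?denom_ratioP // !mulr1 mulrC.
Qed.

(* None is the point at infinity. *)
Definition P1_unif (p : option F) : ratfun :=
  if p is Some a then ratfun_x - ratfun_cst a else ratfun_x^-1.

Definition P1_regular (p : option F) (f : ratfun) :=
  exists n d : {poly F},
    d.[0] != 0 /\
    f = (map_poly ratfun_cst n).[P1_unif p]
        / (map_poly ratfun_cst d).[P1_unif p].

Definition P1 : curve F :=
  Curve ratfun_cst ratfun_deriv P1_regular P1_unif.

End ProjectiveLine.

Section EllipticCurve.
Variables (F : numClosedFieldType) (lam : F).

Definition legendre_poly : {poly F} := 'X * ('X - 1) * ('X - lam%:P).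

Definition EC_poly : {poly (ratfun F)} := 'X^2 - ((legendre_poly)%:F)%:P.

Lemma size_legendre_poly : size legendre_poly = 4%N.
Proof.
rewrite /legendre_poly -[1]polyC1 size_Mmonic ?monicXsubC //; last first.
  by rewrite mulf_neq0 // ?polyX_eq0 // polyXsubC_eq0.
rewrite size_Mmonic ?polyX_eq0 ?monicXsubC //.
by rewrite size_polyX !size_XsubC.
Qed.

Lemma EC_poly_monic_irreducible : monic_irreducible_poly EC_poly.
Proof.
have sE : size EC_poly = 3%N.
  rewrite /EC_poly size_polyDl size_polyXn // size_polyN size_polyC.
  by case: (_ != 0).
split; last by rewrite monicE lead_coefE sE coefB coefXn coefC /= subr0.
apply: cubic_irreducible; first by rewrite sE.
move=> f; rewrite rootE !hornerE; apply/negP; rewrite subr_eq0 => /eqP fE.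
set n := (frac (repr f)).1; set d := (frac (repr f)).2.
have d0 : d != 0 by exact: denom_ratioP.
have P0 : legendre_poly != 0 by rewrite -size_poly_eq0 size_legendre_poly.
have nE : n ^+ 2 = legendre_poly * d ^+ 2.
  apply/eqP; rewrite -tofrac_eq [X in _ == X]tofracM !tofracXn -fE -exprMn.
  by rewrite ratfun_numden.
have n0 : n != 0.
  by rewrite -sqrf_eq0 nE mulf_neq0 // sqrf_eq0.
have := congr1 (fun p : {poly F} => odd (size p)) nE.
rewrite /= [in RHS]size_mul ?sqrf_eq0 // size_legendre_poly !expr2 !size_mul //.
rewrite -size_poly_gt0 in n0; rewrite -size_poly_gt0 in d0.
case: (size n) n0 => // a _; case: (size d) d0 => // b _.
by rewrite !addnS !addSn /= !oddD !addbb.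
Qed.

Definition EC_fun : fieldType := {poly %/ EC_poly with EC_poly_monic_irreducible}.

Definition pull (f : ratfun F) : EC_fun := f%:A.

Definition EC_cst (a : F) : EC_fun := pull (ratfun_cst a).

Definition EC_x : EC_fun := pull (ratfun_x F).

Definition EC_y : EC_fun := 'qX.

(* For f = A + B y, using dy/dx = P'(x) / (2 P(x)) y. *)
Definition EC_deriv (f : EC_fun) : EC_fun :=
  let A := (f : {poly ratfun F})`_0 in let B := (f : {poly ratfun F})`_1 in
  let P := (legendre_poly)%:F in let P' := (legendre_poly^`())%:F in
  pull (ratfun_deriv A)
  + pull (ratfun_deriv B + B * P' / (2%:R * P)) * EC_y.

(* Affine points of the curve, and None for the point w_oo at infinity. *)
Definition EC_point : choiceType :=
  option {ab : F * F | ab.2 ^+ 2 == legendre_poly.[ab.1]}.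

(* Affine coordinate functions around p and the values they take at p. *)
Definition EC_chart (p : EC_point) : (EC_fun * EC_fun) * (F * F) :=
  if p is Some q then ((EC_x, EC_y), val q)
  else ((EC_x / EC_y, EC_y^-1), (0, 0)).

(* The local ring at p: quotients n / d of polynomials in the coordinates of
   the chart, with d nonzero at p. *)
Definition EC_regular (p : EC_point) (f : EC_fun) :=
  let: ((xi, eta), (a, b)) := EC_chart p in
  let ev (g : {poly {poly F}}) : EC_fun :=
    (map_poly (fun q : {poly F} => (map_poly EC_cst q).[xi]) g).[eta] in
  exists n d : {poly {poly F}}, d.[b%:P].[a] != 0 /\ f = ev n / ev d.

Definition EC_unif (p : EC_point) : EC_fun :=
  if p is Some q then
    (if (val q).2 == 0 then EC_y else EC_x - EC_cst (val q).1)
  else EC_x / EC_y.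

Definition EC : curve F := Curve EC_cst EC_deriv EC_regular EC_unif.

Definition EC_proj (p : place EC) : place (P1 F) :=
  if p is Some q then Some (val q).1 else None.

Definition w_oo : place EC := None.

(* E is S-equivalent to L + L^-1 with L = O(p - w_oo) and x(p) = z. *)
Definition is_z_coord (E : pbundle EC) (z : F) :=
  exists p : place EC, EC_proj p = Some z /\
    S_equivalent_sum E (fun q => pt_div p q - pt_div w_oo q)
                       (fun q => pt_div w_oo q - pt_div p q).

Definition z_coord (E : pbundle EC) : F := xget 0 [set z | is_z_coord E z].

Definition T_transform (E : pbundle EC) : pbundle EC :=
  twist (fun q => - pt_div w_oo q) (elm_plus (ppts E) E).

Definition w_coord (E : pbundle EC) : F := z_coord (T_transform E).

End EllipticCurve.

Section Moduli.
Variables (F : numClosedFieldType) (lam t nu : F).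
Local Notation K := (ffield (P1 F)).
Local Notation C := (EC lam).
Implicit Types (u v : F * F) (f : F * F -> F).

(* In all pairs u = (u.1, u.2), u.1 is u_lambda and u.2 is u_t. *)

Definition W_pts (p : place (P1 F)) : bool :=
  if p is Some a then [|| a == 0, a == 1 | a == lam] else true.

Definition D_pts (p : place (P1 F)) : bool := W_pts p || (p == Some t).

Definition P1_lines u (p : place (P1 F)) : 'M[K]_2 :=
  let line (zeta : F) := mx2 (cst (P1 F) zeta) 1 1 0 in
  if p is Some a then
    if a == 0 then line 0 else if a == 1 then line 1 else
    if a == lam then line u.1 else if a == t then line u.2 else 1%:M
  else 1%:M.

(* The trivial bundle with lines zeta = 0, 1, u_lambda, oo, u_t. *)
Definition P1_bundle u : pbundle (P1 F) := PBundle (P1_lines u) D_pts.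

Definition dlog (a : F) : K := (ratfun_x F - ratfun_cst a)^-1.

Definition polar (M : 'M[F]_2) (a : F) : 'M[K]_2 :=
  dlog a *: map_mx (cst (P1 F)) M.

Definition nabla0 u : 'M[K]_2 :=
  let ul := u.1 in let ut := u.2 in
  polar (4%:R^-1 *: mx2 (-1) 0 (- 2%:R - 4%:R * nu) 1) 0
  + polar (4%:R^-1 *: mx2 (1 + 4%:R * nu) (- (4%:R * nu))
                          (2%:R + 4%:R * nu) (- 1 - 4%:R * nu)) 1
  + polar (4%:R^-1 *: mx2 (-1) (2%:R * ul) 0 1) lam
  + polar (nu *: mx2 (-1) (2%:R * ut) 0 1) t.

Definition Theta1 u : 'M[K]_2 :=
  let ut := u.2 in
  polar (mx2 0 0 (1 - ut) 0) 0 + polar (mx2 ut (- ut) ut (- ut)) 1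
  + polar (mx2 (- ut) (ut ^+ 2) (-1) ut) t.

Definition Theta2 u : 'M[K]_2 :=
  let ul := u.1 in
  polar (mx2 0 0 (1 - ul) 0) 0 + polar (mx2 ul (- ul) ul (- ul)) 1
  + polar (mx2 (- ul) (ul ^+ 2) (-1) ul) lam.

(* psi and Psi, with O(-2) represented by O(-2 oo) and eta by the form
   1/2 (dx/x + dx/(x - 1) + dx/(x - lam)), whose connection on O(-2 oo) has
   residue 1/2 at oo as well.  Elementary transformations do not change the
   connection on the generic fibre. *)
Definition psi_bundle (E : pbundle (P1 F)) : pbundle (P1 F) :=
  twist (fun p => - 2%:Z * pt_div (None : place (P1 F)) p) (elm_plus W_pts E).

Definition Psi_conn (A : 'M[K]_2) : 'M[K]_2 :=
  A + (ratfun_cst 2%:R^-1 * (dlog 0 + dlog 1 + dlog lam))%:M.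

(* u' = psi u *)
Definition is_psi u u' :=
  exists N : 'M[K]_2, pb_iso N (psi_bundle (P1_bundle u)) (P1_bundle u').

(* Psi (nabla0 (psi u)), transported to P1_bundle u. *)
Definition Psi_nabla0 u : 'M[K]_2 :=
  xget 0 [set B | exists (u' : F * F) (M : 'M[K]_2),
    [/\ is_psi u u', pb_iso M (psi_bundle (P1_bundle u')) (P1_bundle u)
      & B = gauge M (Psi_conn (nabla0 u'))]].

Definition nabla0_psi u : 'M[K]_2 :=
  ratfun_cst 2%:R^-1 *: (nabla0 u + Psi_nabla0 u).

(* phi and Phi.  The connection xi is the form 1/4 dP/P on O(-2 w_oo), the
   pullback of O(-oo); dropping W from ppts forgets the lines over W. *)
Definition pull_bundle (E : pbundle (P1 F)) : pbundle C :=
  PBundle (fun p : place C => map_mx (@pull F lam) (frame E (EC_proj p)))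
          (fun p : place C => ppts E (EC_proj p)).

Definition phi_bundle (E : pbundle (P1 F)) : pbundle C :=
  let E' := twist (fun p => - 2%:Z * pt_div (@w_oo F lam) p)
              (elm_plus (fun p : place C => W_pts (EC_proj p))
                 (pull_bundle E)) in
  PBundle (frame E')
          (fun p : place C => ppts E' p && ~~ W_pts (EC_proj p)).

Definition Phi_higgs (Th : 'M[K]_2) : 'M[ffield C]_2 := map_mx (@pull F lam) Th.

Definition Phi_conn (A : 'M[K]_2) : 'M[ffield C]_2 :=
  Phi_higgs A
  + (pull lam (ratfun_cst 4%:R^-1 * (dlog 0 + dlog 1 + dlog lam)))%:M.

Definition phi u : pbundle C := phi_bundle (P1_bundle u).

Definition z u : F := z_coord (phi u).
Definition w u : F := w_coord (phi u).

Definition line u v (s : F) : F * F := (u.1 + s * v.1, u.2 + s * v.2).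

Definition diff_dir f u v : F := derive1 (fun s : F => f (line u v s)) 0.

Definition Theta_of f u : 'M[K]_2 :=
  ratfun_cst 2%:R^-1 *: (ratfun_cst (diff_dir f u (0, 1)) *: Theta1 u
                         + ratfun_cst (diff_dir f u (1, 0)) *: Theta2 u).

Definition Theta_z u := Phi_higgs (Theta_of z u).
Definition Theta_w u := Phi_higgs (Theta_of w u).

(* The connection with coordinates (z u, w u, k.1, k.2). *)
Definition universal_conn u (k : F * F) : 'M[ffield C]_2 :=
  Phi_conn (nabla0_psi u)
  + cst C k.1 *: Theta_z u + cst C k.2 *: Theta_w u.

(* Near u, the functions z and w are holomorphic coordinates on the moduli of
   bundles, so that the tangent space at phi u is spanned by the images of the
   tangent vectors v at u. *)
Definition zw_chart u :=
  [/\ is_z_coord (phi u) (z u), is_z_coord (T_transform (phi u)) (w u)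
    & diff_dir z u (1, 0) * diff_dir w u (0, 1)
      - diff_dir z u (0, 1) * diff_dir w u (1, 0) != 0].

(* The covector df at phi u corresponds to the Higgs field Th:
   df (phi_* v) = <Th, Kodaira-Spencer class of phi_* v> for all v. *)
Definition corresponds f u (Th : 'M[ffield C]_2) :=
  is_Higgs_field (phi u) Th /\
  forall v, exists2 eta : place C -> 'M[ffield C]_2,
    is_kodaira_spencer (fun s => phi (line u v s)) 0 eta &
    is_derive (0 : F) (1 : F) (fun s => f (line u v s))
              (serre_pairing (fun=> Th) eta).

(* The value of dk1 /\ dz + dk2 /\ dw at (u, k) on tangent vectors V, V', with
   V.1 along u and V.2 along k. *)
Definition darboux u (V V' : (F * F) * (F * F)) : F :=
  (V.2.1 * diff_dir z u V'.1 - V'.2.1 * diff_dir z u V.1)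
  + (V.2.2 * diff_dir w u V'.1 - V'.2.2 * diff_dir w u V.1).

(* omega_C = dk1 /\ dz + dk2 /\ dw at the point (z u, w u, k.1, k.2). *)
Definition omega_is_darboux u (k : F * F) :=
  forall V V' : (F * F) * (F * F),
  let bun (V : (F * F) * (F * F)) s := phi (line u V.1 s) in
  let con (V : (F * F) * (F * F)) s :=
    universal_conn (line u V.1 s) (line k V.2 s) in
  exists T T' : (place C -> 'M[ffield C]_2) * 'M[ffield C]_2,
    [/\ is_tangent (bun V) (con V) 0 T, is_tangent (bun V') (con V') 0 T'
      & atiyah_bott (universal_conn u k) T T' = darboux u V V'].

End Moduli.

Arguments corresponds {F} lam t f u Th.

(* Main.v *)
Require Import Defs.
From HB Require Import structures.
From mathcomp Require Import all_boot all_order all_algebra all_field.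
From mathcomp Require Import fraction qpoly complex ring.
From mathcomp Require Import all_classical all_reals all_analysis.
Import Order.TTheory GRing.Theory Num.Theory numFieldNormedType.Exports.
(* cst again denotes the constants of a curve, not the constant functions. *)
Import Defs.

(** Write u = (p, q) for (u_lambda, u_t). Everything reduces to explicit formulas in p and q,
    valid over any numClosedFieldType.

    The coordinates z and w. To say that phi u is S-equivalent to L + L^-1 with
    L = O(P - w_oo) is to give a rational section with divisor P - w_oo: the determinant is
    trivial, so the quotient by the line subbundle is then L^-1 (extension_of_section). Such
    sections can be written down, for phi u (z_section) and for its transform at t_1, t_2
    (w_section), and give
      z = lambda (1 - p) / (lambda - p),   w = lambda q N1 / N2,
    where N1 is affine, and N2 affine in each of p and q. Conversely the bundle determines x(P)
    (z_coord_unique): for two such subbundles one of the maps L -> L'^{+-1} is nonzero, which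
    yields a nonzero function with at most a double pole at infinity that vanishes at a point
    over x(P) and at a point over x(P'); it is a polynomial in x of degree at most one, hence
    x(P) = x(P').

    The connection. The involution is psi (p, q) = (p, t p N1 / N2), realised by the matrix
    psi_iso p, and gauging by this matrix gives
      Psi nabla_0 (psi u) = nabla_0 u + c_1 Theta_1 + c_2 Theta_2,
      c_1 dq + c_2 dp = nu dlog (p (p - 1) (p - lambda) / N2 ^ 2).
    So the universal connection is Phi (nabla_0 + d_1 Theta_1 + d_2 Theta_2) with
    2 d_1 = c_1 + k_1 z_q + k_2 w_q and 2 d_2 = c_2 + k_1 z_p + k_2 w_p (universal_connE). Its
    matrix has simple poles over 0, 1, lambda, t, and being a parabolic connection on phi u is
    at each place a linear condition on the residues, true for all d_1, d_2; semistability is inherited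
    from the bundle (is_Con_conn_of).
    Subtracting two such connections shows that Phi (d_1 Theta_1 + d_2 Theta_2) is a parabolic
    Higgs field (is_Higgs_theta).

    Serre duality. When u moves along v, only the lines over lambda and t move, so the
    Kodaira-Spencer class is represented by multiples v.1, v.2 of the nilpotent matrix E_12
    at w_lambda and at t_1, t_2 (lines_variation_ks). Its pairing with
    Phi (d_1 Theta_1 + d_2 Theta_2) is a sum of three residues, equal to 2 (d_1 v.2 + d_2 v.1)
    because pi is ramified at w_lambda and t has two preimages (serre_poles). This 2 cancels the
    1/2 in the definition of Theta_z and Theta_w, so the pairing is dz(v), respectively dw(v).

    The symplectic form. With the same representatives the last term of the Atiyah-Bott form
    vanishes, since E_12 E_12 = 0, and what remains is 2 (dd_1 /\ dq + dd_2 /\ dp). It equals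
    dk_1 /\ dz + dk_2 /\ dw because c_1 dq + c_2 dp is closed and the second derivatives of z
    and w are symmetric (omega_darboux).

    The formulas hold where finitely many polynomials in p, q do not vanish; Q is their
    product, and each factor is nonzero because it has a nonzero value
    (bundle_generically). *)

Set Implicit Arguments.
Unset Strict Implicit.
Unset Printing Implicit Defensive.
Local Open Scope classical_set_scope.
Local Open Scope ring_scope.

(** * Local rings of a curve *)

(** The value of f at p, when f is regular there. All local computations below (orders of
    sections, regularity, residues) are carried out with values. *)
Definition has_value (F : numClosedFieldType) (X : curve F) (p : place X)
  (f : ffield X) (c : F) := vanishes_at p (f - cst X c).

Arguments has_value : simpl never.
Arguments regular : simpl never.
Arguments unif : simpl never.

(** What is used of a smooth curve: the functions regular at p form a local ring with residue
    field F, whose maximal ideal is generated by unif p. *)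
Record smooth (F : numClosedFieldType) (X : curve F) : Prop := Smooth {
  cst_zmod : zmod_morphism (cst X);
  cst_monoid : monoid_morphism (cst X);
  unif_neq0 : forall p : place X, unif p != 0;
  regular_cst : forall (p : place X) c, regular p (cst X c);
  regular_unif : forall p : place X, regular p (unif p);
  regularB : forall (p : place X) f g,
    regular p f -> regular p g -> regular p (f - g);
  regularM : forall (p : place X) f g,
    regular p f -> regular p g -> regular p (f * g);
  regular_value : forall (p : place X) f,
    regular p f -> exists c, has_value p f c;
  unif_not_unit : forall p : place X, ~ regular p (unif p)^-1;
  regularV : forall (p : place X) f,
    regular p f -> ~ vanishes_at p f -> regular p f^-1 }.

(** Both curves present their local rings as quotients n / d of elements of a polynomial ring A
    of coordinates with d nonzero at the point. The axioms of smooth follow once a function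
    that vanishes at the point is known to be divisible by the uniformizer (unif_gen). *)
Section EvaluationLocalRing.
Variables (F : numClosedFieldType) (X : curve F) (p : place X).
Variables (A : comNzRingType) (iota : {rmorphism A -> ffield X}).
Variables (ev : {rmorphism A -> F}) (s : F -> A).
Hypothesis iota_s : forall c, iota (s c) = cst X c.
Hypothesis ev_s : forall c, ev (s c) = c.
Hypothesis regE : forall f, regular p f <->
  exists n d : A, ev d != 0 /\ f = iota n / iota d.
Hypothesis ker_iota : forall a, iota a = 0 -> ev a = 0.
Hypothesis unif0 : unif p != 0.
Hypothesis unifE : exists n d : A, [/\ ev n = 0, ev d != 0 & unif p = iota n / iota d].
Hypothesis unif_gen : forall a, ev a = 0 -> regular p (iota a / unif p).

Lemma iota_neq0 d : ev d != 0 -> iota d != 0.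
Proof. by apply: contra_neq => /ker_iota. Qed.

Lemma eval_regularB f g : regular p f -> regular p g -> regular p (f - g).
Proof.
move=> /regE[n [d [d0 ->]]] /regE[n' [d' [d'0 ->]]]; apply/regE.
exists (n * d' - n' * d), (d * d'); rewrite rmorphM mulf_neq0 //; split=> //.
rewrite rmorphB !rmorphM -[in LHS]mulNr addf_div ?iota_neq0 //.
by rewrite (mulNr (iota n')).
Qed.

Lemma eval_regularM f g : regular p f -> regular p g -> regular p (f * g).
Proof.
move=> /regE[n [d [d0 ->]]] /regE[n' [d' [d'0 ->]]]; apply/regE.
exists (n * n'), (d * d'); rewrite rmorphM mulf_neq0 //; split=> //.
by rewrite !rmorphM mulf_div.
Qed.

Lemma eval_regular a : regular p (iota a).
Proof. by apply/regE; exists a, 1; rewrite !rmorph1 oner_neq0 divr1. Qed.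

Lemma eval_vanishes n d : ev n = 0 -> ev d != 0 ->
  vanishes_at p (iota n / iota d).
Proof.
move=> n0 d0; rewrite /vanishes_at -mulrA [_^-1 / _]mulrC mulrA.
apply: eval_regularM; first exact: unif_gen.
by apply/regE; exists 1, d; rewrite rmorph1 mul1r.
Qed.

Lemma eval_regular_unif : regular p (unif p).
Proof. by case: unifE => n [d [_ d0 ->]]; apply/regE; exists n, d. Qed.

Lemma eval_regular_value f : regular p f -> exists c, has_value p f c.
Proof.
move=> /regE[n [d [d0 ->]]]; exists (ev n / ev d); rewrite /has_value.
have -> : iota n / iota d - cst X (ev n / ev d)
   = iota (n - s (ev n / ev d) * d) / iota d.
  by rewrite rmorphB rmorphM iota_s mulrBl mulfK ?iota_neq0.
by apply: eval_vanishes; rewrite // rmorphB rmorphM ev_s divfK // subrr.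
Qed.

Lemma eval_value a : has_value p (iota a) (ev a).
Proof.
rewrite /has_value -iota_s -rmorphB; apply: unif_gen.
by rewrite rmorphB ev_s subrr.
Qed.

(** If 1 / unif were n' / d', a relation n n' = d d' would hold with the left side vanishing
    at the point and the right side not. *)
Lemma eval_unif_not_unit : ~ regular p (unif p)^-1.
Proof.
case: unifE => n [d [n0 d0 uE]] /regE[n' [d' [d'0 E]]].
have := mulfV unif0; rewrite E uE mulf_div -!rmorphM => /eqP.
rewrite -subr_eq0 => /eqP H.
suff: ev (n * n' - d * d') = 0.
  rewrite rmorphB !rmorphM n0 mul0r sub0r => /eqP.
  by rewrite oppr_eq0 mulf_eq0 (negbTE d0) (negbTE d'0).
apply: ker_iota; rewrite rmorphB; apply/eqP; rewrite subr_eq0; apply/eqP.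
move/eqP: H; rewrite subr_eq0 => /eqP H.
apply: (mulIf (_ : (iota (d * d'))^-1 != 0)); rewrite ?invr_eq0 ?iota_neq0 ?rmorphM ?mulf_neq0 //.
by rewrite -!rmorphM H mulfV // iota_neq0 // rmorphM mulf_neq0.
Qed.

Lemma eval_regularV f : regular p f -> ~ vanishes_at p f -> regular p f^-1.
Proof.
move=> /regE[n [d [d0 ->]]] nv; apply/regE; exists d, n.
rewrite invf_div; split=> //; apply/eqP => n0; apply: nv.
exact: eval_vanishes.
Qed.
End EvaluationLocalRing.

Section SmoothCurve.
Variables (F : numClosedFieldType) (X : curve F) (hX : smooth X).
Local Notation K := (ffield X).
Implicit Types (p : place X) (f g : K) (c : F).

Lemma cstB a b : cst X (a - b) = cst X a - cst X b.
Proof. exact: (cst_zmod hX). Qed.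

Lemma cst0 : cst X 0 = 0.
Proof. by rewrite -(subrr 0) cstB subrr. Qed.

Lemma cstN a : cst X (- a) = - cst X a.
Proof. by rewrite -[- a]sub0r cstB cst0 sub0r. Qed.

Lemma cstD a b : cst X (a + b) = cst X a + cst X b.
Proof. by rewrite -[b]opprK cstB cstN !opprK. Qed.

Lemma cst1 : cst X 1 = 1.
Proof. by case: (cst_monoid hX). Qed.

Lemma cstM a b : cst X (a * b) = cst X a * cst X b.
Proof. by case: (cst_monoid hX). Qed.

Lemma cst_eq0 a : (cst X a == 0) = (a == 0).
Proof.
apply/eqP/eqP => [|->]; last exact: cst0.
case: (eqVneq a 0) => // a0 ca0.
by have := cstM a a^-1; rewrite ca0 mul0r mulfV // cst1 => /eqP; rewrite oner_eq0.
Qed.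

Lemma cstV a : cst X a^-1 = (cst X a)^-1.
Proof.
have [->|a0] := eqVneq a 0; first by rewrite invr0 cst0 invr0.
by apply: (mulfI (_ : cst X a != 0)); rewrite ?cst_eq0 // -cstM !mulfV ?cst1 ?cst_eq0.
Qed.

Lemma regular0 p : regular p (0 : K).
Proof. by rewrite -cst0; exact: regular_cst. Qed.

Lemma regular1 p : regular p (1 : K).
Proof. by rewrite -cst1; exact: regular_cst. Qed.

Lemma regularN p f : regular p f -> regular p (- f).
Proof. by move=> fr; rewrite -sub0r; apply: regularB => //; exact: regular0. Qed.

Lemma regularD p f g : regular p f -> regular p g -> regular p (f + g).
Proof. by move=> fr gr; rewrite -[g]opprK; apply: regularB => //; exact: regularN. Qed.

Lemma regularX p f n : regular p f -> regular p (f ^+ n).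
Proof.
move=> fr; elim: n => [|n IH]; first by rewrite expr0; exact: regular1.
by rewrite exprS; apply: regularM.
Qed.

Lemma vanishes_regular p f : vanishes_at p f -> regular p f.
Proof.
move=> fv; rewrite -[f](@divfK _ (unif p)) ?unif_neq0 //.
by apply: regularM => //; exact: regular_unif.
Qed.

Lemma vanishesB p f g : vanishes_at p f -> vanishes_at p g -> vanishes_at p (f - g).
Proof. by move=> fv gv; rewrite /vanishes_at mulrBl; exact: regularB. Qed.

Lemma vanishes0 p : vanishes_at p (0 : K).
Proof. by rewrite /vanishes_at mul0r; exact: regular0. Qed.

Lemma vanishesN p f : vanishes_at p f -> vanishes_at p (- f).
Proof. by move=> fv; rewrite -sub0r; apply: vanishesB => //; exact: vanishes0. Qed.

Lemma vanishesD p f g : vanishes_at p f -> vanishes_at p g -> vanishes_at p (f + g).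
Proof. by move=> fv gv; rewrite -[g]opprK; apply: vanishesB => //; exact: vanishesN. Qed.

Lemma vanishesM p f g : vanishes_at p f -> regular p g -> vanishes_at p (f * g).
Proof. by move=> fv gr; rewrite /vanishes_at mulrAC; exact: regularM. Qed.

Lemma vanishesMl p f g : regular p f -> vanishes_at p g -> vanishes_at p (f * g).
Proof. by rewrite mulrC => fr gv; exact: vanishesM. Qed.

Lemma vanishes_unif p : vanishes_at p (unif p).
Proof. by rewrite /vanishes_at mulfV ?unif_neq0 //; exact: regular1. Qed.

Lemma vanishesP p f : vanishes_at p f <-> has_value p f 0.
Proof. by rewrite /has_value cst0 subr0. Qed.

Lemma value_regular p f c : has_value p f c -> regular p f.
Proof.
move=> fc; rewrite -[f](subrK (cst X c)); apply: regularD; last exact: regular_cst.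
exact: vanishes_regular.
Qed.

Lemma vanishes_cst p c : vanishes_at p (cst X c) -> c = 0.
Proof.
move=> cv; apply/eqP; apply/negPn/negP => c0; apply: (@unif_not_unit _ _ hX p).
rewrite -[_^-1]mul1r -(@mulVf _ (cst X c)) ?cst_eq0 // -mulrA.
by apply: regularM; rewrite // -cstV; exact: regular_cst.
Qed.

Lemma value_uniq p f c c' : has_value p f c -> has_value p f c' -> c = c'.
Proof.
move=> fc fc'; apply/eqP; rewrite -subr_eq0; apply/eqP; apply: (@vanishes_cst p).
have -> : cst X (c - c') = f - cst X c' - (f - cst X c).
  by rewrite cstB; ring.
exact: vanishesB.
Qed.

Lemma value_cst p c : has_value p (cst X c) c.
Proof. by rewrite /has_value subrr; exact: vanishes0. Qed.

Lemma value1 p : has_value p (1 : K) 1.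
Proof. by rewrite -cst1; exact: value_cst. Qed.

Lemma value0 p : has_value p (0 : K) 0.
Proof. by rewrite -cst0; exact: value_cst. Qed.

Lemma value_unif p : has_value p (unif p) 0.
Proof. by rewrite /has_value cst0 subr0; exact: vanishes_unif. Qed.

Lemma valueD p f g a b : has_value p f a -> has_value p g b ->
  has_value p (f + g) (a + b).
Proof. by move=> fa gb; rewrite /has_value cstD opprD addrACA; exact: vanishesD. Qed.

Lemma valueN p f a : has_value p f a -> has_value p (- f) (- a).
Proof. by move=> fa; rewrite /has_value cstN -opprD; exact: vanishesN. Qed.

Lemma valueB p f g a b : has_value p f a -> has_value p g b ->
  has_value p (f - g) (a - b).
Proof. by move=> fa gb; apply: valueD => //; exact: valueN. Qed.

Lemma valueM p f g a b : has_value p f a -> has_value p g b ->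
  has_value p (f * g) (a * b).
Proof.
move=> fa gb; rewrite /has_value cstM.
have -> : f * g - cst X a * cst X b = (f - cst X a) * g + cst X a * (g - cst X b).
  by rewrite mulrBl mulrBr addrA subrK.
apply: vanishesD; first by apply: vanishesM => //; exact: value_regular gb.
by apply: vanishesMl => //; exact: regular_cst.
Qed.

Lemma value0M p f g : has_value p f 0 -> regular p g -> has_value p (f * g) 0.
Proof. by move=> fa /(regular_value hX)[b gb]; rewrite -[0](mul0r b); exact: valueM. Qed.

Lemma valueX p f a n : has_value p f a -> has_value p (f ^+ n) (a ^+ n).
Proof.
move=> fa; elim: n => [|n IH]; first by rewrite !expr0; exact: value1.
by rewrite !exprS; exact: valueM.
Qed.

Lemma valueV p f a : has_value p f a -> a != 0 -> has_value p f^-1 a^-1.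
Proof.
move=> fa a0; have fr := value_regular fa.
have fv : ~ vanishes_at p f.
  by move=> /vanishesP /(value_uniq fa) /eqP; rewrite (negbTE a0).
have f0 : f != 0 by apply: contra_notN fv => /eqP ->; exact: vanishes0.
have [b fb] := regular_value hX (regularV hX fr fv).
suff -> : a^-1 = b by [].
apply: (mulfI a0); rewrite mulfV //; apply: (value_uniq (value1 p)).
by rewrite -(mulfV f0); exact: valueM.
Qed.

Lemma valueP p f : regular p f <-> exists c, has_value p f c.
Proof. by split=> [/(regular_value hX) //|[c /value_regular]]. Qed.

Lemma value_eq p f a b : has_value p f a -> a = b -> has_value p f b.
Proof. by move=> fa <-. Qed.

Lemma unit_value p f : unit_at p f <-> exists2 c, c != 0 & has_value p f c.
Proof.
split=> [[f0 /valueP[c fc] /valueP[d fd]]|[c c0 fc]].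
  exists c => //; apply/eqP => c0; have := valueM fc fd.
  by rewrite mulfV // c0 mul0r => /(value_uniq (value1 p))/eqP; rewrite oner_eq0.
split; first 1 last.
- exact: value_regular fc.
- exact: value_regular (valueV fc c0).
by apply: contra_neq c0 => f0; move: fc; rewrite f0 => /(value_uniq (value0 p)).
Qed.

Lemma unitM p f g : unit_at p f -> unit_at p g -> unit_at p (f * g).
Proof.
move=> /unit_value[a a0 fa] /unit_value[b b0 gb]; apply/unit_value.
by exists (a * b); [rewrite mulf_neq0|exact: valueM].
Qed.

Lemma unitV p f : unit_at p f -> unit_at p f^-1.
Proof. by move=> [f0 fr fr']; split; rewrite ?invr_eq0 ?invrK. Qed.

(** The difference of two expansions would be a polar part equal to a regular function;
    multiplying by the highest power of the uniformizer kills its coefficients one by one. *)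
Lemma residue_unique p f a b : ddx (unif p) != 0 ->
  is_residue p f a -> is_residue p f b -> a = b.
Proof.
move=> du; set pi := unif p => -[n [c [h [hr -> ->]]]] [m [d [k [kr E ->]]]].
have p0 : pi != 0 by exact: unif_neq0.
have {E}/eqP := mulIf du E.
pose N := (maxn n.+1 m.+1).
have pad l (e : nat -> F) : (l < N)%N ->
    \sum_(i < l.+1) cst X (e i) * pi ^- i.+1 =
    \sum_(i < N) cst X (if (i < l.+1)%N then e i else 0) * pi ^- i.+1.
  move=> lN; rewrite (big_ord_widen N (fun i => cst X (e i) * pi ^- i.+1)) //.
  by rewrite big_mkcond; apply: eq_bigr => i _; case: ifP => // _; rewrite cst0 mul0r.
rewrite (pad n c) ?(pad m d) ?leq_maxl ?leq_maxr // => {pad}.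
rewrite -subr_eq -addrA addrC eq_sym -subr_eq -sumrB => /eqP E.
pose e i := (if (i < n.+1)%N then c i else 0) - (if (i < m.+1)%N then d i else 0).
have {}E : regular p (\sum_(i < N) cst X (e i) * pi ^- i.+1).
  rewrite (eq_bigr (fun i : 'I_N => - (cst X (if (i < m.+1)%N then d i else 0) * pi ^- i.+1 -
      cst X (if (i < n.+1)%N then c i else 0) * pi ^- i.+1))).
    by rewrite sumrN E; apply: regularN; apply: regularB.
  by move=> i _; rewrite /e cstB mulrBl opprB.
suff H : forall i, (i < N)%N -> e i = 0.
  have /H : (0 < N)%N by rewrite leq_max.
  by rewrite /e /= => /eqP; rewrite subr_eq0 => /eqP.
move: E; elim: N => // N IH E.
have eN : e N = 0.
  apply: (@vanishes_cst p).
  have -> : cst X (e N) = pi ^+ N.+1 * \sum_(i < N.+1) cst X (e i) * pi ^- i.+1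
     - \sum_(i < N) cst X (e i) * pi ^+ (N - i).
    rewrite big_ord_recr /= mulrDr mulrCA mulfV ?expf_neq0 // mulr1 addrAC.
    rewrite mulr_sumr -sumrB big1 ?add0r // => i _.
    by rewrite mulrCA -expfB_cond ?(negbTE p0) ?subSS ?subrr // add0n ltnS ltnW.
  apply: vanishesB.
    by rewrite exprS -mulrA; apply: vanishesM; [exact: vanishes_unif|apply: regularM => //; apply: regularX; exact: regular_unif].
  elim/big_ind: _ => [|x y|i _]; [exact: vanishes0|exact: vanishesD|].
  apply: vanishesMl; first exact: regular_cst.
  rewrite -(@prednK (N - i)) ?subn_gt0 // exprS.
  by apply: vanishesM; [exact: vanishes_unif|apply: regularX; exact: regular_unif].
move=> i; rewrite ltnS leq_eqVlt => /orP[/eqP -> //|].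
by apply: IH; move: E; rewrite big_ord_recr /= eN cst0 mul0r addr0.
Qed.

(** All residues needed later are at simple poles, where the residue is a value. *)
Lemma residue_simple_pole p f a : ddx (unif p) != 0 ->
  has_value p (unif p * f / ddx (unif p)) a -> residue p f = a.
Proof.
move=> du fa; have p0 := unif_neq0 hX p; have ra : is_residue p f a.
  exists 0%N, (fun=> a), ((unif p * f / ddx (unif p) - cst X a) / unif p).
  split=> //; rewrite big_ord1 expr1 -mulrDl addrC subrK.
  by rewrite mulrAC divfK // [_ * f]mulrC mulfK.
by rewrite /residue; case: xgetP => [b _ rb|/(_ a) //]; exact: residue_unique rb ra.
Qed.

Lemma residue0 p : ddx (unif p) != 0 -> residue p 0 = 0.
Proof.
by move=> du; apply: residue_simple_pole; rewrite // mulr0 mul0r; exact: value0.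
Qed.

End SmoothCurve.

(** * Two by two matrices and rank 2 bundles *)

Section TwoByTwo.
Implicit Types (R : pzRingType) (K : fieldType).

Lemma ord2E (i : 'I_2) : i = 0 \/ i = 1.
Proof. by case: i => [[|[|]]] // h; [left|right]; exact: val_inj. Qed.

Lemma mx2P (V : nmodType) (A B : 'M[V]_2) :
  A 0 0 = B 0 0 -> A 0 1 = B 0 1 -> A 1 0 = B 1 0 -> A 1 1 = B 1 1 -> A = B.
Proof.
move=> h00 h01 h10 h11; apply/matrixP => i j.
by case: (ord2E i) => ->; case: (ord2E j) => ->.
Qed.

Lemma mx2_forall (V : nmodType) (A : 'M[V]_2) (P : V -> Prop) :
  P (A 0 0) -> P (A 0 1) -> P (A 1 0) -> P (A 1 1) -> forall i j, P (A i j).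
Proof. by move=> h00 h01 h10 h11 i j; case: (ord2E i) => ->; case: (ord2E j) => ->. Qed.

Lemma cv2P (V : nmodType) (A B : 'cV[V]_2) : A 0 0 = B 0 0 -> A 1 0 = B 1 0 -> A = B.
Proof. by move=> h0 h1; apply/colP => i; case: (ord2E i) => ->. Qed.

Lemma mx2_00 (V : nmodType) (a b c d : V) : mx2 a b c d 0 0 = a.
Proof. by rewrite mxE. Qed.
Lemma mx2_01 (V : nmodType) (a b c d : V) : mx2 a b c d 0 1 = b.
Proof. by rewrite mxE. Qed.
Lemma mx2_10 (V : nmodType) (a b c d : V) : mx2 a b c d 1 0 = c.
Proof. by rewrite mxE. Qed.
Lemma mx2_11 (V : nmodType) (a b c d : V) : mx2 a b c d 1 1 = d.
Proof. by rewrite mxE. Qed.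
Definition mx2E := (mx2_00, mx2_01, mx2_10, mx2_11).

Lemma mx2_eta (V : nmodType) (A : 'M[V]_2) : A = mx2 (A 0 0) (A 0 1) (A 1 0) (A 1 1).
Proof. by apply: mx2P; rewrite mx2E. Qed.

Lemma mulmx2E R m n (A : 'M[R]_(m, 2)) (B : 'M[R]_(2, n)) i j :
  (A *m B) i j = A i 0 * B 0 j + A i 1 * B 1 j.
Proof.
rewrite mxE big_ord_recl big_ord1.
by rewrite (_ : lift ord0 ord0 = 1) //; exact: val_inj.
Qed.

Lemma mul_mx2 R (a b c d a' b' c' d' : R) :
  mx2 a b c d *m mx2 a' b' c' d'
  = mx2 (a * a' + b * c') (a * b' + b * d') (c * a' + d * c') (c * b' + d * d').
Proof. by apply: mx2P; rewrite mulmx2E !mx2E. Qed.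

Lemma scale_mx2 R (k a b c d : R) :
  k *: mx2 a b c d = mx2 (k * a) (k * b) (k * c) (k * d).
Proof. by apply: mx2P; rewrite mxE !mx2E. Qed.

Lemma add_mx2 (V : nmodType) (a b c d a' b' c' d' : V) :
  mx2 a b c d + mx2 a' b' c' d' = mx2 (a + a') (b + b') (c + c') (d + d').
Proof. by apply: mx2P; rewrite mxE !mx2E. Qed.

Lemma map_mx2 (V W : nmodType) (f : V -> W) a b c d :
  map_mx f (mx2 a b c d) = mx2 (f a) (f b) (f c) (f d).
Proof. by apply: mx2P; rewrite mxE !mx2E. Qed.

Lemma det2E K (A : 'M[K]_2) : \det A = A 0 0 * A 1 1 - A 0 1 * A 1 0.
Proof.
rewrite (expand_det_row _ 0) big_ord_recl big_ord1 /cofactor !det_mx11 !mxE /=.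
rewrite (_ : lift ord0 ord0 = 1); last exact: val_inj.
rewrite (_ : lift 1 0 = 0); last exact: val_inj.
by rewrite /bump /= addn0 addn1 expr0 expr1 mul1r mulN1r mulrN.
Qed.

Lemma det_mx2 K (a b c d : K) : \det (mx2 a b c d) = a * d - b * c.
Proof. by rewrite det2E !mx2E. Qed.

Lemma scalar_mx2 R (a : R) : a%:M = mx2 a 0 0 a.
Proof. by apply: mx2P; rewrite mxE !mx2E ?mulr1n ?mulr0n. Qed.

Lemma tr_mx2 R (A : 'M[R]_2) : \tr A = A 0 0 + A 1 1.
Proof.
rewrite /mxtrace big_ord_recl big_ord1.
by rewrite (_ : lift ord0 ord0 = 1) //; exact: val_inj.
Qed.

Lemma unitmx2 K (A : 'M[K]_2) : (A \in unitmx) = (\det A != 0).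
Proof. by rewrite unitmxE unitfE. Qed.

Lemma invmx2E K (A : 'M[K]_2) : \det A != 0 ->
  invmx A = (\det A)^-1 *: mx2 (A 1 1) (- A 0 1) (- A 1 0) (A 0 0).
Proof.
move=> d0; have uA : A \in unitmx by rewrite unitmx2.
apply: (can_inj (mulKmx uA)); rewrite mulmxV // -scalemxAr.
rewrite {2}[A]mx2_eta mul_mx2 scale_mx2 -[1%:M]/(1%:M) scalar_mx2.
move: d0; rewrite det2E => d0.
by congr mx2; field.
Qed.

Lemma invmx_mx2 K (a b c d : K) : a * d - b * c != 0 ->
  invmx (mx2 a b c d) = mx2 (d / (a * d - b * c)) (- b / (a * d - b * c))
                            (- c / (a * d - b * c)) (a / (a * d - b * c)).
Proof.
move=> d0; rewrite invmx2E ?det_mx2 // !mx2E scale_mx2.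
by congr mx2; rewrite mulrC.
Qed.

(** The row vector of the linear form det (v, -), whose kernel is the line spanned by v. *)
Definition perp R (v : 'cV[R]_2) : 'rV[R]_2 :=
  \row_j (if j == 0 then - v 1 0 else v 0 0).

Lemma perp0 R (v : 'cV[R]_2) : perp v 0 0 = - v 1 0.
Proof. by rewrite mxE. Qed.
Lemma perp1 R (v : 'cV[R]_2) : perp v 0 1 = v 0 0.
Proof. by rewrite mxE. Qed.

Lemma perp_mul K (v : 'cV[K]_2) : perp v *m v = 0.
Proof.
apply/matrixP => i j; rewrite !ord1 mulmx2E perp0 perp1 mxE.
by rewrite mulNr mulrC addNr.
Qed.

Lemma perp_mulmx K (A : 'M[K]_2) (v : 'cV[K]_2) : \det A != 0 ->
  perp v *m A = \det A *: perp (invmx A *m v).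
Proof.
move=> d0; have uA : A \in unitmx by rewrite unitmx2.
rewrite -{1}[v](mulKVmx uA); set w := invmx A *m v.
apply/matrixP => i j; rewrite ord1 mulmx2E det2E [RHS]mxE.
by case: (ord2E j) => ->; rewrite !perp0 !perp1 !mulmx2E; ring.
Qed.

End TwoByTwo.

Section BundlesOnSmoothCurve.
Variables (F : numClosedFieldType) (X : curve F) (hX : smooth X).
Local Notation K := (ffield X).
Implicit Types (p : place X) (f g : K) (E : pbundle X) (M G : 'M[K]_2).

Lemma regular_mulmx p m n (A : 'M[K]_(m, 2)) (B : 'M[K]_(2, n)) :
  mx_regular p A -> mx_regular p B -> mx_regular p (A *m B).
Proof.
by move=> rA rB i j; rewrite mulmx2E; apply: regularD => //; apply: regularM.
Qed.

Lemma GL2_mul p G H : GL2_at p G -> GL2_at p H -> GL2_at p (G *m H).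
Proof.
move=> [rG uG] [rH uH]; split; first exact: regular_mulmx.
by rewrite det_mulmx; exact: unitM.
Qed.

Lemma GL2_neq0 p G : GL2_at p G -> \det G != 0.
Proof. by case=> _ []. Qed.

Lemma GL2_inv p G : GL2_at p G -> GL2_at p (invmx G).
Proof.
move=> GG; have d0 := GL2_neq0 GG; case: GG => rG uG; split.
  rewrite invmx2E // => i j; rewrite mxE; apply: regularM => //; first by case: uG.
  by move: i j; apply: mx2_forall; rewrite mx2E //; exact: regularN.
by rewrite det_inv; exact: unitV.
Qed.

Lemma pb_iso_frames (M : 'M[K]_2) E E' p : pb_iso M E E' ->
  frame E p \in unitmx /\ frame E' p \in unitmx.
Proof.
case=> _ _ /(_ p) /= [/GL2_neq0]; rewrite !det_mulmx !mulf_eq0 !negb_or !unitmx2.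
rewrite det_inv invr_eq0.
by move=> /andP[/andP[-> _] ->].
Qed.

Lemma pb_iso_comp M M' E E' E'' : pb_iso M E E' -> pb_iso M' E' E'' ->
  pb_iso (M' *m M) E E''.
Proof.
move=> iM iM'; case: (iM) => dM pM gM; case: (iM') => dM' pM' gM'; split.
- by rewrite det_mulmx mulf_neq0.
- by move=> p; rewrite pM.
move=> p; have [_ uE'] := pb_iso_frames p iM.
have -> : invmx (frame E'' p) *m (M' *m M) *m frame E p =
  (invmx (frame E'' p) *m M' *m frame E' p) *m (invmx (frame E' p) *m M *m frame E p).
  by rewrite -!mulmxA mulKVmx // !mulmxA.
case: (gM p) => gl vn; case: (gM' p) => gl' vn'; split; first exact: GL2_mul.
move=> pp; rewrite mulmx2E; apply: (vanishesD hX).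
  by apply: vanishesM => //; [apply: vn'; rewrite -pM|case: gl].
by apply: vanishesMl => //; [case: gl'|apply: vn].
Qed.

Lemma pb_iso_inv M E E' : pb_iso M E E' -> pb_iso (invmx M) E' E.
Proof.
move=> iM; case: (iM) => dM pM gM; have uM : M \in unitmx by rewrite unitmx2.
split; [by rewrite det_inv invr_eq0|by move=> p; rewrite pM|move=> p].
have [uE uE'] := pb_iso_frames p iM; have [gl vn] := gM p.
set G := _ *m _ in gl vn.
have GE : invmx G = invmx (frame E p) *m invmx M *m frame E' p.
  apply: (can_inj (mulKmx (_ : G \in unitmx))); first by rewrite unitmx2 (GL2_neq0 gl).
  rewrite mulmxV ?unitmx2 ?(GL2_neq0 gl) // /G !mulmxA mulmxK // mulmxK //.
  by rewrite mulVmx.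
rewrite /= -GE; split; first exact: GL2_inv.
move=> pp; rewrite invmx2E ?(GL2_neq0 gl) // mxE mx2E.
apply: vanishesMl => //; first by case: gl => _ [].
by apply: vanishesN => //; apply: vn; rewrite pM.
Qed.

(** The quotient of E by the saturated line subbundle L spanned by v is det E / L, and det E is
    trivialised by h. The quotient map is the form det (v, -) divided by h, so its order at p
    is opposite to that of v. *)
Lemma extension_of_section E (v : 'cV[K]_2) (D : place X -> int) (h : K) :
  h != 0 -> (forall p, unit_at p (\det (frame E p) / h)) ->
  v != 0 -> (forall p, line_order E v p (D p)) -> extension E D (fun p => - D p).
Proof.
move=> h0 uh v0 lv; exists v, (h^-1 *: perp v); split=> //.
- rewrite scaler_eq0 invr_eq0 (negbTE h0) /=; apply: contra_neq v0 => pv.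
  have /rowP/(_ 0) := pv; have /rowP/(_ 1) := pv; rewrite perp0 perp1 !mxE => e0 /eqP.
  by rewrite oppr_eq0 => /eqP e1; apply: cv2P; rewrite !mxE.
- by rewrite -scalemxAl perp_mul scaler0.
move=> p; split; first exact: lv.
have [w [[rw [i [j uw]]] wE]] := lv p; have up := uh p.
have d0 : \det (frame E p) != 0.
  by case: up; rewrite mulf_eq0 negb_or => /andP[].
exists ((\det (frame E p) / h) *: perp w); split; first split.
- move=> k l; rewrite mxE; apply: regularM => //; first by case: up.
  rewrite ord1; case: (ord2E l) => ->; rewrite ?perp0 ?perp1 //; exact: regularN.
- move: uw; rewrite (ord1 j); case: (ord2E i) => -> uw.
    by exists 0, 1; rewrite mxE perp1; exact: unitM.
  exists 0, 0; rewrite mxE perp0; apply: unitM => //.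
  have [c c0 cw] := (unit_value hX _ _).1 uw.
  by apply/(unit_value hX); exists (- c); rewrite ?oppr_eq0 //; exact: valueN.
rewrite -scalemxAl perp_mulmx // wE opprK.
have -> : perp (unif p ^ D p *: w) = unif p ^ D p *: perp w.
  by apply/rowP => k; case: (ord2E k) => ->; rewrite !mxE //= mulrN.
by rewrite !scalerA; congr (_ *: _); rewrite mulrC [_ / h]mulrC; ring.
Qed.

(** Of two line subbundles, either the second maps nontrivially to the quotient by the first, or
    they coincide. In both cases h is the matrix of this map between line bundles. *)
Lemma extension_compare E (D1 D2 D1' D2' : place X -> int) :
  (forall p, frame E p \in unitmx) ->
  extension E D1 D2 -> extension E D1' D2' ->
  exists2 h : K, h != 0 &
    (forall p, regular p (h * unif p ^ (D2 p - D1' p))) \/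
    (forall p, regular p (h * unif p ^ (D1 p - D1' p))).
Proof.
move=> uE [v [f [v0 f0 fv lv]]] [v' [f' [v'0 _ _ lv']]].
have u0 p := unif_neq0 hX p.
have [fv'0|fv'N] := eqVneq ((f *m v') 0 0) 0; last first.
  exists ((f *m v') 0 0) => //; left=> p.
  have [_ [w [[rw _] wE]]] := lv p; have [[w' [[rw' _] wE']] _] := lv' p.
  have -> : f *m v' = (f *m frame E p) *m (invmx (frame E p) *m v').
    by rewrite -mulmxA mulKVmx.
  rewrite wE wE' -scalemxAl -scalemxAr scalerA mxE mulrAC -!expfzDr //.
  have -> : - D2 p + D1' p + (D2 p - D1' p) = 0 by ring.
  by rewrite expr0z mul1r; exact: regular_mulmx.
(* f kills v and v', so these are proportional *)
have [c c0 vE] : exists2 c, c != 0 & v' = c *: v.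
  have e := congr1 (fun A : 'M[K]_1 => A 0 0) fv; rewrite /= mulmx2E mxE in e.
  rewrite mulmx2E in fv'0.
  have dv : v 0 0 * v' 1 0 = v 1 0 * v' 0 0.
    apply/eqP; rewrite -subr_eq0; apply/negPn/negP => dn.
    case/negP: f0; apply/eqP/rowP => k; rewrite mxE; apply: (mulIf dn); rewrite mul0r.
    case: (ord2E k) => ->.
      have -> : f 0 0 * (v 0 0 * v' 1 0 - v 1 0 * v' 0 0) =
        (f 0 0 * v 0 0 + f 0 1 * v 1 0) * v' 1 0 -
        (f 0 0 * v' 0 0 + f 0 1 * v' 1 0) * v 1 0 by ring.
      by rewrite e fv'0 !mul0r subrr.
    have -> : f 0 1 * (v 0 0 * v' 1 0 - v 1 0 * v' 0 0) =
        (f 0 0 * v' 0 0 + f 0 1 * v' 1 0) * v 0 0 -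
        (f 0 0 * v 0 0 + f 0 1 * v 1 0) * v' 0 0 by ring.
    by rewrite e fv'0 !mul0r subrr.
  suff [c vE] : exists c, v' = c *: v.
    by exists c => //; apply: contra_neq v'0 => c0; rewrite vE c0 scale0r.
  have [v00|v00] := eqVneq (v 0 0) 0.
    have v10 : v 1 0 != 0.
      by apply: contra_neq v0 => v10; apply: cv2P; rewrite mxE.
    exists (v' 1 0 / v 1 0); apply: cv2P; rewrite mxE ?divfK //.
    move/eqP: dv; rewrite v00 mul0r eq_sym mulf_eq0 (negbTE v10) => /eqP ->.
    by rewrite mulr0.
  exists (v' 0 0 / v 0 0); apply: cv2P; rewrite mxE ?divfK //.
  by rewrite mulrAC [_ * v 1 0]mulrC -dv mulrC mulKf.
exists c => //; right=> p.
have [[w [[rw [i [j uw]]] wE]] _] := lv p; have [[w' [[rw' _] wE']] _] := lv' p.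
have := wE'; rewrite vE -scalemxAr wE scalerA => /matrixP/(_ i j).
rewrite 2!mxE => e.
have w0 : w i j != 0 by case: uw.
have -> : c * unif p ^ (D1 p - D1' p) = w' i j * (w i j)^-1.
  apply: (mulIf (_ : unif p ^ D1' p * w i j != 0)); first by rewrite mulf_neq0 ?expfz_neq0.
  rewrite mulrA -[c * _ * _]mulrA -expfzDr // subrK e.
  by rewrite [RHS]mulrC -mulrA [_ * (w' i j / _)]mulrC divfK // .
by apply: regularM => //; case: uw.
Qed.

End BundlesOnSmoothCurve.

(** * The projective line *)

Local Notation "x %:F" := (@FracField.tofrac _ x).

Section RationalFunctions.
Variable F : numClosedFieldType.
Local Notation K := (ratfun F).

HB.instance Definition _ := GRing.RMorphism.copy (@ratfun_cst F)
  (@FracField.tofrac {poly F} \o @polyC F).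

Lemma ratfun_deriv_frac (n d : {poly F}) : d != 0 ->
  ratfun_deriv (n%:F / d%:F) = (n^`() * d - n * d^`())%:F / (d ^+ 2)%:F.
Proof.
move=> d0; rewrite /ratfun_deriv; set r := repr _.
set n' := (frac r).1; set d' := (frac r).2.
have d'0 : d' != 0 by exact: denom_ratioP.
have E : n' * d = n * d'.
  apply/eqP; rewrite -tofrac_eq !tofracM -[n'%:F](ratfun_numden) -/r -/d'.
  by rewrite mulrAC divfK // tofrac_eq0.
have E' : n'^`() * d + n' * d^`() = n^`() * d' + n * d'^`().
  by rewrite -!derivM E.
apply/eqP; rewrite eqr_div ?tofrac_eq0 ?expf_neq0 // -!tofracM tofrac_eq; apply/eqP.
have -> : (n'^`() * d' - n' * d'^`()) * d ^+ 2 =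
   d' * d * (n'^`() * d + n' * d^`()) - d' * (n' * d) * d^`() - (n' * d) * d * d'^`() by ring.
by rewrite E' E; ring.
Qed.

Lemma ratfun_fracP (f : K) : exists n d : {poly F}, d != 0 /\ f = n%:F / d%:F.
Proof.
exists (frac (repr f)).1, (frac (repr f)).2.
split; first exact: denom_ratioP.
by rewrite -ratfun_numden mulfK // tofrac_eq0 denom_ratioP.
Qed.

Lemma ratfun_derivD : {morph @ratfun_deriv F : f g / f + g}.
Proof.
move=> f g; case: (ratfun_fracP f) => n [d [d0 ->]].
case: (ratfun_fracP g) => m [e [e0 ->]].
rewrite addf_div ?tofrac_eq0 // -!tofracM -tofracD !ratfun_deriv_frac ?mulf_neq0 //.
rewrite addf_div ?tofrac_eq0 ?expf_neq0 // -!tofracM -tofracD.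
apply/eqP; rewrite eqr_div ?tofrac_eq0 ?expf_neq0 ?mulf_neq0 ?expf_neq0 //.
rewrite -!tofracM tofrac_eq !poly.derivE; apply/eqP; ring.
Qed.

Lemma ratfun_derivM (f g : K) :
  ratfun_deriv (f * g) = ratfun_deriv f * g + f * ratfun_deriv g.
Proof.
case: (ratfun_fracP f) => n [d [d0 ->]].
case: (ratfun_fracP g) => m [e [e0 ->]].
rewrite mulf_div -!tofracM !ratfun_deriv_frac ?mulf_neq0 //.
rewrite !mulf_div addf_div ?mulf_neq0 ?tofrac_eq0 ?expf_neq0 // -!tofracM -tofracD.
apply/eqP; rewrite eqr_div ?tofrac_eq0 ?expf_neq0 ?mulf_neq0 ?expf_neq0 //.
rewrite -!tofracM tofrac_eq !poly.derivE; apply/eqP; ring.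
Qed.

Lemma ratfun_deriv_poly (n : {poly F}) : ratfun_deriv n%:F = (n^`())%:F.
Proof.
rewrite -[n%:F]divr1 -tofrac1 ratfun_deriv_frac ?oner_eq0 //.
by rewrite poly.derivE mulr0 subr0 mulr1 expr1n tofrac1 divr1.
Qed.

Lemma ratfun_deriv_cst a : ratfun_deriv (ratfun_cst (a : F)) = 0.
Proof. by rewrite /ratfun_cst ratfun_deriv_poly derivC tofrac0. Qed.

Lemma ratfun_deriv_x : ratfun_deriv (ratfun_x F) = 1.
Proof. by rewrite /ratfun_x ratfun_deriv_poly derivX tofrac1. Qed.

Lemma ratfun_x_not_cst a : ratfun_x F != ratfun_cst a.
Proof.
rewrite /ratfun_x /ratfun_cst tofrac_eq; apply/eqP => /(congr1 (fun p : {poly F} => size p)).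
by rewrite size_polyX size_polyC; case: (a != 0).
Qed.

Lemma horner_ratfun (n : {poly F}) : (map_poly (@ratfun_cst F) n).[ratfun_x F] = n%:F.
Proof.
elim/poly_ind: n => [|n c IH]; first by rewrite rmorph0 horner0 tofrac0.
by rewrite rmorphD rmorphM /= map_polyX map_polyC hornerMXaddC IH tofracD tofracM.
Qed.

(** A rational function outside F is transcendental over F, because F is algebraically closed. *)
Lemma horner_ratfun_eq0 (g : K) (n : {poly F}) : (forall a, g != ratfun_cst a) ->
  (map_poly (@ratfun_cst F) n).[g] = 0 -> n = 0.
Proof.
move=> gc; have [r ->] := closed_field_poly_normal n.
rewrite map_polyZ hornerZ rmorph_prod horner_prod => /eqP.
rewrite mulf_eq0 => /orP[|].
  rewrite (fmorph_eq0 (@ratfun_cst F)) => /eqP ->; exact: scale0r.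
rewrite prodf_seq_eq0 => /hasP[a _]; rewrite rmorphB /= map_polyX map_polyC /=.
by rewrite hornerXsubC subr_eq0 (negbTE (gc a)).
Qed.

Lemma P1_unif_not_cst (p : option F) a : P1_unif p != ratfun_cst a.
Proof.
case: p => [b|] /=.
  rewrite subr_eq -(rmorphD (@ratfun_cst F)); exact: ratfun_x_not_cst.
rewrite -(inj_eq invr_inj) invrK -(fmorphV (@ratfun_cst F)); exact: ratfun_x_not_cst.
Qed.

(** Coordinate at p = the uniformizer; this is the map called iota above. *)
Definition P1_expand (p : option F) : {rmorphism {poly F} -> K} :=
  horner_eval (P1_unif p) \o map_poly (@ratfun_cst F).

Lemma P1_smooth : smooth (P1 F).
Proof.
have unif0 (p : place (P1 F)) : unif p != 0.
  by rewrite -(rmorph0 (@ratfun_cst F)); exact: P1_unif_not_cst.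
have ios (p : place (P1 F)) c : P1_expand p c%:P = cst (P1 F) c.
  by rewrite /= map_polyC /horner_eval hornerC.
have evs (c : F) : (horner_eval (0 : F)) c%:P = c by rewrite /horner_eval hornerC.
have regE (p : place (P1 F)) f : regular p f <-> exists n d : {poly F},
    horner_eval (0 : F) d != 0 /\ f = P1_expand p n / P1_expand p d by [].
have ker (p : place (P1 F)) a : P1_expand p a = 0 -> horner_eval (0 : F) a = 0.
  move=> /(horner_ratfun_eq0 (P1_unif_not_cst p)) ->; exact: rmorph0.
have expX (p : place (P1 F)) : P1_expand p 'X = unif p.
  by rewrite /= map_polyX /horner_eval hornerX.
have unifE (p : place (P1 F)) : exists n d : {poly F}, [/\ horner_eval (0 : F) n = 0,
    horner_eval (0 : F) d != 0 & unif p = P1_expand p n / P1_expand p d].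
  exists 'X, 1; rewrite /horner_eval hornerX hornerC oner_neq0 expX; split=> //.
  by rewrite rmorph1 divr1.
have gen (p : place (P1 F)) a : horner_eval (0 : F) a = 0 -> regular p (P1_expand p a / unif p).
  move=> /eqP /factor_theorem[b ->]; rewrite subr0 rmorphM expX mulfK //.
  exact: (eval_regular (regE p)).
split; first 3 last.
- by move=> p c; rewrite -(ios p); exact: (eval_regular (regE p)).
- by move=> p; exact: (eval_regular_unif (regE p) (unifE p)).
- by move=> p f g; exact: (eval_regularB (regE p) (@ker p)).
- by move=> p f g; exact: (eval_regularM (regE p)).
- by move=> p f; exact: (eval_regular_value (X := P1 F) (iota := P1_expand p) (s := @polyC F) (ios p) evs (regE p) (@ker p) (@gen p)).
- by move=> p; exact: (eval_unif_not_unit (regE p) (@ker p) (unif0 p) (unifE p)).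
- by move=> p f; exact: (eval_regularV (regE p) (@gen p)).
- exact: (rmorphB (@ratfun_cst F)).
- by split; [exact: (rmorph1 (@ratfun_cst F))|exact: (rmorphM (@ratfun_cst F))].
- exact: unif0.
Qed.

Local Notation value p f c := (has_value (p : place (P1 F)) f c).

Lemma P1_value_x (a : F) : value (Some a) (ratfun_x F) a.
Proof.
rewrite -[ratfun_x F](subrK (ratfun_cst a)) -[X in value _ _ X]add0r.
by apply: (valueD P1_smooth); [exact: (value_unif P1_smooth)|exact: (value_cst P1_smooth)].
Qed.

Lemma P1_value_oo : value None (ratfun_x F)^-1 0.
Proof. exact: (value_unif P1_smooth (None : place (P1 F))). Qed.

Lemma P1_value_poly (a : F) (n : {poly F}) : value (Some a) n%:F n.[a].
Proof.
elim/poly_ind: n => [|n c IH].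
  by rewrite tofrac0 horner0; exact: (value0 P1_smooth).
rewrite hornerMXaddC tofracD tofracM; apply: (valueD P1_smooth).
  by apply: (valueM P1_smooth) => //; exact: P1_value_x.
exact: (value_cst P1_smooth).
Qed.

(** The value at infinity of x ^- m n(x) is read off the top coefficient, as the size of n bounds
    its pole. *)
Lemma P1_value_oo_poly (n : {poly F}) m : (size n <= m.+1)%N ->
  value None (n%:F / ratfun_x F ^+ m) n`_m.
Proof.
have x0 : ratfun_x F != 0 by rewrite -(rmorph0 (@ratfun_cst F)) ratfun_x_not_cst.
elim/poly_ind: n m => [|n c IH] m sn.
  by rewrite tofrac0 mul0r coef0; exact: (value0 P1_smooth).
rewrite coefD coefC coefMX tofracD tofracM mulrDl; apply: (valueD P1_smooth); last first.
  case: m {sn} => [|m]; first by rewrite eqxx expr0 divr1; exact: (value_cst P1_smooth).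
  rewrite /=.
  rewrite -exprVn exprS mulrCA; apply: (value0M P1_smooth); first exact: P1_value_oo.
  apply: (regularM P1_smooth); first exact: (regular_cst P1_smooth).
  by apply: (regularX P1_smooth); exact: (value_regular P1_smooth P1_value_oo).
have [n0|n0] := eqVneq n 0.
  rewrite n0 tofrac0 !mul0r coef0 if_same; exact: (value0 P1_smooth).
have {}sn : (size n < m.+1)%N.
  move: sn; rewrite size_MXaddC (negbTE n0) /= => sn; exact: sn.
case: m sn => [|m] sn /=.
  by move: sn; rewrite ltnS leqn0 size_poly_eq0 (negbTE n0).
rewrite exprS invfM mulrA mulfK ?ratfun_x // -/(ratfun_x F) //; exact: IH.
Qed.

Lemma coprime_fracP (f : K) : exists n d : {poly F},
  [/\ d != 0, coprimep n d & f = n%:F / d%:F].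
Proof.
have [n [d [d0 ->]]] := ratfun_fracP f.
have g0 : gcdp n d != 0 by rewrite gcdp_eq0 negb_and d0 orbT.
have Ed : d = d %/ gcdp n d * gcdp n d by rewrite divpK ?dvdp_gcdr.
have En : n = n %/ gcdp n d * gcdp n d by rewrite divpK ?dvdp_gcdl.
have d'0 : d %/ gcdp n d != 0.
  by apply: contra_neq d0 => e; rewrite Ed e mul0r.
exists (n %/ gcdp n d), (d %/ gcdp n d); split=> //.
  by apply: coprimep_div_gcd; rewrite d0 orbT.
have -> : n%:F = (n %/ gcdp n d)%:F * (gcdp n d)%:F by rewrite -tofracM -En.
have -> : d%:F = (d %/ gcdp n d)%:F * (gcdp n d)%:F by rewrite -tofracM -Ed.
by rewrite -mulf_div divff ?mulr1 // tofrac_eq0.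
Qed.

(** At a root of the denominator the numerator would have to vanish too, against coprimality. *)
Lemma P1_regular_poly (f : K) : (forall a : F, regular (Some a : place (P1 F)) f) ->
  exists n : {poly F}, f = n%:F.
Proof.
move=> fr; have [n [d [d0 cnd E]]] := coprime_fracP f.
have [s1|s1] := eqVneq (size d) 1%N.
  have [c c0 dE] : exists2 c, c != 0 & d = c%:P by apply/size_poly1P; rewrite s1.
  exists (c^-1 *: n); rewrite E dE -mul_polyC tofracM mulrC; congr (_ * _).
  by rewrite -(fmorphV (@ratfun_cst F)).
have [a ra] := closed_rootP d s1.
have [c fc] := (valueP P1_smooth _ _).1 (fr a).
have := valueM P1_smooth fc (P1_value_poly a d).
rewrite {1}E divfK ?tofrac_eq0 // (rootP ra) mulr0.
move=> /(value_uniq P1_smooth (P1_value_poly a n)) na.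
have := coprimep_root cnd (introT rootP na); by rewrite (rootP ra) eqxx.
Qed.

(** By the same token a polynomial regular at infinity has no coefficient of positive degree. *)
Lemma P1_regular_cst (f : K) : (forall p : place (P1 F), regular p f) ->
  exists c, f = ratfun_cst c.
Proof.
move=> fr; have [n nE] := P1_regular_poly (fun a => fr (Some a)).
have [n0|n0] := eqVneq n 0; first by exists 0; rewrite nE n0 tofrac0 rmorph0.
have [s1|s1] := leqP (size n) 1.
  by exists n`_0; rewrite nE [n in LHS]size1_polyC.
have [c fc] := (valueP P1_smooth _ _).1 (fr None).
have := P1_value_oo_poly (leqSpred (size n)); rewrite -nE -/(lead_coef n).
have H : value None (f / ratfun_x F ^+ (size n).-1) 0.
  case: (size n) s1 => [|[|k]] // _ /=.
  rewrite -exprVn exprS mulrCA; apply: (value0M P1_smooth); first exact: P1_value_oo.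
  apply: (regularM P1_smooth) => //.
  by apply: (regularX P1_smooth); exact: (value_regular P1_smooth P1_value_oo).
by move=> /(value_uniq P1_smooth H)/esym/eqP; rewrite lead_coef_eq0 (negbTE n0).
Qed.

End RationalFunctions.

(** * The function field of the elliptic curve *)

Ltac split_neq0 := repeat (apply/andP; split); try assumption.

Section EllipticFunctions.
Variables (F : numClosedFieldType) (lam : F).
Hypotheses (lam0 : lam != 0) (lam1 : lam != 1).
Local Notation K := (ratfun F).
Local Notation L := (EC_fun lam).
Local Notation P := (legendre_poly lam).
Local Notation x := (EC_x lam).
Local Notation y := (EC_y lam).
Implicit Types (f g : L) (a b c d : K).

Lemma size_EC_poly : size (EC_poly lam) = 3%N.
Proof.
rewrite /EC_poly size_polyDl size_polyXn // size_polyN size_polyC.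
by case: (_ != 0).
Qed.

Lemma mk_monic_EC : mk_monic (EC_poly lam) = EC_poly lam.
Proof.
rewrite /mk_monic size_EC_poly /=.
by case: (EC_poly_monic_irreducible lam) => _ ->.
Qed.
Lemma pull_is_zmod : zmod_morphism (pull lam).
Proof. by move=> a b; rewrite /pull scalerBl. Qed.

Lemma pull_is_monoid : monoid_morphism (pull lam).
Proof.
split; first exact: scale1r.
move=> a b; rewrite /pull.
by rewrite -scalerAl mul1r scalerA.
Qed.

HB.instance Definition _ := GRing.isZmodMorphism.Build K L (pull lam) pull_is_zmod.
HB.instance Definition _ := GRing.isMonoidMorphism.Build K L (pull lam) pull_is_monoid.

Lemma pullD a b : pull lam (a + b) = pull lam a + pull lam b.
Proof. exact: (rmorphD (pull lam)). Qed.
Lemma pullN a : pull lam (- a) = - pull lam a.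
Proof. exact: (rmorphN (pull lam)). Qed.
Lemma pullM a b : pull lam (a * b) = pull lam a * pull lam b.
Proof. exact: (rmorphM (pull lam)). Qed.
Lemma pullV a : pull lam a^-1 = (pull lam a)^-1.
Proof. exact: (fmorphV (pull lam)). Qed.
Lemma pull0 : pull lam 0 = 0.
Proof. exact: (rmorph0 (pull lam)). Qed.
Lemma pull1 : pull lam 1 = 1.
Proof. exact: (rmorph1 (pull lam)). Qed.
Lemma pull_nat n : pull lam n%:R = n%:R.
Proof. exact: (rmorph_nat (pull lam)). Qed.

Definition PK : K := P%:F.
Definition dPK : K := (P^`())%:F.

Definition coefs (f : L) : {poly K} := f.

Lemma coefs_inj : injective coefs.
Proof. exact: val_inj. Qed.

Lemma coefsD f g : coefs (f + g) = coefs f + coefs g.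
Proof. by []. Qed.

Lemma coefs_pullM a f : coefs (pull lam a * f) = a *: coefs f.
Proof. by rewrite /pull -scalerAl mul1r. Qed.

Lemma coefs_pull a : coefs (pull lam a) = a%:P.
Proof. by rewrite -[pull lam a]mulr1 coefs_pullM -mul_polyC mulr1. Qed.

Lemma coefs_y : coefs y = 'X.
Proof.
apply: qpolyXE; first by rewrite size_EC_poly.
by case: (EC_poly_monic_irreducible lam).
Qed.

Lemma coefsM f g : coefs (f * g) = Pdiv.CommonRing.rmodp (coefs f * coefs g) (EC_poly lam).
Proof.
transitivity (Pdiv.CommonRing.rmodp (coefs f * coefs g) (mk_monic (EC_poly lam))) => //.
by rewrite mk_monic_EC.
Qed.

Lemma size_coefs f : (size (coefs f) <= 2)%N.
Proof.
have : (size (coefs f) < size (mk_monic (EC_poly lam)))%N by exact: size_mk_monic.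
by rewrite mk_monic_EC size_EC_poly.
Qed.

Lemma EC_coef0 a b : (coefs (pull lam a + pull lam b * y))`_0 = a.
Proof.
by rewrite coefsD coefD coefs_pullM coefs_y coefs_pull coefC coefZ coefX mulr0 addr0.
Qed.

Lemma EC_coef1 a b : (coefs (pull lam a + pull lam b * y))`_1 = b.
Proof.
by rewrite coefsD coefD coefs_pullM coefs_y coefs_pull coefC coefZ coefX mulr1 add0r.
Qed.

Lemma EC_eta f : f = pull lam (coefs f)`_0 + pull lam (coefs f)`_1 * y.
Proof.
apply: coefs_inj; apply/polyP => -[|[|i]]; rewrite ?EC_coef0 ?EC_coef1 //.
have h g : (coefs g)`_i.+2 = 0 by apply: nth_default; apply: leq_trans (size_coefs g) _.
by rewrite !h.
Qed.

Lemma EC_eq a b c d : pull lam a + pull lam b * y = pull lam c + pull lam d * y ->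
  a = c /\ b = d.
Proof.
move=> e; split.
  by rewrite -(EC_coef0 a b) -(EC_coef0 c d) e.
by rewrite -(EC_coef1 a b) -(EC_coef1 c d) e.
Qed.

Lemma EC_y2 : y ^+ 2 = pull lam PK.
Proof.
apply: coefs_inj; rewrite coefs_pull expr2 coefsM coefs_y -expr2.
have -> : 'X^2 = 1 * EC_poly lam + (P%:F)%:P :> {poly K} by rewrite mul1r subrK.
apply: Pdiv.RingMonic.rmodp_addl_mul_small.
  by case: (EC_poly_monic_irreducible lam).
by rewrite size_EC_poly size_polyC; case: (_ == 0).
Qed.

Lemma y_neq0 : y != 0.
Proof.
apply/eqP => y0; have := coefs_y; rewrite y0 => /esym/eqP.
by rewrite polyX_eq0.
Qed.

HB.instance Definition _ := GRing.RMorphism.copy (@EC_cst F lam)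
  (pull lam \o @ratfun_cst F).

Lemma legendreE : pull lam PK = x * (x - 1) * (x - EC_cst lam lam).
Proof.
by rewrite /PK /legendre_poly !tofracM !rmorphM !tofracB !rmorphB /= tofrac1 rmorph1.
Qed.

Lemma y2E : y ^+ 2 = x * (x - 1) * (x - EC_cst lam lam).
Proof. by rewrite EC_y2 legendreE. Qed.

Lemma pull_poly (n : {poly F}) : pull lam n%:F = (map_poly (@EC_cst F lam) n).[x].
Proof.
rewrite -horner_ratfun -horner_map; congr (_.[_]).
by rewrite -map_poly_comp.
Qed.

Lemma EC_mulE a b c d : (pull lam a + pull lam b * y) * (pull lam c + pull lam d * y)
  = pull lam (a * c + b * d * PK) + pull lam (a * d + b * c) * y.
Proof. rewrite !(pullD, pullM) -EC_y2.
generalize (pull lam a) (pull lam b) (pull lam c) (pull lam d) y.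
by generalize L => K0 *; ring.
Qed.

Lemma EC_derivE a b : EC_deriv (pull lam a + pull lam b * y) =
  pull lam (ratfun_deriv a)
  + pull lam (ratfun_deriv b + b * dPK / (2%:R * PK)) * y.
Proof. by rewrite /EC_deriv EC_coef0 EC_coef1. Qed.

Lemma EC_derivD f g : EC_deriv (f + g) = EC_deriv f + EC_deriv g.
Proof.
rewrite (EC_eta f) (EC_eta g); set a := _`_0; set b := _`_1; set c := _`_0; set d := _`_1.
have -> : pull lam a + pull lam b * y + (pull lam c + pull lam d * y)
  = pull lam (a + c) + pull lam (b + d) * y.
  by rewrite !pullD mulrDl addrACA.
rewrite !EC_derivE !ratfun_derivD 2!mulrDl [X in pull lam X * y]addrACA.
by rewrite [in LHS]pullD [pull lam (_ + _ + _)]pullD mulrDl addrACA.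
Qed.

Lemma P_neq0 : PK != 0.
Proof. by rewrite tofrac_eq0 -size_poly_eq0 size_legendre_poly. Qed.

(** On the term y ^ 2 = P the rule holds because dy/dx = P' y / (2 P). *)
Lemma EC_derivM f g : EC_deriv (f * g) = EC_deriv f * g + f * EC_deriv g.
Proof.
rewrite (EC_eta f) (EC_eta g); set a := _`_0; set b := _`_1; set c := _`_0; set d := _`_1.
rewrite EC_mulE !EC_derivE !EC_mulE addrACA -mulrDl -!pullD.
have p0 := P_neq0; have n2 : 2%:R != 0 :> K.
  by rewrite -(rmorph_nat (@ratfun_cst F)) fmorph_eq0 pnatr_eq0.
rewrite !(ratfun_derivD, ratfun_derivM) (ratfun_deriv_poly P) -/PK -/dPK.
congr (pull lam _ + pull lam _ * y); move: n2 p0;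
  generalize (ratfun_deriv a) (ratfun_deriv b) (ratfun_deriv c) (ratfun_deriv d);
  generalize PK dPK; generalize a b c d; generalize K;
  by move=> K0 *; field; split_neq0.
Qed.

Lemma EC_deriv_pull a : EC_deriv (pull lam a) = pull lam (ratfun_deriv a).
Proof.
have -> : pull lam a = pull lam a + pull lam 0 * y by rewrite rmorph0 mul0r addr0.
rewrite EC_derivE mul0r mul0r addr0 -[0]tofrac0 ratfun_deriv_poly linear0 tofrac0.
by rewrite rmorph0 mul0r addr0.
Qed.

Lemma EC_deriv_cst (c : F) : EC_deriv (EC_cst lam c) = 0.
Proof. by rewrite EC_deriv_pull ratfun_deriv_cst rmorph0. Qed.

Lemma EC_deriv_x : EC_deriv x = 1.
Proof. by rewrite EC_deriv_pull ratfun_deriv_x rmorph1. Qed.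

Lemma EC_deriv0 : EC_deriv (0 : L) = 0.
Proof. by rewrite -pull0 EC_deriv_pull -(rmorph0 (@ratfun_cst F)) ratfun_deriv_cst. Qed.

Lemma EC_derivN f : EC_deriv (- f) = - EC_deriv f.
Proof.
by apply/eqP; rewrite -addr_eq0 -EC_derivD addNr EC_deriv0.
Qed.

Lemma EC_derivV f : f != 0 -> EC_deriv f^-1 = - EC_deriv f / f ^+ 2.
Proof.
move=> f0; have := EC_derivM f f^-1.
rewrite mulfV // -[1]pull1 -(rmorph1 (@ratfun_cst F)) EC_deriv_cst => /esym/eqP.
rewrite addrC addr_eq0 => /eqP e; apply: (mulfI f0); rewrite e expr2 invfM.
by rewrite mulrCA [f * _]mulrA mulfV // mul1r mulNr.
Qed.

Definition EC_dP : L := pull lam dPK.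

Lemma EC_deriv_y : EC_deriv y = EC_dP / (y *+ 2).
Proof.
have n2 : 2%:R != 0 :> L by rewrite -(rmorph_nat (@EC_cst F lam)) fmorph_eq0 pnatr_eq0.
rewrite -[X in EC_deriv X]mul1r -[X in EC_deriv X]add0r -pull0 -pull1 EC_derivE.
rewrite -(rmorph0 (@ratfun_cst F)) ratfun_deriv_cst.
rewrite -(rmorph1 (@ratfun_cst F)) ratfun_deriv_cst (rmorph1 (@ratfun_cst F)).
rewrite pull0 !add0r mul1r pullM pullV pullM -EC_y2 pull_nat -/EC_dP.
move: y_neq0 n2; generalize EC_dP y; generalize L => K0 d e *.
by rewrite -[e *+ 2]mulr_natl; field; split_neq0.
Qed.

(** * Places of the elliptic curve *)

Lemma legendre_monic : P \is monic.
Proof. by rewrite /legendre_poly !monicMr ?monicX ?monicXsubC // -[1]polyC1 monicXsubC. Qed.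

Lemma horner_legendre (a : F) : P.[a] = a * (a - 1) * (a - lam).
Proof. by rewrite /legendre_poly !hornerE. Qed.

(** The three roots are distinct, since lam is neither 0 nor 1. *)
Lemma legendre_simple_root (a : F) : P.[a] = 0 ->
  exists2 P1 : {poly F}, P = P1 * ('X - a%:P) & P1.[a] != 0.
Proof.
rewrite horner_legendre => /eqP; rewrite !mulf_eq0 -orbA => /or3P[/eqP -> | | ].
- exists (('X - 1) * ('X - lam%:P)); first by rewrite /legendre_poly; ring.
  by have -> : (('X - 1) * ('X - lam%:P)).[0] = lam by rewrite !hornerE; ring.
- rewrite subr_eq0 => /eqP ->; exists ('X * ('X - lam%:P)).
    by rewrite /legendre_poly; ring.
  have -> : ('X * ('X - lam%:P)).[1] = 1 - lam by rewrite !hornerE; ring.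
  by rewrite subr_eq0 eq_sym.
rewrite subr_eq0 => /eqP ->; exists ('X * ('X - 1)); first by [].
have -> : ('X * ('X - 1)).[lam] = lam * (lam - 1) by rewrite !hornerE; ring.
by rewrite mulf_neq0 // subr_eq0.
Qed.

(** The inner variable stands for the first coordinate of the chart, the outer one for the
    second. *)
Definition EC_expand (p : EC_point lam) : {rmorphism {poly {poly F}} -> L} :=
  horner_eval (EC_chart p).1.2
  \o map_poly (horner_eval (EC_chart p).1.1 \o map_poly (@EC_cst F lam)).

Definition EC_eval (p : EC_point lam) : {rmorphism {poly {poly F}} -> F} :=
  horner_eval (EC_chart p).2.1 \o horner_eval ((EC_chart p).2.2)%:P.

Arguments EC_expand : simpl never.
Arguments EC_eval : simpl never.

Lemma EC_regularE (p : place (EC lam)) f : regular p f <->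
  exists n d : {poly {poly F}}, EC_eval p d != 0 /\ f = EC_expand p n / EC_expand p d.
Proof.
case: p => [[[a b] q]|]; rewrite /regular /EC_expand /EC_eval /= /EC_regular /=;
  by split=> -[n [d [d0 ->]]]; exists n, d.
Qed.

Lemma EC_expandC p (A : {poly F}) :
  EC_expand p A%:P = (map_poly (@EC_cst F lam) A).[(EC_chart p).1.1].
Proof. by rewrite /EC_expand /= map_polyC /horner_eval hornerC. Qed.

Lemma EC_expandD p (g h : {poly {poly F}}) :
  EC_expand p (g + h) = EC_expand p g + EC_expand p h.
Proof. exact: rmorphD. Qed.
Lemma EC_expandN p (g : {poly {poly F}}) : EC_expand p (- g) = - EC_expand p g.
Proof. exact: rmorphN. Qed.
Lemma EC_expandM p (g h : {poly {poly F}}) :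
  EC_expand p (g * h) = EC_expand p g * EC_expand p h.
Proof. exact: rmorphM. Qed.

Lemma EC_expand_cst p (c : F) : EC_expand p c%:P%:P = EC_cst lam c.
Proof. by rewrite EC_expandC map_polyC hornerC. Qed.

Lemma EC_expandX p : EC_expand p 'X = (EC_chart p).1.2.
Proof. by rewrite /EC_expand /= map_polyX /horner_eval hornerX. Qed.

Lemma EC_expandX0 p : EC_expand p 'X%:P = (EC_chart p).1.1.
Proof. by rewrite EC_expandC map_polyX hornerX. Qed.

Lemma EC_expand_poly (q : {ab : F * F | ab.2 ^+ 2 == P.[ab.1]}) (A : {poly F}) :
  EC_expand (Some q) A%:P = pull lam A%:F.
Proof. by rewrite EC_expandC pull_poly. Qed.

Lemma EC_evalC p (A : {poly F}) : EC_eval p A%:P = A.[(EC_chart p).2.1].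
Proof. by rewrite /EC_eval /= /horner_eval hornerC. Qed.

Lemma EC_evalX p : EC_eval p 'X = (EC_chart p).2.2.
Proof. by rewrite /EC_eval /= /horner_eval hornerX hornerC. Qed.

(** Induction over polynomials for relations between functions and their values. *)
Lemma EC_expand_ind p (V : L -> F -> Prop) :
  (forall c : F, V (EC_cst lam c) c) ->
  V (EC_chart p).1.1 (EC_chart p).2.1 -> V (EC_chart p).1.2 (EC_chart p).2.2 ->
  (forall f g (a b : F), V f a -> V g b -> V (f + g) (a + b)) ->
  (forall f g (a b : F), V f a -> V g b -> V (f * g) (a * b)) ->
  forall g : {poly {poly F}}, V (EC_expand p g) (EC_eval p g).
Proof.
move=> Vc Vx Vy VD VM; elim/poly_ind => [|g c IH].
  by rewrite (rmorph0 (EC_expand p)) (rmorph0 (EC_eval p)) -(rmorph0 (@EC_cst F lam)); exact: Vc.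
rewrite !rmorphD !rmorphM EC_expandX EC_evalX; apply: (VD); first exact: (VM).
rewrite EC_expandC EC_evalC; elim/poly_ind: c => [|c d IHc].
  by rewrite rmorph0 !horner0 -(rmorph0 (@EC_cst F lam)); exact: Vc.
rewrite rmorphD rmorphM /= map_polyX map_polyC !hornerMXaddC.
by apply: (VD); [exact: (VM)|exact: Vc].
Qed.

Lemma EC_expand_affine (q : {ab : F * F | ab.2 ^+ 2 == P.[ab.1]}) (g : {poly {poly F}}) :
  exists A B : {poly F}, EC_expand (Some q) g = pull lam A%:F + pull lam B%:F * y
    /\ EC_eval (Some q) g = A.[(val q).1] + B.[(val q).1] * (val q).2.
Proof.
have qP := eqP (valP q).
pose V f (c : F) := exists A B : {poly F}, f = pull lam A%:F + pull lam B%:F * y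
    /\ c = A.[(val q).1] + B.[(val q).1] * (val q).2.
apply: (@EC_expand_ind (Some q) V).
- by move=> c; exists c%:P, 0; rewrite tofrac0 pull0 horner0 hornerC !mul0r !addr0.
- by exists 'X, 0; rewrite tofrac0 pull0 horner0 hornerX !mul0r !addr0.
- exists 0, 1; rewrite tofrac0 tofrac1 pull0 pull1 horner0 hornerC !mul1r !add0r.
  by [].
- move=> _ _ _ _ [A [B [-> ->]]] [A' [B' [-> ->]]].
  by exists (A + A'), (B + B'); rewrite !tofracD !pullD !hornerD !mulrDl !addrA;
    split; rewrite addrAC [LHS]addrAC [X in X + _]addrAC.
move=> _ _ _ _ [A [B [-> ->]]] [A' [B' [-> ->]]].
exists (A * A' + B * B' * P), (A * B' + B * A'); split.
  by rewrite EC_mulE /PK -!tofracM -!tofracD.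
have -> : (A * A' + B * B' * P).[(val q).1] = A.[(val q).1] * A'.[(val q).1]
    + B.[(val q).1] * B'.[(val q).1] * P.[(val q).1] by rewrite hornerD !hornerM.
by rewrite -qP hornerD !hornerM; ring.
Qed.

(** In the chart at infinity a polynomial is A + B y with A regular at infinity in x and B of
    order at least 2 there: products stay of this form as y ^ 2 = P has a pole of order 3. *)
Lemma EC_expand_oo (g : {poly {poly F}}) : exists A B : K,
  [/\ EC_expand None g = pull lam A + pull lam B * y,
      has_value (None : place (P1 F)) A (EC_eval None g)
    & regular (None : place (P1 F)) (ratfun_x F ^+ 2 * B)].
Proof.
have hX := P1_smooth F.
pose V f (c : F) := exists A B : K, [/\ f = pull lam A + pull lam B * y,
      has_value (None : place (P1 F)) A c
    & regular (None : place (P1 F)) (ratfun_x F ^+ 2 * B)].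
have P0 : PK != 0 by exact: P_neq0.
have x0 : ratfun_x F != 0 by rewrite -(rmorph0 (@ratfun_cst F)) ratfun_x_not_cst.
have vP : has_value (None : place (P1 F)) (PK / ratfun_x F ^+ 3) 1.
  have := @P1_value_oo_poly F P 3; rewrite size_legendre_poly => /(_ isT).
  by have := monicP legendre_monic; rewrite lead_coefE size_legendre_poly => ->.
have vP' : has_value (None : place (P1 F)) (ratfun_x F ^+ 3 / PK) 1.
  by have := valueV hX vP (oner_neq0 _); rewrite invf_div invr1.
have vt := P1_value_oo F.
have rt : regular (None : place (P1 F)) (ratfun_x F)^-1 by exact: value_regular vt.
apply: (@EC_expand_ind None V).
- move=> c; exists (ratfun_cst c), 0; rewrite pull0 mul0r addr0 mulr0; split=> //.
    exact: (value_cst hX).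
  exact: (regular0 hX).
- exists 0, (ratfun_x F / PK); rewrite pull0 add0r pullM pullV -EC_y2; split.
  + by rewrite expr2 invfM -!mulrA mulVf ?mulr1 // y_neq0.
  + exact: (value0 hX).
  by rewrite mulrA -exprSr; exact: (value_regular hX vP').
- exists 0, PK^-1; rewrite pull0 add0r pullV -EC_y2; split.
  + by rewrite expr2 invfM -!mulrA mulVf ?mulr1 // y_neq0.
  + exact: (value0 hX).
  have -> : ratfun_x F ^+ 2 / PK = ratfun_x F ^+ 3 / PK * (ratfun_x F)^-1.
    by rewrite [_ ^+ 3]exprSr [RHS]mulrAC mulfK.
  by apply: (regularM hX) => //; exact: (value_regular hX vP').
- move=> _ _ a b [A [B [-> vA rB]]] [A' [B' [-> vA' rB']]].
  exists (A + A'), (B + B'); split.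
  + by rewrite !pullD mulrDl addrACA.
  + exact: (valueD hX).
  by rewrite mulrDr; exact: (regularD hX).
move=> _ _ a b [A [B [-> vA rB]]] [A' [B' [-> vA' rB']]].
exists (A * A' + B * B' * PK), (A * B' + B * A'); split.
+ exact: EC_mulE.
+ rewrite -[a * b]addr0; apply: (valueD hX); first exact: (valueM hX).
  have -> : B * B' * PK = (ratfun_x F)^-1 *
     (ratfun_x F ^+ 2 * B * (ratfun_x F ^+ 2 * B') * (PK / ratfun_x F ^+ 3)).
    move: x0; generalize PK (ratfun_x F) B B'; generalize K => K0 *.
    by field; split_neq0.
  apply: (value0M hX) => //; apply: (regularM hX); last exact: (value_regular hX vP).
  exact: (regularM hX).
rewrite mulrDr [A * _]mulrC !mulrA; apply: (regularD hX).
  by apply: (regularM hX) => //; exact: (value_regular hX vA).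
by apply: (regularM hX) => //; exact: (value_regular hX vA').
Qed.

(** The expansion of a polynomial in the form A + B y is unique and determines its value. *)
Lemma EC_expand_ker p (g : {poly {poly F}}) : EC_expand p g = 0 -> EC_eval p g = 0.
Proof.
have z0 : (0 : L) = pull lam 0 + pull lam 0 * y by rewrite pull0 mul0r addr0.
case: p => [q|].
  have [A [B [-> ->]]] := EC_expand_affine q g.
  rewrite z0 => /EC_eq[/eqP A0 /eqP B0].
  rewrite tofrac_eq0 in A0; rewrite tofrac_eq0 in B0.
  by rewrite (eqP A0) (eqP B0) !horner0 mul0r addr0.
have [A [B [-> vA _]]] := EC_expand_oo g.
rewrite z0 => /EC_eq[A0 _]; apply: (value_uniq (P1_smooth F) vA).
by rewrite A0; exact: (value0 (P1_smooth F)).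
Qed.

Lemma EC_unif_oo : unif (None : place (EC lam)) = x / y.
Proof. by []. Qed.

Lemma EC_unif_affine (q : {ab : F * F | ab.2 ^+ 2 == P.[ab.1]}) :
  unif (Some q : place (EC lam)) = if (val q).2 == 0 then y else x - EC_cst lam (val q).1.
Proof. by []. Qed.

Lemma EC_unif_neq0 (p : place (EC lam)) : unif p != 0.
Proof.
have xc (c : F) : x != EC_cst lam c.
  by rewrite /EC_x /EC_cst (inj_eq (fmorph_inj (pull lam))) ratfun_x_not_cst.
case: p => [q|] /=; last first.
  rewrite /unif /= mulf_neq0 ?invr_eq0 ?y_neq0 // -(rmorph0 (@EC_cst F lam)).
  exact: xc.
by rewrite /unif /= /EC_unif; case: ifP => _; [exact: y_neq0|rewrite subr_eq0].
Qed.

Lemma EC_unifE (p : place (EC lam)) : exists n d : {poly {poly F}},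
  [/\ EC_eval p n = 0, EC_eval p d != 0 & unif p = EC_expand p n / EC_expand p d].
Proof.
have one q : EC_eval q 1 != 0 by rewrite rmorph1 oner_neq0.
case: p => [q|]; last first.
  by exists 'X%:P, 1; rewrite EC_evalC hornerX EC_expandX0 (rmorph1 (EC_expand None)) divr1.
rewrite EC_unif_affine; case: ifP => [/eqP b0|_].
  by exists 'X, 1; rewrite EC_evalX EC_expandX (rmorph1 (EC_expand (Some q))) divr1.
exists ('X - (val q).1%:P)%:P, 1.
rewrite EC_evalC hornerXsubC subrr (rmorph1 (EC_expand (Some q))) divr1; split=> //.
by rewrite EC_expand_poly tofracB pullD pullN.
Qed.

(** The uniformizers generate the maximal ideals. At infinity, with s = x / y and r = 1 / y, the
    equation reads r = s (s - r) (s - lam r), so r is divisible by s. At a ramification point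
    x - a = y ^ 2 / P1(x). Elsewhere multiplying by y + b makes the divisibility by x - a
    visible. *)
Lemma EC_unif_gen (p : place (EC lam)) (g : {poly {poly F}}) : EC_eval p g = 0 ->
  regular p (EC_expand p g / unif p).
Proof.
case: p => [q|]; last first.
  elim/poly_ind: g => [|g c _].
    by move=> _; rewrite rmorph0 mul0r -(rmorph0 (EC_expand None)); exact: (eval_regular (X := EC lam) (iota := EC_expand None) (EC_regularE None)).
  rewrite rmorphD rmorphM EC_evalX mulr0 add0r EC_evalC => /= c0.
  have [c1 ->] := factor_theorem _ _ (introT rootP c0); rewrite subr0.
  have -> : EC_expand None (g * 'X + (c1 * 'X)%:P) / unif (None : place (EC lam)) =
    EC_expand None (g * ('X%:P - 'X) * ('X%:P - lam%:P%:P * 'X) + c1%:P).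
    rewrite polyCM !(EC_expandD, EC_expandM, EC_expandN) EC_expand_cst.
    rewrite EC_expandX EC_expandX0 EC_unif_oo /=.
    have y0 := y_neq0; have x0 : x != 0.
      by have := EC_unif_neq0 None; rewrite mulf_eq0 invr_eq0 (negbTE y0) orbF.
    rewrite mulrDl mulfK ?mulf_neq0 ?invr_eq0 //; congr (_ + _).
    have id (K0 : fieldType) (s r l : K0) : s != 0 -> r != 0 ->
        r ^+ 2 = s * (s - 1) * (s - l) ->
        r^-1 / (s / r) = (s / r - r^-1) * (s / r - l / r).
      move=> s0 r0 e; have -> : r^-1 / (s / r) = s^-1 by field; split_neq0.
      have -> : (s / r - r^-1) * (s / r - l / r) = (s * (s - 1) * (s - l)) / (s * r ^+ 2).
        by field; split_neq0.
      by rewrite -e; field; split_neq0.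
    by rewrite -!mulrA; congr (_ * _); apply: id => //; exact: y2E.
  exact: (eval_regular (X := EC lam) (iota := EC_expand None) (EC_regularE None)).
have qP := eqP (valP q); have [A [B [-> ->]]] := EC_expand_affine q g.
move: qP; case: q => [[a b] /= qq] qP v0; rewrite EC_unif_affine /=.
set q : EC_point lam := Some _.
have [b0|b0] := eqVneq b 0.
  rewrite b0 mulr0 addr0 in v0; have [A1 AE] := factor_theorem _ _ (introT rootP v0).
  have [|P1 PE P10] := @legendre_simple_root a; first by rewrite -qP b0 expr0n.
  apply/EC_regularE; exists (A1%:P * 'X + (B * P1)%:P), P1%:P.
  rewrite EC_evalC; split; first exact: P10.
  have P1n : pull lam P1%:F != 0.
    rewrite fmorph_eq0 tofrac_eq0; apply: contra_neq P10 => ->; exact: horner0.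
  rewrite EC_expandD EC_expandM !EC_expand_poly EC_expandX AE !tofracM !pullM /=.
  have := EC_y2; rewrite /PK PE tofracM pullM.
  have id (K0 : fieldType) (d p1 a1 b1 r : K0) : p1 != 0 -> r != 0 -> r ^+ 2 = p1 * d ->
      (a1 * d + b1 * r) / r = (a1 * r + b1 * p1) / p1.
    move=> p10 r0 e; rewrite (_ : d = r ^+ 2 / p1); last by rewrite e mulrC mulKf.
    by field; split_neq0.
  by move=> e; apply: id => //; exact: y_neq0.
have div (R : {poly F}) : exists R1, R - R.[a]%:P = R1 * ('X - a%:P).
  by apply/factor_theorem; rewrite rootE hornerD hornerN hornerC subrr.
have [A1 AE] := div A; have [B1 BE] := div B; have [P1 PE] := div P.
have pullC (c : F) : pull lam (c%:P)%:F = EC_cst lam c by [].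
have pullE (R R1 : {poly F}) : R - R.[a]%:P = R1 * ('X - a%:P) ->
    pull lam R%:F = pull lam R1%:F * (x - EC_cst lam a) + EC_cst lam R.[a].
  move=> /(canRL (subrK _)) {1}->.
  by rewrite tofracD tofracM tofracB pullD pullM pullD pullN !pullC.
apply/EC_regularE.
exists ((A1%:P + B1%:P * 'X) * ('X + b%:P%:P) + (B.[a]%:P * P1)%:P), ('X + b%:P%:P).
have yb : EC_eval q ('X + b%:P%:P) != 0.
  by rewrite rmorphD EC_evalX EC_evalC hornerC /= -mulr2n mulrn_eq0.
split=> //; have {}yb : EC_expand q ('X + b%:P%:P) != 0.
  by apply: contra_neq yb => /EC_expand_ker.
move: yb; rewrite polyCM !(EC_expandD, EC_expandM) !EC_expand_cst !EC_expand_poly EC_expandX /=.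
have xa0 : x - EC_cst lam a != 0.
  by have := EC_unif_neq0 q; rewrite EC_unif_affine /= (negbTE b0).
have P'E := pullE _ _ PE; rewrite -/PK -EC_y2 -qP (rmorphXn (@EC_cst F lam)) in P'E.
rewrite (pullE _ _ AE) (pullE _ _ BE) (_ : A.[a] = - (B.[a] * b)); last first.
  by apply/eqP; rewrite -addr_eq0 v0.
rewrite (rmorphN (@EC_cst F lam)) (rmorphM (@EC_cst F lam)) => yb.
have id (K0 : fieldType) (d a1 b1 c e p1 r : K0) : d != 0 -> r + e != 0 ->
    r ^+ 2 = p1 * d + e ^+ 2 ->
    (a1 * d + - (c * e) + (b1 * d + c) * r) / d
    = ((a1 + b1 * r) * (r + e) + c * p1) / (r + e).
  move=> d0 re0 h; rewrite (_ : p1 = (r ^+ 2 - e ^+ 2) / d); last by rewrite h addrK mulfK.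
  by field; split_neq0.
exact: id.
Qed.

Lemma EC_smooth : smooth (EC lam).
Proof.
split.
- exact: (rmorphB (@EC_cst F lam)).
- by split; [exact: (rmorph1 (@EC_cst F lam))|exact: (rmorphM (@EC_cst F lam))].
- exact: EC_unif_neq0.
- move=> p c; have <- : EC_expand p c%:P%:P = cst (EC lam) c by exact: EC_expand_cst.
  exact: (eval_regular (X := EC lam) (iota := EC_expand p) (EC_regularE p)).
- by move=> p; exact: (eval_regular_unif (X := EC lam) (iota := EC_expand p) (EC_regularE p) (EC_unifE p)).
- by move=> p f g; exact: (eval_regularB (X := EC lam) (iota := EC_expand p) (EC_regularE p) (@EC_expand_ker p)).
- by move=> p f g; exact: (eval_regularM (X := EC lam) (iota := EC_expand p) (EC_regularE p)).
- move=> p f; have evs (c : F) : EC_eval p c%:P%:P = c by rewrite EC_evalC hornerC.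
  have ios (c : F) : EC_expand p c%:P%:P = cst (EC lam) c by exact: EC_expand_cst.
  exact: (eval_regular_value (X := EC lam) (iota := EC_expand p)
    (ev := EC_eval p) (s := fun c : F => c%:P%:P) ios evs (EC_regularE p) (@EC_expand_ker p) (@EC_unif_gen p)).
- by move=> p; exact: (eval_unif_not_unit (X := EC lam) (iota := EC_expand p)
    (EC_regularE p) (@EC_expand_ker p) (EC_unif_neq0 p) (EC_unifE p)).
by move=> p f; exact: (eval_regularV (X := EC lam) (iota := EC_expand p) (EC_regularE p) (@EC_unif_gen p)).
Qed.

Lemma EC_value_expand (p : place (EC lam)) (g : {poly {poly F}}) :
  has_value p (EC_expand p g) (EC_eval p g).
Proof.
have evs (c : F) : EC_eval p c%:P%:P = c by rewrite EC_evalC hornerC.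
have ios (c : F) : EC_expand p c%:P%:P = cst (EC lam) c by exact: EC_expand_cst.
exact: (eval_value (X := EC lam) (iota := EC_expand p)
    (ev := EC_eval p) (s := fun c : F => c%:P%:P) ios evs (@EC_unif_gen p)).
Qed.

Local Notation affine_point := {ab : F * F | ab.2 ^+ 2 == P.[ab.1]}.

Lemma EC_value_x (q : affine_point) : has_value (Some q : place (EC lam)) x (val q).1.
Proof. by have := EC_value_expand (Some q) 'X%:P; rewrite EC_expandX0 EC_evalC hornerX. Qed.

Lemma EC_value_y (q : affine_point) : has_value (Some q : place (EC lam)) y (val q).2.
Proof. by have := EC_value_expand (Some q) 'X; rewrite EC_expandX EC_evalX. Qed.

Lemma x_neq_cst (c : F) : x != EC_cst lam c.
Proof. by rewrite /EC_x /EC_cst (inj_eq (fmorph_inj (pull lam))) ratfun_x_not_cst. Qed.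

Lemma x_neq0 : x != 0.
Proof. by rewrite -(rmorph0 (@EC_cst F lam)) x_neq_cst. Qed.

(** The function 1 / x equals (s - r) (s - lam r) for the coordinates s = x / y and r = 1 / y of
    the chart at infinity. *)
Lemma EC_value_oo_x : has_value (None : place (EC lam)) x^-1 0.
Proof.
have := EC_value_expand None (('X%:P - 'X) * ('X%:P - lam%:P%:P * 'X)).
have -> : EC_eval None (('X%:P - 'X) * ('X%:P - lam%:P%:P * 'X)) = 0.
  by rewrite (rmorphM (EC_eval None)) (rmorphB (EC_eval None)) EC_evalC EC_evalX hornerX subrr mul0r.
rewrite !(EC_expandD, EC_expandM, EC_expandN) EC_expand_cst EC_expandX EC_expandX0 /=.
have id (K0 : fieldType) (s r l : K0) : s != 0 -> r != 0 ->
    r ^+ 2 = s * (s - 1) * (s - l) -> (s / r - r^-1) * (s / r - l / r) = s^-1.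
  move=> s0 r0 e.
  have -> : (s / r - r^-1) * (s / r - l / r) = (s * (s - 1) * (s - l)) / (s * r ^+ 2).
    by field; split_neq0.
  by rewrite -e; field; split_neq0.
by rewrite id // ?x_neq0 ?y_neq0 // y2E.
Qed.

Lemma pull_map_poly (n : {poly F}) (g : K) :
  pull lam (map_poly (@ratfun_cst F) n).[g] = (map_poly (@EC_cst F lam) n).[pull lam g].
Proof. by rewrite -horner_map -map_poly_comp. Qed.

Lemma value_horner (p : place (EC lam)) f (c : F) (n : {poly F}) : has_value p f c ->
  has_value p (map_poly (@EC_cst F lam) n).[f] n.[c].
Proof.
move=> fc; elim/poly_ind: n => [|n d IH].
  by rewrite rmorph0 !horner0; exact: (value0 EC_smooth).
rewrite rmorphD rmorphM /= map_polyX map_polyC !hornerMXaddC.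
apply: (valueD EC_smooth); first exact: (valueM EC_smooth).
exact: (value_cst EC_smooth).
Qed.

(** The projection to P^1 maps the coordinates of a point to those of its image. *)
Lemma pull_value (p : place (EC lam)) (g : K) (c : F) :
  has_value (EC_proj p : place (P1 F)) g c -> has_value p (pull lam g) c.
Proof.
move=> gc; have [n [d [d0 E]]] : P1_regular (EC_proj p) g by exact: (value_regular (P1_smooth F) gc).
have vp : has_value p (pull lam (P1_unif (EC_proj p))) 0.
  case: p {gc E} => [q|] /=.
    have -> : pull lam (ratfun_x F - ratfun_cst (\val q).1) = x - EC_cst lam (val q).1.
      by rewrite pullD pullN.
    rewrite -(subrr (val q).1); apply: (valueB EC_smooth); first exact: EC_value_x.
    exact: (value_cst EC_smooth).
  by rewrite pullV; exact: EC_value_oo_x.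
have vP : has_value (EC_proj p : place (P1 F)) g (n.[0] / d.[0]).
  have ev (m : {poly F}) : has_value (EC_proj p : place (P1 F)) (P1_expand (EC_proj p) m) m.[0].
    elim/poly_ind: m => [|m b IH].
      by rewrite rmorph0 horner0; exact: (value0 (P1_smooth F)).
    rewrite rmorphD rmorphM /= /horner_eval map_polyX map_polyC hornerX hornerC hornerMXaddC.
    apply: (valueD (P1_smooth F)); last exact: (value_cst (P1_smooth F)).
    by apply: (valueM (P1_smooth F)) => //; exact: (value_unif (P1_smooth F)).
  rewrite E; apply: (valueM (P1_smooth F)); first exact: ev.
  by apply: (valueV (P1_smooth F)) => //; exact: ev.
rewrite (value_uniq (P1_smooth F) gc vP) E pullM pullV !pull_map_poly.
apply: (valueM EC_smooth); first exact: value_horner.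
by apply: (valueV EC_smooth) => //; exact: value_horner.
Qed.

(** * Uniqueness of the coordinate z *)

(** The hyperelliptic involution sends y to - y. *)
Definition EC_conj f : L := pull lam (coefs f)`_0 - pull lam (coefs f)`_1 * y.

Lemma EC_conjE a b : EC_conj (pull lam a + pull lam b * y) = pull lam a - pull lam b * y.
Proof. by rewrite /EC_conj EC_coef0 EC_coef1. Qed.

Lemma EC_conjM f g : EC_conj (f * g) = EC_conj f * EC_conj g.
Proof.
rewrite (EC_eta f) (EC_eta g) EC_mulE !EC_conjE.
rewrite -!mulNr -!pullN EC_mulE; congr (pull lam _ + pull lam _ * y).
  by rewrite mulrNN.
by rewrite opprD mulrN mulNr.
Qed.

Lemma EC_conj1 : EC_conj 1 = 1.
Proof.
have -> : (1 : L) = pull lam 1 + pull lam 0 * y by rewrite pull0 pull1 mul0r addr0.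
by rewrite EC_conjE pull0 pull1 mul0r subr0 addr0.
Qed.

Lemma EC_conjV f : f != 0 -> EC_conj f^-1 = (EC_conj f)^-1.
Proof.
move=> f0; have := EC_conjM f f^-1; rewrite mulfV // EC_conj1 => e.
have c0 : EC_conj f != 0.
  by apply/eqP => c0; move/eqP: e; rewrite c0 mul0r oner_eq0.
by apply: (mulfI c0); rewrite -e mulfV.
Qed.

Lemma conj_point_subproof (q : affine_point) : (- (val q).2) ^+ 2 == P.[(val q).1].
Proof. by rewrite sqrrN; exact: (valP q). Qed.

Definition conj_point (q : affine_point) : affine_point :=
  exist _ ((val q).1, - (val q).2) (conj_point_subproof q).

Lemma EC_conj_regular (q : affine_point) f :
  regular (Some (conj_point q) : place (EC lam)) f -> regular (Some q : place (EC lam)) (EC_conj f).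
Proof.
have conj_expand (g : {poly {poly F}}) : exists g' : {poly {poly F}}, EC_conj (EC_expand (Some (conj_point q)) g)
    = EC_expand (Some q) g' /\ EC_eval (Some q) g' = EC_eval (Some (conj_point q)) g.
  have [A [B [-> ->]]] := EC_expand_affine (conj_point q) g.
  exists (A%:P - B%:P * 'X); rewrite EC_conjE EC_expandD EC_expandN EC_expandM.
  rewrite !EC_expand_poly EC_expandX; split=> //.
  rewrite (rmorphB (EC_eval _)) (rmorphM (EC_eval _)) !EC_evalC EC_evalX /=.
  by rewrite mulrN.
move=> /EC_regularE[n [d [d0 ->]]]; apply/EC_regularE.
have [n' [n'E _]] := conj_expand n; have [d' [d'E d'v]] := conj_expand d.
exists n', d'; rewrite d'v; split=> //.
rewrite EC_conjM EC_conjV ?n'E ?d'E //.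
by apply: contra_neq d0 => /EC_expand_ker.
Qed.

Lemma point_over (a : F) : exists q : affine_point, (val q).1 = a.
Proof.
have h : (sqrtC P.[a]) ^+ 2 == P.[a] by rewrite sqrtCK.
by exists (exist _ (a, sqrtC P.[a]) h).
Qed.

Lemma EC_value_poly (q : affine_point) (n : {poly F}) :
  has_value (Some q : place (EC lam)) (pull lam n%:F) n.[(val q).1].
Proof. by apply: pull_value; exact: P1_value_poly. Qed.

(** The argument is that of P1_regular_poly, with the values taken at a point above the root. *)
Lemma pull_regular_poly (g : K) :
  (forall q : affine_point, regular (Some q : place (EC lam)) (pull lam g)) ->
  exists n : {poly F}, g = n%:F.
Proof.
move=> gr; have [n [d [d0 cnd E]]] := coprime_fracP g.
have [s1|s1] := eqVneq (size d) 1%N.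
  have [c c0 dE] : exists2 c, c != 0 & d = c%:P by apply/size_poly1P; rewrite s1.
  exists (c^-1 *: n); rewrite E dE -mul_polyC tofracM mulrC; congr (_ * _).
  by rewrite -(fmorphV (@ratfun_cst F)).
have [a ra] := closed_rootP d s1; have [q qa] := point_over a.
have [c fc] := (valueP EC_smooth _ _).1 (gr q).
have := valueM EC_smooth fc (EC_value_poly q d).
rewrite -pullM {1}E divfK ?tofrac_eq0 // qa (rootP ra) mulr0.
move=> /(value_uniq EC_smooth (EC_value_poly q n)) na; rewrite qa in na.
by have := coprimep_root cnd (introT rootP na); rewrite (rootP ra) eqxx.
Qed.

Lemma nat2_neq0 : (2%:R : L) != 0.
Proof. by rewrite -(rmorph_nat (@EC_cst F lam)) fmorph_eq0 pnatr_eq0. Qed.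

(** The trace A of f and the norm of its odd part B y have no poles at finite distance, so they
    are polynomials. As P has simple roots, B ^ 2 P can be a polynomial only if B is one. *)
Lemma affine_functions f :
  (forall q : affine_point, regular (Some q : place (EC lam)) f) ->
  exists A B : {poly F}, f = pull lam A%:F + pull lam B%:F * y.
Proof.
move=> fr; have fr' (q : affine_point) : regular (Some q : place (EC lam)) (EC_conj f).
  exact: EC_conj_regular.
set a := (coefs f)`_0; set b := (coefs f)`_1.
have fE : f = pull lam a + pull lam b * y by exact: EC_eta.
have cE : EC_conj f = pull lam a - pull lam b * y by [].
clearbody a b.
have r2 (q : affine_point) : regular (Some q : place (EC lam)) ((2%:R)^-1 : L).
  have -> : (2%:R)^-1 = cst (EC lam) (2%:R^-1).
    by rewrite /= (fmorphV (@EC_cst F lam)) (rmorph_nat (@EC_cst F lam)).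
  exact: (regular_cst EC_smooth).
have [A AE] : exists n : {poly F}, a = n%:F.
  apply: pull_regular_poly => q.
  have -> : pull lam a = (f + EC_conj f) / 2%:R.
    have n2 := nat2_neq0; rewrite cE fE.
    have id (K0 : fieldType) (u v : K0) : 2%:R != 0 :> K0 -> u = (u + v + (u - v)) / 2%:R.
      by move=> ?; field.
    exact: id.
  by apply: (regularM EC_smooth) => //; exact: (regularD EC_smooth).
have byr (q : affine_point) : regular (Some q : place (EC lam)) (pull lam b * y).
  have -> : pull lam b * y = f - pull lam A%:F by rewrite fE AE addrC addKr.
  by apply: (regularB EC_smooth) => //; exact: (value_regular EC_smooth (EC_value_poly q A)).
have [s sE] : exists n : {poly F}, b ^+ 2 * PK = n%:F.
  apply: pull_regular_poly => q; rewrite pullM expr2 pullM -EC_y2 expr2 mulrACA.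
  exact: (regularM EC_smooth).
have [n [d [d0 cnd E]]] := coprime_fracP b.
have {sE} : n ^+ 2 * P = s * d ^+ 2.
  apply/eqP; rewrite -tofrac_eq tofracM [in X in _ == X]tofracM !tofracXn -sE E expr_div_n -/PK.
  by rewrite [X in _ == X]mulrAC divfK // expf_neq0 // tofrac_eq0.
have [s1|s1] := eqVneq (size d) 1%N.
  have [c c0 dE] : exists2 c, c != 0 & d = c%:P by apply/size_poly1P; rewrite s1.
  move=> _; exists A, (c^-1 *: n); rewrite fE AE E dE -mul_polyC; congr (_ + pull lam _ * _).
  by rewrite tofracM mulrC; congr (_ * _); rewrite -(fmorphV (@ratfun_cst F)).
have [r rr] := closed_rootP d s1; have [d1 dE] := factor_theorem _ _ rr.
have nr0 : n.[r] != 0.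
  by apply/eqP => /(introT rootP)/(coprimep_root cnd); rewrite (rootP rr) eqxx.
move=> e; have := congr1 (fun p => p.[r]) e.
rewrite /= hornerM horner_exp [RHS]hornerM horner_exp (rootP rr) expr0n mulr0 => /eqP.
rewrite mulf_eq0 expf_eq0 /= (negbTE nr0) => /eqP /legendre_simple_root[P1 PE P10].
case/negP: (P10); apply/eqP.
have X0 : 'X - r%:P != 0 by rewrite polyXsubC_eq0.
have {}e : n ^+ 2 * P1 = s * d1 ^+ 2 * ('X - r%:P).
  by apply: (mulIf X0); rewrite -[LHS]mulrA -PE e dE; ring.
have := congr1 (fun p => p.[r]) e.
rewrite /= hornerM [RHS]hornerM hornerXsubC subrr mulr0 horner_exp => /eqP.
by rewrite mulf_eq0 expf_eq0 /= (negbTE nr0) => /eqP.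
Qed.

Lemma EC_value_oo_poly (n : {poly F}) m : (size n <= m.+1)%N ->
  has_value (None : place (EC lam)) (pull lam n%:F / x ^+ m) n`_m.
Proof.
move=> sn; have -> : pull lam n%:F / x ^+ m = pull lam (n%:F / ratfun_x F ^+ m).
  by rewrite pullM pullV; congr (_ / _); rewrite (rmorphXn (pull lam)).
by apply: pull_value; exact: P1_value_oo_poly.
Qed.

Lemma legendre_coef3 : P`_3 = 1.
Proof. by have := monicP legendre_monic; rewrite lead_coefE size_legendre_poly. Qed.

Lemma EC_value_oo_y2 : has_value (None : place (EC lam)) (y ^+ 2 / x ^+ 3) 1.
Proof.
rewrite EC_y2 -legendre_coef3; apply: EC_value_oo_poly.
by rewrite size_legendre_poly.
Qed.

Lemma EC_value_oo_unif : has_value (None : place (EC lam)) (x / y) 0.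
Proof. exact: (value_unif EC_smooth (None : place (EC lam))). Qed.

Lemma EC_value_oo_yx : has_value (None : place (EC lam)) (y / x ^+ 2) 0.
Proof.
have id (K0 : fieldType) (s r : K0) : s != 0 -> r != 0 ->
    r / s ^+ 2 = (s / r) * (r ^+ 2 / s ^+ 3) by move=> *; field; split_neq0.
rewrite (id _ _ _ x_neq0 y_neq0); apply: (value0M EC_smooth); first exact: EC_value_oo_unif.
exact: (value_regular EC_smooth EC_value_oo_y2).
Qed.

(** At infinity x has a pole of order 2 and y one of order 3, so the poles of A and B y cannot
    cancel, and the top coefficients of A and B would be values of functions that vanish. *)
Lemma functions_double_pole f :
  (forall q : affine_point, regular (Some q : place (EC lam)) f) ->
  regular (None : place (EC lam)) (f / x) ->
  exists2 A : {poly F}, (size A <= 2)%N & f = pull lam A%:F.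
Proof.
move=> /affine_functions[A [B fE]] fr.
have X0 := x_neq0; have Y0 := y_neq0.
have rt : regular (None : place (EC lam)) x^-1 by exact: (value_regular EC_smooth EC_value_oo_x).
have rp : regular (None : place (EC lam)) (x / y) by exact: (value_regular EC_smooth EC_value_oo_unif).
have Blt : B != 0 -> (size A <= (size B).+1)%N -> False.
  move=> B0 sAB.
  have sB : size B = (size B).-1.+1 by rewrite prednK // size_poly_gt0.
  set b := (size B).-1 in sB.
  have v0 : has_value (None : place (EC lam)) (f / x ^+ b.+1 * (x / y)) 0.
    rewrite mulrC; apply: (value0M EC_smooth); first exact: EC_value_oo_unif.
    rewrite exprS invfM mulrA -exprVn.
    by apply: (regularM EC_smooth) => //; exact: (regularX EC_smooth).
  have v1 : has_value (None : place (EC lam)) (f / x ^+ b.+1 * (x / y)) (lead_coef B).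
    have -> : f / x ^+ b.+1 * (x / y) =
        (x / y) * (pull lam A%:F / x ^+ b.+1) + pull lam B%:F / x ^+ b.
      have id (K0 : fieldType) (s r m g h : K0) : s != 0 -> r != 0 -> m != 0 ->
         (g + h * r) / (s * m) * (s / r) = (s / r) * (g / (s * m)) + h / m.
        by move=> *; field; split_neq0.
      by rewrite fE exprS id // expf_neq0.
    rewrite -[lead_coef B]add0r; apply: (valueD EC_smooth).
      apply: (value0M EC_smooth); first exact: EC_value_oo_unif.
      apply: (value_regular EC_smooth); apply: EC_value_oo_poly.
      by rewrite -sB.
    by rewrite lead_coefE -/b; apply: EC_value_oo_poly; rewrite -sB.
  by have /eqP := value_uniq EC_smooth v0 v1; rewrite eq_sym lead_coef_eq0 (negbTE B0).
have Alt : ((size B).+1 < size A)%N -> (2 < size A)%N -> False.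
  move=> sBA sA.
  have [m sAm] : exists m, size A = m.+3.
    by exists (size A - 3)%N; rewrite -addn3 subnK.
  have v0 : has_value (None : place (EC lam)) (f / x ^+ m.+2) 0.
    have -> : f / x ^+ m.+2 = x^-1 * (f / x * x^-1 ^+ m).
      have id (K0 : fieldType) (s n g : K0) : s != 0 -> n != 0 ->
         g / (s * (s * n)) = s^-1 * (g / s * n^-1).
        by move=> *; field; split_neq0.
      by rewrite !exprS id // ?expf_neq0 // exprVn.
    apply: (value0M EC_smooth); first exact: EC_value_oo_x.
    by apply: (regularM EC_smooth) => //; exact: (regularX EC_smooth).
  have v1 : has_value (None : place (EC lam)) (f / x ^+ m.+2) (lead_coef A).
    have -> : f / x ^+ m.+2 = pull lam A%:F / x ^+ m.+2 + y / x ^+ 2 * (pull lam B%:F / x ^+ m).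
      have id (K0 : fieldType) (s n r g h : K0) : s != 0 -> n != 0 ->
         (g + h * r) / (s * (s * n)) = g / (s * (s * n)) + r / s ^+ 2 * (h / n).
        by move=> *; field; split_neq0.
      by rewrite fE (exprS x m.+1) (exprS x m) id // expf_neq0.
    rewrite -[lead_coef A]addr0; apply: (valueD EC_smooth).
      by rewrite lead_coefE sAm; apply: EC_value_oo_poly; rewrite sAm.
    apply: (value0M EC_smooth); first exact: EC_value_oo_yx.
    apply: (value_regular EC_smooth); apply: EC_value_oo_poly.
    by move: sBA; rewrite sAm !ltnS.
  have /eqP := value_uniq EC_smooth v0 v1; rewrite eq_sym lead_coef_eq0 => /eqP A0.
  by move: sA; rewrite A0 size_poly0.
have B0 : B = 0.
  apply/eqP; apply/negPn/negP => B0; have [|sBA] := leqP (size A) (size B).+1.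
    exact: Blt.
  apply: Alt => //; apply: leq_ltn_trans sBA.
  by rewrite ltnS size_poly_gt0.
exists A; last by rewrite fE B0 tofrac0 pull0 mul0r addr0.
rewrite leqNgt; apply/negP => sA; apply: Alt => //.
by rewrite B0 size_poly0 (ltn_trans _ sA).
Qed.

Local Notation place := (place (EC lam)).

(** The function h is a section of O(- D), that is div h >= D. *)
Definition vanishes_along h (D : place -> int) := forall p, regular p (h * unif p ^ (- D p)).

Lemma vanishes_alongM h g (D D' : place -> int) :
  vanishes_along h D -> vanishes_along g D' -> vanishes_along (h * g) (fun p => D p + D' p).
Proof.
move=> hD gD p; have u0 := EC_unif_neq0 p.
by rewrite opprD expfzDr // mulrACA; exact: (regularM EC_smooth).
Qed.

(** At a ramification point the two points of the fibre coincide, and x - a = y ^ 2 / P1(x) has a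
    double zero. *)
Lemma x_fibre (q : affine_point) : vanishes_along (x - EC_cst lam (val q).1)
  (fun p => pt_div (Some q : place) p + pt_div (Some (conj_point q) : place) p
            - 2 * pt_div (@w_oo F lam) p).
Proof.
have X0 := x_neq0; have Y0 := y_neq0; move=> [r|]; last first.
  rewrite /pt_div eqxx !sub0r mulr1 opprK -exprnP EC_unif_oo.
  have -> : (x - EC_cst lam (val q).1) * (x / y) ^+ 2 =
      (1 - EC_cst lam (val q).1 * x^-1) * (y ^+ 2 / x ^+ 3)^-1.
    have id (K0 : fieldType) (s r c : K0) : s != 0 -> r != 0 ->
      (s - c) * (s / r) ^+ 2 = (1 - c * s^-1) * (r ^+ 2 / s ^+ 3)^-1.
      by move=> *; field; split_neq0.
    exact: id.
  apply: (regularM EC_smooth).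
    apply: (regularB EC_smooth); first exact: (regular1 EC_smooth).
    apply: (regularM EC_smooth); first exact: (regular_cst EC_smooth).
    exact: (value_regular EC_smooth EC_value_oo_x).
  exact: (value_regular EC_smooth (valueV EC_smooth EC_value_oo_y2 (oner_neq0 _))).
rewrite /pt_div /w_oo mulr0 subr0.
have rx (c : F) : regular (Some r : place) (x - EC_cst lam c).
  apply: (regularB EC_smooth); last exact: (regular_cst EC_smooth).
  exact: (value_regular EC_smooth (EC_value_x r)).
have eqS (s : affine_point) : (Some r == Some s :> place) = (r == s) by [].
rewrite !eqS; case: (eqVneq r q) => [->|rq]; case: eqVneq => [e|ne].
- have b0 : (val q).2 = 0.
    have /(congr1 snd)/eqP := congr1 val e; rewrite /= -addr_eq0 -mulr2n mulrn_eq0.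
    by move=> /eqP.
  have [|P1 PE P10] := @legendre_simple_root (val q).1.
    by rewrite -(eqP (valP q)) b0 expr0n.
  rewrite (_ : - (_ + _) = - 2%:Z :> int) // -invr_expz -exprnP EC_unif_affine b0 eqxx.
  have -> : (x - EC_cst lam (val q).1) / y ^+ 2 = (pull lam P1%:F)^-1.
    have p1 : pull lam P1%:F != 0.
      by rewrite fmorph_eq0 tofrac_eq0; apply: contra_neq P10 => ->; exact: horner0.
    have P'E : pull lam PK = pull lam P1%:F * (x - EC_cst lam (val q).1).
      by rewrite /PK [in LHS]PE tofracM tofracB pullM pullD pullN.
    rewrite EC_y2 P'E.
    by rewrite mulrC invfM -mulrA mulVf ?mulr1 // subr_eq0 x_neq_cst.
  apply: (value_regular EC_smooth).
  exact: (valueV EC_smooth (EC_value_poly q P1)).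
- rewrite addr0 EC_unif_affine ifN.
    by rewrite (_ : - _ = -1 :> int) // exprN1 mulfV ?subr_eq0 ?x_neq_cst //; exact: (regular1 EC_smooth).
  apply: contra_neq ne => b0; apply: val_inj; rewrite /= b0 oppr0.
  by case: (sval q) (b0 : (sval q).2 = 0) => u v /= ->.
- rewrite add0r EC_unif_affine e /= oppr_eq0 ifN.
    by rewrite (_ : - _ = -1 :> int) // exprN1 mulfV ?subr_eq0 ?x_neq_cst //; exact: (regular1 EC_smooth).
  apply: contra_neq rq => b0; rewrite e; apply: val_inj; rewrite /= b0 oppr0.
  by case: (sval q) (b0 : (sval q).2 = 0) => u v /= ->.
by rewrite addr0 oppr0 expr0z mulr1.
Qed.

(** Such a function is a polynomial of degree at most one in x with roots x(q) and x(q'). *)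
Lemma vanishes_at_two_points h (q q' : affine_point) : h != 0 ->
  vanishes_along h (fun p => pt_div (Some q : place) p + pt_div (Some q' : place) p
                     - 2 * pt_div (@w_oo F lam) p) ->
  (val q).1 = (val q').1.
Proof.
move=> h0 hD; have u0 := EC_unif_neq0.
have pos (r : affine_point) : exists2 k : nat, regular (Some r : place) (h * unif (Some r : place) ^- k)
    & (r == q) || (r == q') -> (0 < k)%N.
  exists ((r == q) + (r == q'))%N; last by case: eqP; case: eqP.
  have := hD (Some r); rewrite /pt_div /w_oo mulr0 subr0.
  by rewrite -[Some r == Some q :> place]/(r == q) -[Some r == Some q' :> place]/(r == q') -PoszD exprnN.
have [A sA hE] : exists2 A : {poly F}, (size A <= 2)%N & h = pull lam A%:F.
  apply: functions_double_pole => [r|].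
    have [k rk _] := pos r; rewrite -[h](@divfK _ (unif (Some r : place) ^+ k)) ?expf_neq0 //.
    apply: (regularM EC_smooth) => //; apply: (regularX EC_smooth).
    exact: (regular_unif EC_smooth).
  have := hD None; rewrite /pt_div /w_oo eqxx !sub0r mulr1 opprK -exprnP EC_unif_oo => hr.
  have -> : h / x = h * (x / y) ^+ 2 * (y ^+ 2 / x ^+ 3).
    have id (K0 : fieldType) (s r g : K0) : s != 0 -> r != 0 ->
      g / s = g * (s / r) ^+ 2 * (r ^+ 2 / s ^+ 3) by move=> *; field; split_neq0.
    by apply: id; [exact: x_neq0|exact: y_neq0].
  by apply: (regularM EC_smooth) => //; exact: (value_regular EC_smooth EC_value_oo_y2).
have root r : (r == q) || (r == q') -> A.[(val r).1] = 0.
  move=> rq; have [k rk /(_ rq) k0] := pos r.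
  apply: (value_uniq EC_smooth (EC_value_poly r A)); rewrite -hE.
  rewrite -[h](@divfK _ (unif (Some r : place) ^+ k)) ?expf_neq0 // mulrC.
  rewrite -(prednK k0) [X in X * _]exprS -mulrA; apply: (value0M EC_smooth).
    exact: (value_unif EC_smooth).
  rewrite prednK //; apply: (regularM EC_smooth) => //.
  by apply: (regularX EC_smooth); exact: (regular_unif EC_smooth).
have A0 : A != 0 by apply: contra_neq h0 => A0; rewrite hE A0 tofrac0 pull0.
apply/eqP; apply/negPn/negP => ne.
have := @max_poly_roots _ A [:: (val q).1; (val q').1] A0.
rewrite /= !rootE !root ?eqxx ?orbT // inE ne => /(_ isT isT).
by rewrite ltnNge sA.
Qed.

(** A nonzero map between the two subbundles or to the quotient is a function h with
    div h >= +- (q - oo) +- (q' - oo). Multiplying by x - x(q), whose divisor is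
    q + conj q - 2 oo, replaces q by its conjugate and changes the sign, so that both signs can
    be made positive. *)
Lemma z_coord_unique (E : pbundle (EC lam)) (z z' : F) :
  (forall p, frame E p \in unitmx) -> is_z_coord E z -> is_z_coord E z' -> z = z'.
Proof.
move=> uE [[q|] [//= [<-] hq]] [[q'|] [//= [<-] hq']] {z z'}.
pose O := @w_oo F lam.
pose sgn (s : bool) (r : affine_point) (p : place) : int :=
  if s then pt_div O p - pt_div (Some r : place) p else pt_div (Some r : place) p - pt_div O p.
have sgnN s r p : sgn (~~ s) r p = - sgn s r p by case: s; rewrite /sgn /= opprB.
have ext r : S_equivalent_sum E (fun p => pt_div (Some r : place) p - pt_div O p)
     (fun p => pt_div O p - pt_div (Some r : place) p) ->
   exists s, extension E (sgn s r) (sgn (~~ s) r).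
  by case=> h; [exists false|exists true].
have [s hs] := ext q hq; have [s' hs'] := ext q' hq'.
have [h h0 [s1 [s2 hv]]] : exists2 h : L, h != 0 & exists s1 s2,
    vanishes_along h (fun p => sgn s1 q p + sgn s2 q' p).
  have [h h0 [hr|hr]] := extension_compare EC_smooth uE hs hs'; exists h => //.
    by exists s, s' => p; have := hr p; rewrite sgnN -opprD.
  by exists (~~ s), s' => p; have := hr p; rewrite sgnN opprD opprK.
(* the conjugate point r' stands for r when its sign is negative *)
have flip g (b : bool) (r : affine_point) (R : place -> int) : g != 0 -> vanishes_along g (fun p => sgn b r p + R p) ->
    exists2 g' : L, g' != 0 & exists2 r' : affine_point, (val r').1 = (val r).1 &
    vanishes_along g' (fun p => sgn false r' p + R p).
  move=> g0; case: b => gv; last by exists g => //; exists r.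
  exists (g * (x - EC_cst lam (val r).1)); first by rewrite mulf_neq0 // subr_eq0 x_neq_cst.
  exists (conj_point r); first by [].
  move=> p; have := vanishes_alongM gv (x_fibre r) p; rewrite /sgn -/O.
  have id (i j k l : int) : j - i + l + (i + k - 2 * j) = k - j + l by ring.
  by rewrite id.
have [g g0 [r <- gv]] := flip _ _ _ _ h0 hv.
have gv' : vanishes_along g (fun p => sgn s2 q' p + sgn false r p).
  by move=> p; rewrite addrC; exact: gv.
have [k k0 [r' <- kv]] := flip _ _ _ _ g0 gv'.
apply: (vanishes_at_two_points k0) => p; have := kv p; rewrite /sgn -/O.
have id (i j m : int) : j - i + (m - i) = m + j - 2 * i by ring.
by rewrite id.
Qed.

End EllipticFunctions.

Lemma unit_of_value (F : numClosedFieldType) (X : curve F) (hX : smooth X) (p : place X)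
  (f : ffield X) (c : F) : has_value p f c -> c != 0 -> unit_at p f.
Proof. by move=> fc c0; apply/(unit_value hX); exists c. Qed.

Lemma regular_div (F : numClosedFieldType) (X : curve F) (hX : smooth X) (p : place X)
  (f : ffield X) : has_value p f 0 -> regular p (f / unif p).
Proof. by case: (vanishesP hX p f) => _ h /h. Qed.

Lemma invmx_line (K : fieldType) (c : K) : invmx (mx2 c 1 1 0) = mx2 0 1 1 (- c).
Proof.
rewrite invmx_mx2; last by rewrite mulr0 mul1r sub0r oppr_eq0 oner_neq0.
rewrite mulr0 mul1r sub0r mul0r invrN invr1 mulrN1; congr mx2.
- by rewrite ?mulrN1 opprK.
- by rewrite ?mulrN1 opprK.
by rewrite mulrN1.
Qed.

(** * The involution psi *)

Arguments P1_lines : simpl never.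
Arguments W_pts : simpl never.

Section ParabolicLine.
Variables (F : numClosedFieldType) (lam t : F).
Hypotheses (lam0 : lam != 0) (lam1 : lam != 1).
Hypotheses (t0 : t != 0) (t1 : t != 1) (tlam : t != lam).
Local Notation K := (ratfun F).
Local Notation X := (P1 F).
Local Notation k := (@ratfun_cst F).
Local Notation x := (ratfun_x F).
Local Notation hX := (P1_smooth F).
Implicit Types (p q : F) (u : F * F).

Lemma ratfun_cstD (a b : F) : k (a + b) = k a + k b. Proof. exact: rmorphD. Qed.
Lemma ratfun_cstN (a : F) : k (- a) = - k a. Proof. exact: rmorphN. Qed.
Lemma ratfun_cstM (a b : F) : k (a * b) = k a * k b. Proof. exact: rmorphM. Qed.
Lemma ratfun_cst0 : k 0 = 0. Proof. exact: rmorph0. Qed.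
Lemma ratfun_cst1 : k 1 = 1. Proof. exact: rmorph1. Qed.
Lemma ratfun_cstV (a : F) : k a^-1 = (k a)^-1. Proof. exact: fmorphV. Qed.
Lemma ratfun_cstX (a : F) n : k (a ^+ n) = k a ^+ n. Proof. exact: rmorphXn. Qed.
Lemma ratfun_cst_nat n : k n%:R = n%:R. Proof. exact: rmorph_nat. Qed.
Definition ratfun_cstE := (ratfun_cst_nat, ratfun_cstD, ratfun_cstN, ratfun_cstM, ratfun_cst0,
  ratfun_cst1, ratfun_cstV, ratfun_cstX).

(** The slope of the line over the pole a in P1_bundle u. *)
Definition zeta u (a : F) : F := if a == 0 then 0 else if a == 1 then 1 else
  if a == lam then u.1 else u.2.

Lemma P1_lines_zeta u a : [|| a == 0, a == 1, a == lam | a == t] ->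
  P1_lines lam t u (Some a) = mx2 (k (zeta u a)) 1 1 0.
Proof.
rewrite /P1_lines /zeta; case: ifP => // _; case: ifP => // _.
by case: ifP => //= _ ->.
Qed.

Definition P1_generic (a : F) := ~~ [|| a == 0, a == 1, a == lam | a == t].

Lemma P1_lines_generic u a : P1_generic a -> P1_lines lam t u (Some a) = 1%:M.
Proof. by rewrite /P1_generic !negb_or /P1_lines => /and4P[/negbTE-> /negbTE-> /negbTE-> /negbTE->]. Qed.

Lemma W_pts_some (a : F) : W_pts lam (Some a) = [|| a == 0, a == 1 | a == lam].
Proof. by []. Qed.

Lemma W_pts_t : W_pts lam (Some t) = false.
Proof. by rewrite W_pts_some (negbTE t0) (negbTE t1) (negbTE tlam). Qed.

Lemma psi_frame_W u (a : F) : W_pts lam (Some a) ->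
  frame (psi_bundle lam (P1_bundle lam t u)) (Some a) =
  mx2 1 (k (zeta u a) / (x - k a)) 0 (x - k a)^-1.
Proof.
move=> aW; rewrite /= aW /pt_div mulr0 oppr0 expr0z scale1r.
rewrite P1_lines_zeta; last by case/or3P: aW => ->; rewrite ?orbT.
by rewrite mul_mx2; congr mx2; rewrite ?(mulr0, mul0r, mulr1, mul1r, addr0, add0r).
Qed.

Lemma P1_frame u (a : option F) : frame (P1_bundle lam t u) a = P1_lines lam t u a.
Proof. by []. Qed.

Lemma psi_frame_oo u : frame (psi_bundle lam (P1_bundle lam t u)) None =
  mx2 0 x^-1 (x^-1 ^+ 2) 0.
Proof.
rewrite /= /P1_lines /pt_div eqxx mulr1 opprK -exprnP scalar_mx2 mul_mx2 scale_mx2.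
have x0 : x != 0 by rewrite -ratfun_cst0 ratfun_x_not_cst.
by congr mx2; rewrite ?(mulr0, mul0r, mulr1, mul1r, addr0, add0r) //= invrK expr2 divfK.
Qed.

Lemma psi_frame_other u (a : F) : ~~ W_pts lam (Some a) ->
  frame (psi_bundle lam (P1_bundle lam t u)) (Some a) = P1_lines lam t u (Some a).
Proof.
move=> /negbTE aW; rewrite /= aW.
by rewrite /pt_div mulr0 oppr0 expr0z scale1r.
Qed.

Lemma GL2_mx2 (Y : curve F) (hY : smooth Y) (p : place Y) (a b c d : ffield Y) e :
  regular p a -> regular p b -> regular p c -> regular p d ->
  has_value p (a * d - b * c) e -> e != 0 -> GL2_at p (mx2 a b c d).
Proof.
move=> ra rb rc rd ve e0; split; first by apply: mx2_forall; rewrite mx2E.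
by rewrite det_mx2; exact: (unit_of_value hY ve e0).
Qed.

(** For u = (p, q), psi u is (p, t p N1 / N2) and w is lam q N1 / N2. *)
Definition N1 u := (1 - u.2) * (1 - lam) - (1 - u.1) * (1 - t).
Definition N2 u := t * u.1 * (1 - lam) * (1 - u.2) - lam * (1 - u.1) * (1 - t) * u.2.

(** Up to a factor, the inverse of the matrix of a basis of the global sections of
    psi_bundle. *)
Definition psi_iso p : 'M[K]_2 :=
  mx2 (- k ((1 - lam) * p) * x) (k p * x * (k (1 - p) * x - k (lam - p)))
      (k (lam - p) * x - k (lam * (1 - p))) (k ((1 - lam) * p) * x).

Lemma det_psi_iso p : \det (psi_iso p) =
  - k (p * (1 - p) * (lam - p)) * (x * (x - 1) * (x - k lam)).
Proof.
rewrite det_mx2 !ratfun_cstE.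
have id (K0 : fieldType) (s l r : K0) : - ((1 - l) * r) * s * ((1 - l) * r * s) -
   r * s * ((1 - r) * s - (l - r)) * ((l - r) * s - l * (1 - r)) =
   - (r * (1 - r) * (l - r)) * (s * (s - 1) * (s - l)) by ring.
exact: id.
Qed.

Ltac value_step := match goal with
  | |- has_value _ (_ + _) _ => apply: (valueD hX)
  | |- has_value _ (- _) _ => apply: (valueN hX)
  | |- has_value _ (_ * _) _ => apply: (valueM hX)
  | |- has_value _ (_ ^+ _) _ => apply: (valueX hX)
  | |- has_value _ x _ => exact: P1_value_x
  | |- has_value _ x^-1 _ => exact: P1_value_oo
  | |- has_value _ (k _) _ => exact: (value_cst hX)
  | |- has_value _ 1 _ => exact: (value1 hX)
  | |- has_value _ 0 _ => exact: (value0 hX)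
  end.
Ltac value_of := apply: value_eq; [repeat value_step|].

(** At a point of W the stalk of psi_bundle is spanned by e_1 and (z e_1 + e_2) / (x - a); the
    three equations say that the value of M at a kills the line (z, 1) and has its image in this same
    line. *)
Lemma psi_iso_local_W (M : 'M[K]_2) (a z e m00 m01 m10 m11 : F) :
  has_value (Some a : place X) (M 0 0) m00 -> has_value (Some a : place X) (M 0 1) m01 ->
  has_value (Some a : place X) (M 1 0) m10 -> has_value (Some a : place X) (M 1 1) m11 ->
  m00 * z + m01 = 0 -> m10 * z + m11 = 0 -> m00 = z * m10 ->
  has_value (Some a : place X) (\det M / (x - k a)) e -> e != 0 ->
  let G := invmx (mx2 (k z) 1 1 0) *m M *m mx2 1 (k z / (x - k a)) 0 (x - k a)^-1 in
  GL2_at (Some a : place X) G /\ vanishes_at (Some a : place X) (G 1 0).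
Proof.
move=> v00 v01 v10 v11 e0 e1 e2 vd nz /=.
have xa : x - k a != 0 by rewrite subr_eq0 ratfun_x_not_cst.
have -> : invmx (mx2 (k z) 1 1 0) *m M *m mx2 1 (k z / (x - k a)) 0 (x - k a)^-1 =
  mx2 (M 1 0) ((M 1 0 * k z + M 1 1) / (x - k a)) (M 0 0 - k z * M 1 0)
      ((M 0 0 * k z + M 0 1 - k z * (M 1 0 * k z + M 1 1)) / (x - k a)).
  rewrite invmx_line [X in _ *m X *m _]mx2_eta !mul_mx2.
  by congr mx2; ring.
have vk := value_cst hX (Some a : place X) z.
split; last first.
  rewrite mx2E; apply/(vanishesP hX); apply: (@value_eq _ _ _ _ (m00 - z * m10)).
    by apply: (valueB hX) => //; exact: (valueM hX).
  by rewrite e2 subrr.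
apply: (GL2_mx2 hX (e := - e)); last by rewrite oppr_eq0.
- exact: (value_regular hX v10).
- apply: (regular_div hX (p := Some a : place X)).
  by rewrite -e1; apply: (valueD hX) => //; exact: (valueM hX).
- by apply: (regularB hX); [exact: (value_regular hX v00)|exact: (value_regular hX (valueM hX vk v10))].
- apply: (regular_div hX (p := Some a : place X)).
  apply: (@value_eq _ _ _ _ (m00 * z + m01 - z * (m10 * z + m11))); last by rewrite e0 e1 mulr0 subr0.
  apply: (valueB hX); first by apply: (valueD hX) => //; exact: (valueM hX).
  by apply: (valueM hX) => //; apply: (valueD hX) => //; exact: (valueM hX).
suff -> : M 1 0 * ((M 0 0 * k z + M 0 1 - k z * (M 1 0 * k z + M 1 1)) / (x - k a)) -
  (M 1 0 * k z + M 1 1) / (x - k a) * (M 0 0 - k z * M 1 0) = - (\det M / (x - k a)).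
  exact: (valueN hX).
by rewrite det2E; ring.
Qed.

Lemma psi_iso_local_const (M : 'M[K]_2) (a e : F) (f f' : 'M[F]_2) :
  (forall i j, regular (Some a : place X) (M i j)) ->
  has_value (Some a : place X) (\det M) e -> e != 0 -> \det f != 0 -> \det f' != 0 ->
  GL2_at (Some a : place X) (invmx (map_mx k f') *m M *m map_mx k f).
Proof.
move=> rM vd nz f0 f'0.
have cst_GL2 (g : 'M[F]_2) : \det g != 0 -> GL2_at (Some a : place X) (map_mx k g).
  move=> g0; split; first by move=> i j; rewrite mxE; exact: (regular_cst hX).
  rewrite det_map_mx; exact: (unit_of_value hX (value_cst hX (Some a : place X) _)).
apply: (GL2_mul hX); last exact: cst_GL2.
apply: (GL2_mul hX); first by apply: (GL2_inv hX); exact: cst_GL2.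
by split=> //; exact: (unit_of_value hX vd).
Qed.

Lemma zeta_t u : zeta u t = u.2.
Proof. by rewrite /zeta (negbTE t0) (negbTE t1) (negbTE tlam). Qed.

Lemma line_map (c : F) : mx2 (k c) 1 1 0 = map_mx k (mx2 c 1 1 0).
Proof. by rewrite map_mx2 ratfun_cst1 ratfun_cst0. Qed.

Lemma det_line (c : F) : \det (mx2 c 1 1 0) != 0.
Proof. by rewrite det_mx2 mulr0 mulr1 sub0r oppr_eq0 oner_neq0. Qed.

Lemma psi_iso_value (p a : F) : let M := psi_iso p in
  [/\ has_value (Some a : place X) (M 0 0) (- ((1 - lam) * p) * a),
      has_value (Some a : place X) (M 0 1) (p * a * ((1 - p) * a - (lam - p))),
      has_value (Some a : place X) (M 1 0) ((lam - p) * a - lam * (1 - p)),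
      has_value (Some a : place X) (M 1 1) ((1 - lam) * p * a)
    & has_value (Some a : place X) (\det M)
        (- (p * (1 - p) * (lam - p)) * (a * (a - 1) * (a - lam)))].
Proof.
rewrite /= det_psi_iso !mx2E; split.
- by value_of; rewrite ?mulNr.
- by value_of.
- by value_of.
- by value_of.
- by value_of.
Qed.

(** Only the condition at t involves q and q': the matrix sends the line q to the line q'. *)
Lemma psi_iso_pb p q q' : p != 0 -> p != 1 -> p != lam ->
  q' * N2 (p, q) = t * p * N1 (p, q) ->
  pb_iso (X := X) (psi_iso p) (psi_bundle lam (P1_bundle lam t (p, q))) (P1_bundle lam t (p, q')).
Proof.
move=> p0 p1 plam qq'.
have c0 : - (p * (1 - p) * (lam - p)) != 0.
  by rewrite oppr_eq0 !mulf_neq0 // subr_eq0 eq_sym.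
have xa (a : F) : x - k a != 0 by rewrite subr_eq0 ratfun_x_not_cst.
have x0 : x != 0 by rewrite -ratfun_cst0 ratfun_x_not_cst.
split.
- rewrite det_psi_iso -ratfun_cstN; apply: mulf_neq0; first by rewrite fmorph_eq0.
  apply: mulf_neq0; last exact: xa.
  by apply: mulf_neq0; [exact: x0|rewrite -ratfun_cst1; exact: xa].
- by [].
case=> [a|]; last first.
  rewrite psi_frame_oo /= /P1_lines invmx1 mul1mx /psi_iso mul_mx2.
  set m00 := _ + _; set m01 := _ + _; set m10 := _ + _; set m11 := _ + _.
  have v00 : has_value (None : place X) m00 (p * (1 - p)).
    have -> : m00 = k p * (k (1 - p) - k (lam - p) * x^-1).
      have id (K0 : fieldType) (s a b c d : K0) : s != 0 ->
        - d * s * 0 + a * s * (b * s - c) * s^-1 ^+ 2 = a * (b - c * s^-1) by move=> *; field.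
      exact: id.
    by value_of; rewrite mulr0 subr0.
  have v01 : has_value (None : place X) m01 (- ((1 - lam) * p)).
    by rewrite /m01 mulr0 addr0 mulfK // -ratfun_cstN; exact: (value_cst hX).
  have v10 : has_value (None : place X) m10 0.
    have -> : m10 = x^-1 * k ((1 - lam) * p).
      have id (K0 : fieldType) (s a b : K0) : s != 0 ->
        b * 0 + a * s * s^-1 ^+ 2 = s^-1 * a by move=> *; field.
      exact: id.
    by value_of; rewrite mul0r.
  have v11 : has_value (None : place X) m11 (lam - p).
    have -> : m11 = k (lam - p) - k (lam * (1 - p)) * x^-1.
      have id (K0 : fieldType) (s a b c : K0) : s != 0 ->
        (b * s - c) / s + a * s * 0 = b - c * s^-1 by move=> *; field.
      exact: id.
    by value_of; rewrite mulr0 subr0.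
  split; last by move=> _; rewrite mx2E; apply/(vanishesP hX).
  apply: (GL2_mx2 hX); try (exact: (value_regular hX v00) || exact: (value_regular hX v01) || exact: (value_regular hX v10) || exact: (value_regular hX v11)).
    by apply: (valueB hX); apply: (valueM hX); eassumption.
  by rewrite mulr0 subr0 !mulf_neq0 // subr_eq0 eq_sym.
have [v00 v01 v10 v11 vd] := psi_iso_value p a.
have [aW|aW] := boolP (W_pts lam (Some a)).
  cbv zeta; rewrite P1_frame (psi_frame_W _ aW) P1_lines_zeta; last by case/or3P: aW => ->; rewrite ?orbT.
  have zE q1 : zeta (p, q1) a = if a == 0 then 0 else if a == 1 then 1 else p.
    by rewrite /zeta; case/or3P: aW => ->; rewrite ?if_same.
  rewrite !zE; set z := if _ then _ else _.
  pose e := if a == 0 then - (p * (1 - p) * (lam - p)) * lam else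
            if a == 1 then - (p * (1 - p) * (lam - p)) * (1 - lam) else
            - (p * (1 - p) * (lam - p)) * (lam * (lam - 1)).
  have [] := @psi_iso_local_W (psi_iso p) a z e _ _ _ _ v00 v01 v10 v11.
  - rewrite /z; move: aW; rewrite W_pts_some; case: eqP => [-> _|_] /=; first by ring.
    by case: eqP => [-> _|_ /eqP ->] /=; ring.
  - rewrite /z; move: aW; rewrite W_pts_some; case: eqP => [-> _|_] /=; first by ring.
    by case: eqP => [-> _|_ /eqP ->] /=; ring.
  - rewrite /z; move: aW; rewrite W_pts_some; case: eqP => [-> _|_] /=; first by ring.
    by case: eqP => [-> _|_ /eqP ->] /=; ring.
  - rewrite /e det_psi_iso; move: aW; rewrite W_pts_some.
    have kN1 : - k (p * (1 - p) * (lam - p)) = k (- (p * (1 - p) * (lam - p))).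
      by rewrite ratfun_cstN.
    rewrite kN1; set c := - (p * (1 - p) * (lam - p)).
    have id0 (K0 : fieldType) (d s l : K0) : s != 0 ->
       d * (s * (s - 1) * (s - l)) / s = d * ((s - 1) * (s - l)) by move=> *; field.
    have id1 (K0 : fieldType) (d s l : K0) : s - 1 != 0 ->
       d * (s * (s - 1) * (s - l)) / (s - 1) = d * (s * (s - l)) by move=> *; field.
    have idl (K0 : fieldType) (d s l : K0) : s - l != 0 ->
       d * (s * (s - 1) * (s - l)) / (s - l) = d * (s * (s - 1)) by move=> *; field.
    case: eqP => [-> _|_] /=.
      by rewrite ratfun_cst0 subr0 (id0 _ _ _ _ x0); value_of; ring.
    case: eqP => [-> _|_ /eqP ->].
      rewrite ratfun_cst1 id1 ?xa -?ratfun_cst1 //; value_of.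
      by rewrite mul1r.
    by rewrite (idl _ _ _ _ (xa lam)); value_of.
  - rewrite /e; case: ifP => _; first by rewrite mulf_neq0.
    by case: ifP => _; rewrite !mulf_neq0 // subr_eq0 // eq_sym.
  by move=> *; split.
have ne0 : - (p * (1 - p) * (lam - p)) * (a * (a - 1) * (a - lam)) != 0.
  move: aW; rewrite W_pts_some !negb_or => /and3P[a0 a1 al].
  by rewrite !mulf_neq0 ?subr_eq0.
cbv zeta; rewrite P1_frame (psi_frame_other _ aW).
have rM i j : regular (Some a : place X) (psi_iso p i j).
  by move: i j; apply: mx2_forall; [exact: (value_regular hX v00)|exact: (value_regular hX v01)
    |exact: (value_regular hX v10)|exact: (value_regular hX v11)].
have [a_t|at_] := eqVneq a t; last first.
  rewrite P1_lines_generic ?P1_lines_generic; last first.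
  - by move: aW; rewrite /P1_generic W_pts_some !negb_or at_ => /and3P[-> -> ->].
  - by move: aW; rewrite /P1_generic W_pts_some !negb_or at_ => /and3P[-> -> ->].
  rewrite -(map_mx1 k); split.
    by apply: (psi_iso_local_const rM vd); rewrite ?det1 ?oner_neq0.
  have -> : ppts (psi_bundle lam (P1_bundle lam t (p, q))) (Some a) = (a == t).
    by rewrite -[ppts _ _]/(D_pts lam t (Some a)) /D_pts (negbTE aW).
  by rewrite (negbTE at_).
subst a; have tl v : P1_lines lam t v (Some t) = mx2 (k v.2) 1 1 0.
  by rewrite P1_lines_zeta ?eqxx ?orbT // zeta_t.
rewrite !tl /=.
split.
  rewrite !line_map; apply: (psi_iso_local_const rM vd) => //; exact: det_line.
move=> _; rewrite invmx_line [X in _ *m X *m _]mx2_eta !mul_mx2 mx2E.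
apply/(vanishesP hX).
rewrite mul1r.
apply: (@value_eq _ _ _ _ ((- ((1 - lam) * p) * t + - q' * ((lam - p) * t - lam * (1 - p))) * q
   + (p * t * ((1 - p) * t - (lam - p)) + - q' * ((1 - lam) * p * t)) * 1)).
  apply: (valueD hX); apply: (valueM hX).
  - apply: (valueD hX); first by rewrite ?mul1r; exact: v00.
    by apply: (valueM hX) => //; apply: (valueN hX); exact: (value_cst hX).
  - exact: (value_cst hX).
  - apply: (valueD hX); first by rewrite ?mul1r; exact: v01.
    by apply: (valueM hX) => //; apply: (valueN hX); exact: (value_cst hX).
  - exact: (value1 hX).
move: qq'; rewrite /N1 /N2 /= => qq'.
have -> : (- ((1 - lam) * p) * t + - q' * ((lam - p) * t - lam * (1 - p))) * q
   + (p * t * ((1 - p) * t - (lam - p)) + - q' * ((1 - lam) * p * t)) * 1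
   = t * p * ((1 - q) * (1 - lam) - (1 - p) * (1 - t)) - q' *
     (t * p * (1 - lam) * (1 - q) - lam * (1 - p) * (1 - t) * q) by ring.
by rewrite qq' subrr.
Qed.

(** An isomorphism is a constant matrix; it preserves the lines 0, 1, oo only if it is scalar,
    and then the remaining lines agree. *)
Lemma P1_bundle_iso (M : 'M[K]_2) u u' :
  pb_iso (X := X) M (P1_bundle lam t u) (P1_bundle lam t u') ->
  u = u' /\ exists2 c, c != 0 & M = (k c)%:M.
Proof.
case=> dM _ gM.
have D_W (a : F) : [|| a == 0, a == 1, a == lam | a == t] -> D_pts lam t (Some a).
  by move=> h; rewrite /D_pts W_pts_some -[Some a == Some t]/(a == t) -!orbA.
have lineE v (a : F) : exists2 f : 'M[F]_2, \det f != 0 & P1_lines lam t v (Some a) = map_mx k f.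
  have [aD|aD] := boolP [|| a == 0, a == 1, a == lam | a == t].
    by exists (mx2 (zeta v a) 1 1 0); rewrite ?det_line // P1_lines_zeta // line_map.
  by exists 1%:M; rewrite ?det1 ?oner_neq0 // P1_lines_generic // map_mx1.
have rM (a : place X) i j : regular a (M i j).
  have [f f0 fE] : exists2 f : 'M[F]_2, \det f != 0 & P1_lines lam t u a = map_mx k f.
    case: a => [a|]; first exact: lineE.
    by exists 1%:M; rewrite ?det1 ?oner_neq0 // map_mx1.
  have [f' f'0 fE'] : exists2 f : 'M[F]_2, \det f != 0 & P1_lines lam t u' a = map_mx k f.
    case: a {fE} => [a|]; first exact: lineE.
    by exists 1%:M; rewrite ?det1 ?oner_neq0 // map_mx1.
  have [[rG _] _] := gM a; move: rG; cbv zeta; rewrite !P1_frame fE fE' => rG.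
  have ri (g : 'M[F]_2) : mx_regular a (map_mx k g).
    by move=> i' j'; rewrite mxE; exact: (regular_cst hX).
  have u_f : map_mx k f \in unitmx by rewrite unitmx2 det_map_mx fmorph_eq0.
  have u_f' : map_mx k f' \in unitmx by rewrite unitmx2 det_map_mx fmorph_eq0.
  have -> : M = map_mx k f' *m (invmx (map_mx k f') *m M *m map_mx k f) *m map_mx k (invmx f).
    have id (K0 : fieldType) (A B N : 'M[K0]_2) : A \in unitmx -> B \in unitmx ->
        N = B *m (invmx B *m N *m A) *m invmx A.
      by move=> uA uB; rewrite -!mulmxA mulmxV // mulmx1 mulKVmx.
    by rewrite map_invmx; exact: id.
  move: i j; apply: (regular_mulmx hX); last exact: ri.
  by apply: (regular_mulmx hX).
have [c cE] : exists c : 'M[F]_2, M = map_mx k c.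
  have h i j := P1_regular_cst (fun a => rM a i j).
  have [c00 e00] := h 0 0; have [c01 e01] := h 0 1.
  have [c10 e10] := h 1 0; have [c11 e11] := h 1 1.
  by exists (mx2 c00 c01 c10 c11); apply: mx2P; rewrite mxE mx2E.
have {}dM : \det c != 0 by move: dM; rewrite cE det_map_mx fmorph_eq0.
have line0 (a : F) : [|| a == 0, a == 1, a == lam | a == t] ->
    c 0 0 * zeta u a + c 0 1 = zeta u' a * (c 1 0 * zeta u a + c 1 1).
  move=> aD; have [_ /(_ (D_W a aD))] := gM (Some a).
  rewrite !P1_frame !P1_lines_zeta // !line_map cE.
  rewrite -map_invmx -!map_mxM mxE => /(vanishes_cst hX).
  rewrite invmx_line [X in _ *m X *m _]mx2_eta !mul_mx2 mx2E => e.
  by apply/eqP; rewrite -subr_eq0; apply/eqP; rewrite -e; ring.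
have c10 : c 1 0 = 0.
  have [_ /(_ isT)] := gM None; rewrite !P1_frame /P1_lines invmx1 mul1mx mulmx1 cE mxE.
  exact: (vanishes_cst hX).
have c01 : c 0 1 = 0.
  by have := line0 0; rewrite eqxx /zeta eqxx mulr0 add0r mul0r => ->.
have c11 : c 0 0 = c 1 1.
  have := line0 1; rewrite eqxx orbT /zeta oner_eq0 eqxx c10 c01 !mul1r mulr1 addr0 mul0r add0r.
  by move=> ->.
have nz : c 1 1 != 0.
  by move: dM; rewrite det2E c01 mul0r subr0 c11 mulf_eq0 orbb.
split; last first.
  exists (c 1 1) => //; rewrite cE scalar_mx2; apply: mx2P; rewrite mxE mx2E ?c01 ?c10 ?c11 //.
have zz (a : F) : [|| a == 0, a == 1, a == lam | a == t] -> zeta u a = zeta u' a.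
  move=> /line0; rewrite c10 c01 c11 mul0r addr0 add0r mulrC => h; exact: (mulIf nz).
move: (zz lam) (zz t); rewrite !eqxx !orbT !zeta_t /zeta (negbTE lam0) (negbTE lam1) eqxx.
by case: u u' {gM line0 zz} => p q [p' q'] /= -> // -> .
Qed.

(** * The connection Psi nabla_0 (psi u) *)

Variable nu : F.

Definition dN2p u : F := t * (1 - lam) * (1 - u.2) + lam * (1 - t) * u.2.
Definition dN2q u : F := - (t * u.1 * (1 - lam)) - lam * (1 - u.1) * (1 - t).

(** The form psi_c1 du_t + psi_c2 du_lam equals
    nu dlog (u_lam (u_lam - 1) (u_lam - lam) / N2 ^ 2); in particular it is closed. *)
Definition psi_c1 u : F := - (2%:R * nu) * dN2q u / N2 u.
Definition psi_c2 u : F :=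
  nu * (u.1^-1 + (u.1 - 1)^-1 + (u.1 - lam)^-1 - 2%:R * dN2p u / N2 u).

Lemma dlogE (a : F) : dlog a = (x - k a)^-1.
Proof. by []. Qed.

Lemma polar_mx2 (a b c d e : F) : polar (mx2 a b c d) e =
  mx2 (dlog e * k a) (dlog e * k b) (dlog e * k c) (dlog e * k d).
Proof. by rewrite /polar map_mx2 scale_mx2. Qed.

(** The matrix of nabla_0 over any field, so that the identity below is checked on an abstract
    field. *)
Definition conn_mx (K0 : fieldType) (s l r a b n : K0) : 'M[K0]_2 := mx2
    (s^-1 * (4%:R^-1 * (-1)) + (s - 1)^-1 * (4%:R^-1 * (1 + 4%:R * n))
       + (s - l)^-1 * (4%:R^-1 * (-1)) + (s - r)^-1 * (n * (-1)))
    ((s - 1)^-1 * (4%:R^-1 * - (4%:R * n))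
       + (s - l)^-1 * (4%:R^-1 * (2%:R * a)) + (s - r)^-1 * (n * (2%:R * b)))
    (s^-1 * (4%:R^-1 * (- 2%:R - 4%:R * n)) + (s - 1)^-1 * (4%:R^-1 * (2%:R + 4%:R * n)))
    (s^-1 * 4%:R^-1 + (s - 1)^-1 * (4%:R^-1 * (- 1 - 4%:R * n))
       + (s - l)^-1 * 4%:R^-1 + (s - r)^-1 * n).

Definition theta_mx (K0 : fieldType) (s e c : K0) : 'M[K0]_2 := mx2
    ((s - 1)^-1 * c + (s - e)^-1 * - c) ((s - 1)^-1 * - c + (s - e)^-1 * c ^+ 2)
    (s^-1 * (1 - c) + (s - 1)^-1 * c - (s - e)^-1) ((s - 1)^-1 * - c + (s - e)^-1 * c).

Lemma nabla0_mx u : nabla0 lam t nu u = conn_mx x (k lam) (k t) (k u.1) (k u.2) (k nu).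
Proof.
rewrite /nabla0 !scale_mx2 !polar_mx2 !add_mx2 !dlogE /conn_mx.
rewrite !(mulr0, mulr1) ratfun_cst0 !(mulr0, subr0, addr0, add0r) ratfun_cst1.
by congr mx2; rewrite !ratfun_cstE.
Qed.

Lemma Theta1_mx u : Theta1 t u = theta_mx x (k t) (k u.2).
Proof.
rewrite /Theta1 !polar_mx2 !add_mx2 !dlogE /theta_mx.
rewrite ratfun_cst0 !(mulr0, subr0, addr0, add0r) ratfun_cst1.
by congr mx2; rewrite !ratfun_cstE ?mulrN1.
Qed.

Lemma Theta2_mx u : Theta2 lam u = theta_mx x (k lam) (k u.1).
Proof.
rewrite /Theta2 !polar_mx2 !add_mx2 !dlogE /theta_mx.
rewrite ratfun_cst0 !(mulr0, subr0, addr0, add0r) ratfun_cst1.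
by congr mx2; rewrite !ratfun_cstE ?mulrN1.
Qed.

(** The gauge transformation by psi_iso, cleared of the inverse matrix. M is the matrix psi_iso
    with parameter a and dM its derivative. *)
Lemma psi_gauge_identity (K0 : fieldType) (s l r a b n : K0) :
  let N1 := (1 - b) * (1 - l) - (1 - a) * (1 - r) in
  let N2 := r * a * (1 - l) * (1 - b) - l * (1 - a) * (1 - r) * b in
  let b' := r * a * N1 / N2 in
  let c1 := - (2%:R * n) * (- (r * a * (1 - l)) - l * (1 - a) * (1 - r)) / N2 in
  let c2 := n * (a^-1 + (a - 1)^-1 + (a - l)^-1
    - 2%:R * (r * (1 - l) * (1 - b) + l * (1 - r) * b) / N2) in
  let M := mx2 (- ((1 - l) * a) * s) (a * s * ((1 - a) * s - (l - a)))
      ((l - a) * s - (l * (1 - a))) (((1 - l) * a) * s) in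
  let dM := mx2 (- ((1 - l) * a)) (a * ((1 - a) * s - (l - a)) + a * s * (1 - a))
      (l - a) ((1 - l) * a) in
  s != 0 -> s - 1 != 0 -> s - l != 0 -> s - r != 0 -> a != 0 -> a - 1 != 0 -> a - l != 0 ->
  N2 != 0 -> 2%:R != 0 :> K0 -> 4%:R != 0 :> K0 ->
  M *m (conn_mx s l r a b' n + (2%:R^-1 * (s^-1 + (s - 1)^-1 + (s - l)^-1))%:M) - dM
  = (conn_mx s l r a b n + c1 *: theta_mx s r b + c2 *: theta_mx s l a) *m M.
Proof.
move=> N1 N2 b' c1 c2 M dM s0 s1 sl sr a0 a1 al n20 n2 n4.
rewrite /conn_mx /theta_mx /M /dM scalar_mx2 !scale_mx2 !add_mx2 !mul_mx2.
rewrite /c1 /c2 /b'; move: n20; rewrite /N1 /N2 => n20 {N1 N2 b' c1 c2 M dM}.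
apply: mx2P; rewrite !mxE /=.
- by field; split_neq0.
- by field; split_neq0.
- by field; split_neq0.
by field; split_neq0.
Qed.

Lemma psi_iso_deriv p : map_mx (@ddx F X) (psi_iso p) =
  mx2 (- k ((1 - lam) * p)) (k p * (k (1 - p) * x - k (lam - p)) + k p * x * k (1 - p))
      (k (lam - p)) (k ((1 - lam) * p)).
Proof.
have dN (f : K) : ratfun_deriv (- f) = - ratfun_deriv f.
  apply/eqP; rewrite -addr_eq0 -ratfun_derivD addNr -ratfun_cst0 ratfun_deriv_cst.
  exact: eqxx.
have dlin (a b : F) : ratfun_deriv (k a * x + k b) = k a.
  by rewrite ratfun_derivD ratfun_derivM !ratfun_deriv_cst ratfun_deriv_x mul0r add0r mulr1 addr0.
have dlin0 (a : F) : ratfun_deriv (k a * x) = k a.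
  by rewrite ratfun_derivM ratfun_deriv_cst ratfun_deriv_x mul0r add0r mulr1.
have dlinB (a b : F) : ratfun_deriv (k a * x - k b) = k a by rewrite -ratfun_cstN dlin.
have id (V : zmodType) (f : K -> V) (a b c d : K) : map_mx f (mx2 a b c d) = mx2 (f a) (f b) (f c) (f d).
  exact: map_mx2.
rewrite /psi_iso id /= mulNr dN !dlin0 ratfun_derivM dlin0 !dlinB.
by [].
Qed.

(** Isomorphisms of the parabolic bundle are determined up to a constant, which does not affect
    the gauge transform. *)
Lemma gauge_scalar (M A : 'M[K]_2) c : c != 0 -> M \in unitmx ->
  gauge (X := X) ((k c)%:M *m M) A = gauge (X := X) M A.
Proof.
move=> c0 uM; rewrite /gauge.
have -> : map_mx (@ddx F X) ((k c)%:M *m M) = k c *: map_mx (@ddx F X) M.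
  apply/matrixP => i j; rewrite mul_scalar_mx !mxE /= ratfun_derivM ratfun_deriv_cst.
  by rewrite mul0r add0r.
have kc0 : k c != 0 by rewrite fmorph_eq0.
rewrite mul_scalar_mx -scalemxAl -scalerBr.
have id (K0 : fieldType) (B N : 'M[K0]_2) (d : K0) : d != 0 -> N \in unitmx ->
    (d *: B) *m invmx (d *: N) = B *m invmx N.
  move=> d0 uN; rewrite invmxZ; last by rewrite unitmxZ // unitfE.
  by rewrite -scalemxAl -scalemxAr scalerA mulfV // scale1r.
exact: (id K (M *m A - map_mx (@ddx F X) M) M (k c) kc0 uM).
Qed.

Lemma psi_gauge p q : let u := (p, q) in let u' := (p, t * p * N1 u / N2 u) in
  p != 0 -> p != 1 -> p != lam -> N2 u != 0 ->
  gauge (X := X) (psi_iso p) (Psi_conn lam (nabla0 lam t nu u')) =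
  nabla0 lam t nu u + k (psi_c1 u) *: Theta1 t u + k (psi_c2 u) *: Theta2 lam u.
Proof.
move=> u u' p0 p1 pl n20.
have x0 : x - k 0 != 0 by rewrite subr_eq0 ratfun_x_not_cst.
have x1 : x - k 1 != 0 by rewrite subr_eq0 ratfun_x_not_cst.
have xl : x - k lam != 0 by rewrite subr_eq0 ratfun_x_not_cst.
have xt : x - k t != 0 by rewrite subr_eq0 ratfun_x_not_cst.
have uM : psi_iso p \in unitmx.
  rewrite unitmx2 det_psi_iso -ratfun_cstN; apply: mulf_neq0.
    by rewrite fmorph_eq0 oppr_eq0 !mulf_neq0 // subr_eq0 eq_sym.
  apply: mulf_neq0; last exact: xl.
  by rewrite ratfun_cst0 subr0 in x0; rewrite ratfun_cst1 in x1; exact: (mulf_neq0 x0 x1).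
rewrite /gauge; apply: (can_inj (mulmxK uM)); rewrite mulmxKV //.
(* transport to the abstract identity, with a = p, b = q, r = t, l = lam *)
have := @psi_gauge_identity K x (k lam) (k t) (k p) (k q) (k nu).
rewrite psi_iso_deriv /psi_iso /Psi_conn !nabla0_mx Theta1_mx Theta2_mx !dlogE /u' /u /=.
rewrite (_ : k (t * p * N1 (p, q) / N2 (p, q)) = k t * k p *
   ((1 - k q) * (1 - k lam) - (1 - k p) * (1 - k t)) /
   (k t * k p * (1 - k lam) * (1 - k q) - k lam * (1 - k p) * (1 - k t) * k q)); last first.
  by rewrite /N1 /N2 /= !ratfun_cstE.
rewrite (_ : k (psi_c1 (p, q)) = - (2%:R * k nu) * (- (k t * k p * (1 - k lam)) -
   k lam * (1 - k p) * (1 - k t)) /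
   (k t * k p * (1 - k lam) * (1 - k q) - k lam * (1 - k p) * (1 - k t) * k q)); last first.
  by rewrite /psi_c1 /dN2q /N2 /= !ratfun_cstE.
rewrite (_ : k (psi_c2 (p, q)) = k nu * ((k p)^-1 + (k p - 1)^-1 + (k p - k lam)^-1 -
   2%:R * (k t * (1 - k lam) * (1 - k q) + k lam * (1 - k t) * k q) /
   (k t * k p * (1 - k lam) * (1 - k q) - k lam * (1 - k p) * (1 - k t) * k q))); last first.
  by rewrite /psi_c2 /dN2p /N2 /= !ratfun_cstE.
rewrite !(ratfun_cstN, ratfun_cstM, ratfun_cstD (1 : F), ratfun_cstD lam) !ratfun_cstE !subr0.
apply.
- by rewrite ratfun_cst0 subr0 in x0; exact: x0.
- by rewrite ratfun_cst1 in x1; exact: x1.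
- exact: xl.
- exact: xt.
- by rewrite fmorph_eq0.
- by rewrite -ratfun_cst1 -ratfun_cstN -ratfun_cstD fmorph_eq0 subr_eq0.
- by rewrite -ratfun_cstN -ratfun_cstD fmorph_eq0 subr_eq0.
- by move: n20; rewrite -(fmorph_eq0 k) /N2 /= !ratfun_cstE.
- by rewrite -ratfun_cst_nat fmorph_eq0 pnatr_eq0.
by rewrite -ratfun_cst_nat fmorph_eq0 pnatr_eq0.
Qed.

Definition psi_generic u := [/\ u.1 != 0, u.1 != 1, u.1 != lam & N2 u != 0].

Lemma psi_involution p q : let q' := t * p * N1 (p, q) / N2 (p, q) in
  p != 0 -> p != 1 -> p != lam -> N2 (p, q) != 0 ->
  q * N2 (p, q') = t * p * N1 (p, q').
Proof.
move=> q' p0 p1 pl n0; rewrite /q' /N1 /N2 /= in n0 *.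
by field.
Qed.

(** The choice of u' and M in the definition of Psi_nabla0 is unique up to a constant, by
    P1_bundle_iso. *)
Lemma Psi_nabla0E u : psi_generic u -> Psi_nabla0 lam t nu u =
  nabla0 lam t nu u + k (psi_c1 u) *: Theta1 t u + k (psi_c2 u) *: Theta2 lam u.
Proof.
case: u => p q [/= p0 p1 pl n0]; rewrite -psi_gauge //.
pose q' := t * p * N1 (p, q) / N2 (p, q).
have i1 := @psi_iso_pb p q q' p0 p1 pl (divfK n0 _).
have i2 := @psi_iso_pb p q' q p0 p1 pl (psi_involution p0 p1 pl n0).
rewrite /Psi_nabla0; case: xgetP => [B _ [u' [M [[N iN] iM ->]]]|]; last first.
  move=> /(_ (gauge (X := X) (psi_iso p) (Psi_conn lam (nabla0 lam t nu (p, q'))))) [].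
  exists (p, q'), (psi_iso p); split; [|exact: i2|reflexivity].
  by exists (psi_iso p); exact: i1.
have [u'E _] := P1_bundle_iso (pb_iso_comp hX (pb_iso_inv hX i1) iN).
move: iM; rewrite -u'E => iM.
have [_ [c c0 cE]] := P1_bundle_iso (pb_iso_comp hX (pb_iso_inv hX i2) iM).
have uM : psi_iso p \in unitmx by rewrite unitmx2; case: i2.
have -> : M = (k c)%:M *m psi_iso p by rewrite -cE mulmxKV.
exact: gauge_scalar.
Qed.

End ParabolicLine.

(** * Directional derivatives and genericity *)

Section DerivativeRules.
Variables (R : numFieldType) (s : R).
Implicit Types (f g : R -> R) (a b c d : R).

Lemma is_derive1_eq f a b : is_derive s (1 : R) f a -> a = b -> is_derive s (1 : R) f b.
Proof. by move=> h <-. Qed.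

Lemma is_derive1_ext f g a : f =1 g -> is_derive s (1 : R) f a -> is_derive s (1 : R) g a.
Proof. by move=> /funext ->. Qed.

Lemma is_derive1_cst c : is_derive s (1 : R) (fun=> c) 0.
Proof. exact: (is_derive_cst c s 1). Qed.

Lemma is_derive1D f g a b : is_derive s (1 : R) f a -> is_derive s (1 : R) g b ->
  is_derive s (1 : R) (fun z => f z + g z) (a + b).
Proof. by move=> hf hg; exact: (is_deriveD hf hg). Qed.

Lemma is_derive1N f a : is_derive s (1 : R) f a -> is_derive s (1 : R) (fun z => - f z) (- a).
Proof. by move=> hf; exact: (is_deriveN hf). Qed.

Lemma is_derive1M f g a b : is_derive s (1 : R) f a -> is_derive s (1 : R) g b ->
  is_derive s (1 : R) (fun z => f z * g z) (f s * b + g s * a).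
Proof. by move=> hf hg; exact: (is_deriveM hf hg). Qed.

Lemma is_derive1V f a : f s != 0 -> is_derive s (1 : R) f a ->
  is_derive s (1 : R) (fun z => (f z)^-1) (- a / f s ^+ 2).
Proof.
move=> f0 hf; have df := @ex_derive _ _ _ _ _ _ _ hf.
have := derivableP (derivableV f0 df).
rewrite deriveV // (@derive_val _ _ _ _ _ _ _ hf) => h.
by apply: (is_derive1_eq h); rewrite /GRing.scale /= mulrC mulrN mulNr.
Qed.

Lemma is_derive1_affine c d : is_derive s (1 : R) (fun z : R => c + z * d) d.
Proof.
have h : is_derive s (1 : R) (fun z : R => z) 1 := is_derive_id _ _.
apply: (is_derive1_eq (is_derive1D (is_derive1_cst c) (is_derive1M h (is_derive1_cst d)))).
by rewrite mulr0 !add0r mulr1.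
Qed.

Lemma is_derive1_near_neq0 f a : is_derive s (1 : R) f a -> f s != 0 ->
  \forall z \near s, f z != 0.
Proof.
move=> hd h0; have dh := @ex_derive _ _ _ _ _ _ _ hd.
have /derivable1_diffP/differentiable_continuous hc := dh.
apply: (hc [set z | z != 0]); exists `|f s|; first by rewrite /= normr_gt0.
move=> y; rewrite /= => yl.
by apply/eqP => y0; move: yl; rewrite y0 subr0 ltxx.
Qed.

Lemma derive1_val f a : is_derive s (1 : R) f a -> derive1 f s = a.
Proof. by move=> hf; rewrite derive1E; exact: (@derive_val _ _ _ _ _ _ _ hf). Qed.

End DerivativeRules.

Section DirectionalDerivatives.
Variable F : numClosedFieldType.
Implicit Types (f g : F * F -> F) (u v : F * F) (a b c d : F).

Lemma line0 u v : line u v 0 = u.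
Proof. by case: u => a b; rewrite /line !mul0r !addr0. Qed.

(** At u, f has directional derivatives given by the partial derivatives a (along u.1) and b
    (along u.2). Existence along lines is all that the notions of derivative in the theorem
    ask for. *)
Definition has_grad f u a b := forall v,
  is_derive (0 : F) (1 : F) (fun s : F => f (line u v s)) (v.1 * a + v.2 * b).

Lemma has_grad_eq f u a b a' b' : has_grad f u a b -> a = a' -> b = b' -> has_grad f u a' b'.
Proof. by move=> h <- <-. Qed.

Lemma has_grad_cst c u : has_grad (fun=> c) u 0 0.
Proof. by move=> v; apply: (is_derive1_eq (is_derive1_cst 0 c)); rewrite !mulr0 addr0. Qed.

Lemma has_grad_fst u : has_grad (fun u => u.1) u 1 0.
Proof. by move=> v; rewrite mulr1 mulr0 addr0; exact: is_derive1_affine. Qed.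

Lemma has_grad_snd u : has_grad (fun u => u.2) u 0 1.
Proof. by move=> v; rewrite mulr1 mulr0 add0r; exact: is_derive1_affine. Qed.

Lemma has_gradD f g u a b c d : has_grad f u a b -> has_grad g u c d ->
  has_grad (fun u => f u + g u) u (a + c) (b + d).
Proof.
by move=> hf hg v; apply: (is_derive1_eq (is_derive1D (hf v) (hg v))); ring.
Qed.

Lemma has_gradN f u a b : has_grad f u a b -> has_grad (fun u => - f u) u (- a) (- b).
Proof. by move=> hf v; apply: (is_derive1_eq (is_derive1N (hf v))); ring. Qed.

Lemma has_gradM f g u a b c d : has_grad f u a b -> has_grad g u c d ->
  has_grad (fun u => f u * g u) u (f u * c + g u * a) (f u * d + g u * b).
Proof.
move=> hf hg v; apply: (is_derive1_eq (is_derive1M (hf v) (hg v))).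
by rewrite !line0; ring.
Qed.

Lemma has_gradV f u a b : f u != 0 -> has_grad f u a b ->
  has_grad (fun u => (f u)^-1) u (- a / f u ^+ 2) (- b / f u ^+ 2).
Proof.
move=> f0 hf v; have f0' : f (line u v 0) != 0 by rewrite line0.
by apply: (is_derive1_eq (is_derive1V f0' (hf v))); rewrite !line0; ring.
Qed.

Lemma has_grad_near f g u a b : (forall v, \forall s \near (0 : F), f (line u v s) = g (line u v s)) ->
  has_grad f u a b -> has_grad g u a b.
Proof. by move=> fg hf v; exact: (near_eq_is_derive (fg v) (hf v)). Qed.

Lemma diff_dirE f u v a b : has_grad f u a b -> diff_dir f u v = v.1 * a + v.2 * b.
Proof. by move=> hf; exact: (derive1_val (hf v)). Qed.

End DirectionalDerivatives.

Section Genericity.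
Variable F : numClosedFieldType.
Implicit Types (f g : F * F -> F) (u v : F * F).

Definition value2 (Q : {poly {poly F}}) u : F := Q.[(u.2)%:P].[u.1].

(** Polynomial functions of u, closed under ring operations, are used to build Q without writing
    it. *)
Definition polynomial f := exists Q, forall u, value2 Q u = f u.

Lemma polynomial_cst c : polynomial (fun=> c).
Proof. by exists c%:P%:P => u; rewrite /value2 !hornerC. Qed.
Lemma polynomial_fst : polynomial (fun u => u.1).
Proof. by exists 'X%:P => u; rewrite /value2 hornerC hornerX. Qed.
Lemma polynomial_snd : polynomial (fun u => u.2).
Proof. by exists 'X => u; rewrite /value2 hornerX hornerC. Qed.
Lemma polynomialD f g : polynomial f -> polynomial g -> polynomial (fun u => f u + g u).
Proof. by move=> [Q hQ] [Q' hQ']; exists (Q + Q') => u; rewrite /value2 !hornerD -hQ -hQ'. Qed.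
Lemma polynomialN f : polynomial f -> polynomial (fun u => - f u).
Proof. by move=> [Q hQ]; exists (- Q) => u; rewrite /value2 !hornerN -hQ. Qed.
Lemma polynomialM f g : polynomial f -> polynomial g -> polynomial (fun u => f u * g u).
Proof. by move=> [Q hQ] [Q' hQ']; exists (Q * Q') => u; rewrite /value2 !hornerM -hQ -hQ'. Qed.

Definition generically (A : F * F -> Prop) :=
  exists2 Q : {poly {poly F}}, Q != 0 & forall u, value2 Q u != 0 -> A u.

Lemma generically_and (A B : F * F -> Prop) :
  generically A -> generically B -> generically (fun u => A u /\ B u).
Proof.
move=> [Q Q0 hQ] [Q' Q'0 hQ']; exists (Q * Q'); first by rewrite mulf_neq0.
by move=> u; rewrite /value2 !hornerM mulf_eq0 negb_or => /andP[/hQ ? /hQ' ?].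
Qed.

Lemma generically_imply (A B : F * F -> Prop) : (forall u, A u -> B u) ->
  generically A -> generically B.
Proof. by move=> AB [Q Q0 hQ]; exists Q => // u /hQ /AB. Qed.

Lemma generically_neq0 f u0 : polynomial f -> f u0 != 0 -> generically (fun u => f u != 0).
Proof.
move=> [Q hQ] f0; exists Q => [|u]; last by rewrite hQ.
by apply: contraNneq f0 => Q0; rewrite -hQ Q0 /value2 !horner0.
Qed.

(** Polynomials are differentiable, hence continuous, along lines; so genericity is preserved
    nearby. *)
Lemma value2_derivable Q u v :
  exists d, is_derive (0 : F) (1 : F) (fun s => value2 Q (line u v s)) d.
Proof.
rewrite /value2 /line /=; set a1 := u.1; set a2 := u.2.
have inner (p : {poly F}) :
    exists d, is_derive (0 : F) (1 : F) (fun s => p.[a1 + s * v.1]) d.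
  elim/poly_ind: p => [|p c [d hd]].
    by exists 0; apply: is_derive1_ext (is_derive1_cst 0 0) => s; rewrite horner0.
  have h := is_derive1D (is_derive1M hd (is_derive1_affine 0 a1 v.1)) (is_derive1_cst 0 c).
  by eexists; apply: is_derive1_ext h => s; rewrite hornerMXaddC.
elim/poly_ind: Q => [|Q c [d hd]].
  by exists 0; apply: is_derive1_ext (is_derive1_cst 0 0) => s; rewrite !horner0.
have [d' hd'] := inner c.
have h := is_derive1D (is_derive1M hd (is_derive1_affine 0 a2 v.2)) hd'.
by eexists; apply: is_derive1_ext h => s; rewrite hornerMXaddC hornerD hornerM hornerC.
Qed.

Lemma near_value2_neq0 Q u v : value2 Q u != 0 ->
  \forall s \near (0 : F), value2 Q (line u v s) != 0.
Proof.
move=> Q0; have [d hd] := value2_derivable Q u v.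
by apply: (is_derive1_near_neq0 hd); rewrite line0.
Qed.

End Genericity.

(** * The stalks of phi u and of its transform at T *)

Section DoubleCover.
Variables (F : numClosedFieldType) (lam t : F).
Hypotheses (lam0 : lam != 0) (lam1 : lam != 1).
Hypotheses (t0 : t != 0) (t1 : t != 1) (tlam : t != lam).
Local Notation L := (EC_fun lam).
Local Notation C := (EC lam).
Local Notation e := (@EC_cst F lam).
Local Notation x := (EC_x lam).
Local Notation y := (EC_y lam).
Local Notation P := (legendre_poly lam).
Local Notation hC := (EC_smooth lam0 lam1).
Local Notation affine_point := {ab : F * F | ab.2 ^+ 2 == P.[ab.1]}.
Local Notation "q ^p" := (Some q : place C) (at level 2, format "q ^p").
Local Notation oo := (None : place C).
Local Notation "f ~[ p ] c" := (has_value (p : place C) f c) (at level 70).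
Implicit Types (u : F * F) (q : affine_point) (f g : L).

Ltac cvalue_step := match goal with
  | |- has_value _ (_ + _) _ => apply: (valueD hC)
  | |- has_value _ (- _) _ => apply: (valueN hC)
  | |- has_value _ (_ * _) _ => apply: (valueM hC)
  | |- has_value _ (_ ^+ _) _ => apply: (valueX hC)
  | |- has_value _ x _ => exact: (EC_value_x lam0 lam1)
  | |- has_value _ y _ => exact: (EC_value_y lam0 lam1)
  | |- has_value _ (e _) _ => exact: (value_cst hC)
  | |- has_value _ y^-1 _ => apply: (valueV hC (EC_value_y lam0 lam1 _))
  | |- has_value _ 1 _ => exact: (value1 hC)
  | |- has_value _ 0 _ => exact: (value0 hC)
  end.
Ltac cvalue_of := apply: value_eq; [repeat cvalue_step|].

Lemma EC_cst0 : e 0 = 0. Proof. exact: rmorph0. Qed.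
Lemma EC_cst1 : e 1 = 1. Proof. exact: rmorph1. Qed.

(** The equation y ^ 2 = x (x - 1) (x - lam). *)
Lemma ramified_W q : W_pts lam (Some (val q).1) = ((val q).2 == 0).
Proof.
rewrite -sqrf_eq0 (eqP (valP q)) horner_legendre !mulf_eq0 !subr_eq0.
by rewrite /W_pts orbA.
Qed.

Lemma fibre_points q q' : (val q).1 = (val q').1 -> q = q' \/ q = conj_point q'.
Proof.
case: q q' => [[a b] hq] [[a' b'] hq'] /= E.
have : b ^+ 2 == b' ^+ 2 by move: (hq) (hq') => /= /eqP -> /eqP ->; rewrite E.
rewrite eqf_sqr => /orP[]/eqP E'; [left|right]; apply: val_inj => /=; by rewrite E E'.
Qed.

Lemma phi_frameE u (p : place C) : frame (phi lam t u) p =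
  unif p ^ (2 * pt_div (@w_oo F lam) p) *:
    (if W_pts lam (EC_proj p)
     then map_mx (pull lam) (P1_lines lam t u (EC_proj p)) *m mx2 0 (unif p)^-1 1 0
     else map_mx (pull lam) (P1_lines lam t u (EC_proj p))).
Proof. by rewrite /= mulNr opprK. Qed.

Lemma phi_frame_affine u q : frame (phi lam t u) q^p =
    (if W_pts lam (Some (val q).1)
     then map_mx (pull lam) (P1_lines lam t u (Some (val q).1)) *m mx2 0 (unif q^p)^-1 1 0
     else map_mx (pull lam) (P1_lines lam t u (Some (val q).1))).
Proof. by rewrite phi_frameE /pt_div mulr0 expr0z scale1r. Qed.

Lemma phi_frame_oo u : frame (phi lam t u) oo = mx2 0 (x / y) ((x / y) ^+ 2) 0.
Proof.
rewrite phi_frameE /pt_div eqxx mulr1 -exprnP /= EC_unif_oo.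
rewrite [P1_lines _ _ _ _]/(1%:M) map_mx1 mul1mx scale_mx2 !mulr0 mulr1.
have id (K0 : fieldType) (r : K0) : r != 0 -> r ^+ 2 * r^-1 = r.
  by move=> r0; rewrite expr2 mulfK.
by rewrite (id L (x / y) (mulf_neq0 (@x_neq0 F lam) (invr_neq0 (@y_neq0 F lam)))).
Qed.

Lemma pull_line (c : F) : map_mx (pull lam) (mx2 (ratfun_cst c) 1 1 0) = mx2 (e c) 1 1 0.
Proof. by rewrite map_mx2 pull1 pull0. Qed.

Lemma phi_frame_W u q : (val q).2 = 0 -> frame (phi lam t u) q^p =
  mx2 1 (e (zeta lam u (val q).1) / y) 0 y^-1.
Proof.
move=> b0; have aW : W_pts lam (Some (val q).1) by rewrite ramified_W b0.
rewrite phi_frame_affine aW P1_lines_zeta //; last by case/or3P: aW => ->; rewrite ?orbT.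
rewrite pull_line EC_unif_affine b0 eqxx mul_mx2.
have id (K0 : pzRingType) (c d : K0) : mx2 (c * 0 + 1 * 1) (c * d + 1 * 0)
    (1 * 0 + 0 * 1) (1 * d + 0 * 0) = mx2 1 (c * d) 0 d.
  by rewrite !(mulr0, mul0r, mulr1, mul1r, addr0, add0r).
exact: id.
Qed.

Lemma phi_frame_t u q : (val q).1 = t -> frame (phi lam t u) q^p = mx2 (e u.2) 1 1 0.
Proof.
move=> at_; rewrite phi_frame_affine at_ W_pts_t // P1_lines_zeta ?eqxx ?orbT //.
by rewrite zeta_t // pull_line.
Qed.

Lemma phi_frame_other u q : (val q).2 != 0 -> (val q).1 != t ->
  frame (phi lam t u) q^p = 1%:M.
Proof.
rewrite -ramified_W => aW at_; rewrite phi_frame_affine (negbTE aW).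
rewrite P1_lines_generic ?map_mx1 // /P1_generic.
by move: aW; rewrite W_pts_some !negb_or => /and3P[-> -> ->].
Qed.

Lemma ramified_neq_t q : (val q).2 = 0 -> (val q).1 != t.
Proof.
move=> b0; apply/eqP => at_; have := ramified_W q.
by rewrite b0 eqxx at_ W_pts_t.
Qed.

Lemma place_cases (Q : place C -> Prop) :
  Q oo -> (forall q, (val q).2 = 0 -> Q q^p) ->
  (forall q, (val q).2 != 0 -> (val q).1 = t -> Q q^p) ->
  (forall q, (val q).2 != 0 -> (val q).1 != t -> Q q^p) -> forall p, Q p.
Proof.
move=> Qoo QW Qt Q' [q|//].
have [b0|b0] := eqVneq (val q).2 0; first exact: QW.
by have [at_|at_] := eqVneq (val q).1 t; [exact: Qt|exact: Q'].
Qed.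

Lemma phi_ppts u (p : place C) : ppts (phi lam t u) p = (EC_proj p == Some t).
Proof.
rewrite /= /D_pts; case: eqVneq => [->|_]; first by rewrite orbT W_pts_t.
by rewrite orbF andbN.
Qed.

Lemma unif_ramified q : (val q).2 = 0 -> unif q^p = y.
Proof. by move=> b0; rewrite EC_unif_affine b0 eqxx. Qed.

Lemma unif_unramified q : (val q).2 != 0 -> unif q^p = x - e (val q).1.
Proof. by move=> /negbTE b0; rewrite EC_unif_affine b0. Qed.

Lemma invmx_of (K0 : fieldType) n (A B : 'M[K0]_n) :
  A *m B = 1%:M -> A \in unitmx /\ invmx A = B.
Proof.
move=> AB; have [uA _] := mulmx1_unit AB; split=> //.
by rewrite -[RHS](mulKmx uA) AB mulmx1.
Qed.

Lemma EC_cstD (a b : F) : e (a + b) = e a + e b. Proof. exact: rmorphD. Qed.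
Lemma EC_cstB (a b : F) : e (a - b) = e a - e b. Proof. exact: rmorphB. Qed.
Lemma EC_cstN (a : F) : e (- a) = - e a. Proof. exact: rmorphN. Qed.
Lemma EC_cstM (a b : F) : e (a * b) = e a * e b. Proof. exact: rmorphM. Qed.
Lemma EC_cstV (a : F) : e a^-1 = (e a)^-1. Proof. exact: fmorphV. Qed.

Lemma T_frameE u (p : place C) : frame (T_transform (phi lam t u)) p =
  unif p ^ (pt_div (@w_oo F lam) p) *:
    (if EC_proj p == Some t then frame (phi lam t u) p *m mx2 0 (unif p)^-1 1 0
     else frame (phi lam t u) p).
Proof.
by rewrite -(phi_ppts u) /T_transform [frame (twist _ _) _]/= opprK.
Qed.

Lemma T_frame_affine u q : frame (T_transform (phi lam t u)) q^p =
    (if (val q).1 == t then frame (phi lam t u) q^p *m mx2 0 (unif q^p)^-1 1 0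
     else frame (phi lam t u) q^p).
Proof. by rewrite T_frameE /pt_div expr0z scale1r. Qed.

Lemma T_frame_oo u : frame (T_transform (phi lam t u)) oo =
  mx2 0 ((x / y) ^+ 2) ((x / y) ^+ 3) 0.
Proof.
rewrite T_frameE /pt_div eqxx expr1z EC_unif_oo phi_frame_oo.
have -> : (EC_proj oo == Some t) = false by [].
by rewrite scale_mx2 !mulr0 -expr2 -exprS.
Qed.

Lemma T_frame_t u q : (val q).1 = t -> (val q).2 != 0 ->
  frame (T_transform (phi lam t u)) q^p = mx2 1 (e u.2 / (x - e t)) 0 (x - e t)^-1.
Proof.
move=> at_ b0; rewrite T_frame_affine at_ eqxx phi_frame_t // (unif_unramified b0) at_ mul_mx2.
have id (K0 : pzRingType) (c d : K0) : mx2 (c * 0 + 1 * 1) (c * d + 1 * 0)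
    (1 * 0 + 0 * 1) (1 * d + 0 * 0) = mx2 1 (c * d) 0 d.
  by rewrite !(mulr0, mul0r, mulr1, mul1r, addr0, add0r).
exact: id.
Qed.

Lemma T_frame_W u q : (val q).2 = 0 ->
  frame (T_transform (phi lam t u)) q^p = mx2 1 (e (zeta lam u (val q).1) / y) 0 y^-1.
Proof.
by move=> b0; rewrite T_frame_affine (negbTE (ramified_neq_t b0)) phi_frame_W.
Qed.

Lemma T_frame_other u q : (val q).2 != 0 -> (val q).1 != t ->
  frame (T_transform (phi lam t u)) q^p = 1%:M.
Proof.
by move=> b0 at_; rewrite T_frame_affine (negbTE at_) phi_frame_other.
Qed.

Lemma value_xt q : x - e t ~[q^p] (val q).1 - t.
Proof. by cvalue_of. Qed.

Lemma xt_neq0 : x - e t != 0. Proof. by rewrite subr_eq0 x_neq_cst. Qed.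

(** The elementary transformations divide the determinant by the uniformizers at W, hence by y up
    to units; the twist corrects the order at infinity. *)
Lemma phi_det_unit u p : unit_at p (\det (frame (phi lam t u) p) / y^-1).
Proof.
rewrite invrK; elim/place_cases: p => [|q b0|q b0 at_|q b0 at_].
- rewrite phi_frame_oo det_mx2.
  have -> : (0 * 0 - x / y * (x / y) ^+ 2) * y = - (y ^+ 2 / x ^+ 3)^-1.
    have id (K0 : fieldType) (r s : K0) : r != 0 -> s != 0 ->
        (0 * 0 - r / s * (r / s) ^+ 2) * s = - (s ^+ 2 / r ^+ 3)^-1.
      by move=> r0 s0; field; split_neq0.
    exact: (id L x y (@x_neq0 F lam) (@y_neq0 F lam)).
  have v := valueN hC (valueV hC (EC_value_oo_y2 lam0 lam1) (oner_neq0 F)).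
  by apply: (unit_of_value hC v); rewrite oppr_eq0 invr_eq0 oner_eq0.
- rewrite phi_frame_W // det_mx2 mulr0 subr0 mul1r mulVf; last exact: (@y_neq0 F lam).
  exact: (unit_of_value hC (value1 hC _) (oner_neq0 _)).
- rewrite phi_frame_t // det_mx2 mulr0 sub0r mulr1 mulN1r.
  by apply: (unit_of_value hC (valueN hC (EC_value_y lam0 lam1 q))); rewrite oppr_eq0.
rewrite phi_frame_other // det1 mul1r.
exact: (unit_of_value hC (EC_value_y lam0 lam1 q)).
Qed.

Lemma value_oo_xt : x / (x - e t) ~[oo] 1.
Proof.
have -> : x / (x - e t) = (1 - e t * x^-1)^-1.
  have id (K0 : fieldType) (r s : K0) : r != 0 -> r - s != 0 -> r / (r - s) = (1 - s * r^-1)^-1.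
    by move=> r0 s0; field; split_neq0.
  exact: (id L x (e t) (@x_neq0 F lam) xt_neq0).
have v := valueB hC (value1 hC oo) (valueM hC (value_cst hC oo t) (EC_value_oo_x lam0 lam1)).
have v1 : 1 - e t * x^-1 ~[oo] 1 by apply: value_eq; [exact: v|rewrite mulr0 subr0].
by apply: value_eq; [exact: (valueV hC v1 (oner_neq0 F))|rewrite invr1].
Qed.

Lemma T_det_unit u p :
  unit_at p (\det (frame (T_transform (phi lam t u)) p) / (y * (x - e t))^-1).
Proof.
rewrite invrK; elim/place_cases: p => [|q b0|q b0 at_|q b0 at_].
- rewrite T_frame_oo det_mx2.
  have -> : (0 * 0 - (x / y) ^+ 2 * (x / y) ^+ 3) * (y * (x - e t)) =
      - ((y ^+ 2 / x ^+ 3) ^+ 2 * (x / (x - e t)))^-1.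
    have id (K0 : fieldType) (r s d : K0) : r != 0 -> s != 0 -> d != 0 ->
        (0 * 0 - (r / s) ^+ 2 * (r / s) ^+ 3) * (s * d) =
        - ((s ^+ 2 / r ^+ 3) ^+ 2 * (r / d))^-1.
      by move=> r0 s0 d0; field; split_neq0.
    exact: (id L x y _ (@x_neq0 F lam) (@y_neq0 F lam) xt_neq0).
  have v := valueM hC (valueX hC 2 (EC_value_oo_y2 lam0 lam1)) value_oo_xt.
  have v1 : (y ^+ 2 / x ^+ 3) ^+ 2 * (x / (x - e t)) ~[oo] 1.
    by apply: value_eq; [exact: v|rewrite expr1n mulr1].
  have v2 := valueN hC (valueV hC v1 (oner_neq0 F)).
  by apply: (unit_of_value hC v2); rewrite oppr_eq0 invr_eq0 oner_eq0.
- rewrite T_frame_W // det_mx2 mulr0 subr0 mul1r.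
  have -> : y^-1 * (y * (x - e t)) = x - e t by rewrite mulrA mulVf ?mul1r // y_neq0.
  apply: (unit_of_value hC (value_xt q)).
  by rewrite subr_eq0 ramified_neq_t.
- rewrite T_frame_t // det_mx2 mulr0 subr0 mul1r mulrCA mulVf ?mulr1; last exact: xt_neq0.
  exact: (unit_of_value hC (EC_value_y lam0 lam1 q)).
rewrite T_frame_other // det1 mul1r.
apply: (unit_of_value hC (valueM hC (EC_value_y lam0 lam1 q) (value_xt q))).
by rewrite mulf_neq0 // subr_eq0.
Qed.

Lemma frame_unit_of_det (E : pbundle C) h p : unit_at p (\det (frame E p) / h) ->
  frame E p \in unitmx.
Proof. by case=> + _ _; rewrite unitmx2; apply: contraNN => /eqP->; rewrite mul0r. Qed.

Lemma phi_frame_unit u p : frame (phi lam t u) p \in unitmx.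
Proof. exact: (frame_unit_of_det (phi_det_unit u p)). Qed.

Lemma T_frame_unit u p : frame (T_transform (phi lam t u)) p \in unitmx.
Proof. exact: (frame_unit_of_det (T_det_unit u p)). Qed.

Definition cv2 (a b : L) : 'cV[L]_2 := \col_i if i == 0 then a else b.

Lemma mul_mx2_cv2 (a b c d f g : L) :
  mx2 a b c d *m cv2 f g = cv2 (a * f + b * g) (c * f + d * g).
Proof. by apply: cv2P; rewrite mulmx2E !mxE. Qed.

Lemma line_order_value (E : pbundle C) p n (f g : L) (v : 'cV[L]_2) (r s : F) :
  frame E p \in unitmx -> f ~[p] r -> g ~[p] s -> (r != 0) || (s != 0) ->
  v = unif p ^ n *: (frame E p *m cv2 f g) -> line_order E v p n.
Proof.
move=> uE vf vg rs ->; exists (cv2 f g); split; last first.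
  by rewrite -scalemxAr mulKmx.
split; first by move=> i j; rewrite ord1; case: (ord2E i) => ->; rewrite mxE; apply: (value_regular hC); [exact: vf|exact: vg].
case/orP: rs => [r0|s0]; [exists 0, 0|exists 1, 0]; rewrite mxE.
  exact: (unit_of_value hC vf).
exact: (unit_of_value hC vg).
Qed.

Lemma scale_cv2 (c f g : L) : c *: cv2 f g = cv2 (c * f) (c * g).
Proof. by apply: cv2P; rewrite !mxE. Qed.

(** * The coordinates z and w as functions of u *)

Lemma scale_id (p : place C) n (v : 'cV[L]_2) : n = 0 -> unif p ^ n *: v = v.
Proof. by move=> ->; rewrite expr0z scale1r. Qed.

Lemma pt_div_neq (p q : place C) : p != q -> pt_div q p = 0.
Proof. by rewrite /pt_div => /negbTE ->. Qed.

Lemma pt_div_eq (p : place C) : pt_div p p = 1.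
Proof. by rewrite /pt_div eqxx. Qed.

Lemma neq_point q q' : q != q' -> (q^p) != (q'^p).
Proof. by apply: contraNneq => -[->]. Qed.

Lemma neq_oo q : (q^p != oo) * (oo != q^p). Proof. by []. Qed.

Definition section_div (q : affine_point) (p : place C) : int :=
  pt_div q^p p - pt_div (@w_oo F lam) p.

Lemma section_div_oo q : section_div q oo = -1.
Proof. by rewrite /section_div pt_div_eq pt_div_neq ?neq_oo // sub0r. Qed.

Lemma section_div_pt q : section_div q q^p = 1.
Proof. by rewrite /section_div pt_div_eq pt_div_neq ?neq_oo // subr0. Qed.

Lemma section_div_other q q' : q' != q -> section_div q q'^p = 0.
Proof.
by move=> /neq_point h; rewrite /section_div !pt_div_neq ?neq_oo // subr0.
Qed.

Lemma conj_of_same_fibre q q' : (val q).1 = (val q').1 -> q != q' ->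
  (val q).2 = - (val q').2.
Proof. by move=> /fibre_points[->|-> _ //]; rewrite eqxx. Qed.

(** The section is (x / y - z / y_P, be (x - z) / y) with P = q0. It vanishes at (z, y_P), has a
    simple pole at infinity, and its values at w_0, w_1, w_lam are forced into the stalk by the
    two equations on be; at the conjugate point the first coordinate does not vanish. *)
Lemma z_section u q0 (z be : F) : (val q0).1 = z -> z != 0 -> z != 1 -> z != lam -> z != t ->
  be != 0 -> be * (1 - z) = 1 -> u.1 * be * (lam - z) = lam ->
  extension (phi lam t u) (section_div q0) (fun p => - section_div q0 p).
Proof.
move=> q0z z0 z1 zl zt be0 E1 El.
have b0 : (val q0).2 != 0.
  by rewrite -ramified_W W_pts_some q0z !negb_or z0 z1 zl.
set yP := (val q0).2 in b0.
pose v := cv2 (x / y - e (z / yP)) (e be * (x - e z) / y).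
have xz0 : x - e z != 0 by rewrite subr_eq0 x_neq_cst.
have y0 : y != 0 := @y_neq0 F lam.
have x0 : x != 0 := @x_neq0 F lam.
have ebe0 : e be != 0 by rewrite fmorph_eq0.
have v0 : v != 0.
  apply/eqP => /matrixP/(_ 1 0); rewrite !mxE /= => /eqP; apply/negP.
  exact: (mulf_neq0 (mulf_neq0 ebe0 xz0) (invr_neq0 y0)).
apply: (extension_of_section hC (h := y^-1) (v := v)) => //.
- exact: invr_neq0.
- exact: phi_det_unit.
have v1q q : (val q).2 != 0 -> x / y - e (z / yP) ~[q^p] (val q).1 / (val q).2 - z / yP.
  by move=> bq; cvalue_of => //; exact: bq.
have v2q q : (val q).2 != 0 -> e be * (x - e z) / y ~[q^p] be * ((val q).1 - z) / (val q).2.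
  by move=> bq; cvalue_of => //; exact: bq.
elim/place_cases => [|q bq|q bq at_|q bq at_].
- rewrite section_div_oo.
  apply: (@line_order_value _ _ _ (e be * (1 - e z * x^-1)) (x / y - e (z / yP)) v
    (be * (1 - z * 0)) (0 - z / yP) (phi_frame_unit u oo)).
  + apply: (valueM hC (value_cst hC _ _)); apply: (valueB hC (value1 hC _)).
    exact: (valueM hC (value_cst hC _ _) (EC_value_oo_x lam0 lam1)).
  + exact: (valueB hC (EC_value_oo_unif lam0 lam1) (value_cst hC _ _)).
  + by apply/orP; right; rewrite sub0r oppr_eq0 mulf_neq0 ?invr_eq0.
  rewrite phi_frame_oo mul_mx2_cv2 EC_unif_oo scale_cv2 /v.
  have id (K0 : fieldType) (r s c d m : K0) : r != 0 -> s != 0 ->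
    (r / s - d = (r / s) ^ (-1) * (0 * (c * (1 - m * r^-1)) + r / s * (r / s - d))) *
    (c * (r - m) / s = (r / s) ^ (-1) * ((r / s) ^+ 2 * (c * (1 - m * r^-1)) + 0 * (r / s - d))).
    by move=> r0 s0; rewrite exprN1; split; field; split_neq0.
  congr cv2; [exact: (id L x y (e be) (e (z / yP)) (e z) x0 y0).1|
              exact: (id L x y (e be) (e (z / yP)) (e z) x0 y0).2].
- have qq0 : q != q0 by apply: contraNneq b0 => qq; rewrite /yP -qq bq.
  rewrite section_div_other //.
  set ze := zeta lam u (val q).1.
  (* the first coordinate is regular because x - ze be (x - z) vanishes at this point *)
  have ze0 : (val q).1 - ze * be * ((val q).1 - z) = 0.
    have := ramified_W q; rewrite bq eqxx W_pts_some /ze /zeta.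
    case: eqVneq => [-> _|_]; first by rewrite !mul0r subr0.
    case: eqVneq => [-> _|_]; first by rewrite mul1r E1 subrr.
    by case: eqVneq => // -> _; rewrite El subrr.
  have vv : x - e ze * e be * (x - e z) ~[q^p] 0 by rewrite -ze0; cvalue_of.
  have /(valueP hC)[rr] := regular_div hC vv; rewrite (unif_ramified bq) => hc.
  apply: (@line_order_value _ _ _ ((x - e ze * e be * (x - e z)) / y - e (z / yP))
    (e be * (x - e z)) v (rr - z / yP) (be * ((val q).1 - z)) (phi_frame_unit u q^p)).
  + exact: (valueB hC hc (value_cst hC _ _)).
  + by cvalue_of.
  + apply/orP; right; rewrite mulf_neq0 // subr_eq0.
    have := ramified_W q; rewrite bq eqxx W_pts_some.
    by case/or3P=> /eqP->; rewrite eq_sym.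
  rewrite phi_frame_W // mul_mx2_cv2 scale_id // /v.
  have id (K0 : fieldType) (r s c d m n : K0) : s != 0 ->
    (r / s - d = 1 * ((r - n * c * (r - m)) / s - d) + n / s * (c * (r - m))) *
    (c * (r - m) / s = 0 * ((r - n * c * (r - m)) / s - d) + s^-1 * (c * (r - m))).
    by move=> s0; split; field; split_neq0.
  congr cv2; [exact: (id L x y (e be) (e (z / yP)) (e z) (e ze) y0).1|
              exact: (id L x y (e be) (e (z / yP)) (e z) (e ze) y0).2].
- have qq0 : q != q0 by apply: contraNneq zt => qq; rewrite -q0z -qq at_.
  rewrite section_div_other //.
  apply: (@line_order_value _ _ _ (e be * (x - e z) / y)
    (x / y - e (z / yP) - e u.2 * (e be * (x - e z) / y)) v _ _ (phi_frame_unit u q^p) (v2q q bq)).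
  + by apply: (valueB hC (v1q q bq)); apply: (valueM hC (value_cst hC _ _) (v2q q bq)).
  + by apply/orP; left; rewrite !mulf_neq0 ?invr_eq0 // subr_eq0 at_ eq_sym.
  rewrite phi_frame_t // mul_mx2_cv2 scale_id // /v.
  have id (K0 : fieldType) (a b c : K0) : (a = c * b + 1 * (a - c * b)) * (b = 1 * b + 0 * (a - c * b)).
    by split; ring.
  congr cv2; [exact: (id L _ _ (e u.2)).1|exact: (id L (x / y - e (z / yP)) _ (e u.2)).2].
have [qq0|qq0] := eqVneq q q0; last first.
  rewrite section_div_other //.
  apply: (@line_order_value _ _ _ _ _ v _ _ (phi_frame_unit u q^p) (v1q q bq) (v2q q bq)).
    have [qz|qz] := eqVneq (val q).1 z; last by rewrite !mulf_neq0 ?orbT ?invr_eq0 // subr_eq0.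
    have bE : (val q).2 = - yP by apply: conj_of_same_fibre => //; rewrite qz.
    rewrite qz bE invrN mulrN -opprD oppr_eq0 -mulr2n mulrn_eq0 /=.
    by rewrite mulf_neq0 ?invr_eq0.
  rewrite phi_frame_other // mul1mx scale_id //.
rewrite qq0 section_div_pt.
have w1 : x / y - e (z / yP) ~[q0^p] 0.
  by apply: value_eq; [exact: v1q|rewrite q0z subrr].
have w2 : e be * (x - e z) / y ~[q0^p] 0.
  by apply: value_eq; [exact: v2q|rewrite q0z subrr mulr0 mul0r].
have /(valueP hC)[rr hc] := regular_div hC w1.
have hd : e be * (x - e z) / y / unif q0^p ~[q0^p] be / yP.
  rewrite (unif_unramified b0) q0z.
  have -> : e be * (x - e z) / y / (x - e z) = e be * y^-1.
    have id (K0 : fieldType) (a b c : K0) : b != 0 -> a * b / c / b = a * c^-1.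
      by move=> b00; rewrite mulrAC mulfK.
    exact: (id L _ _ _ xz0).
  by cvalue_of => //; exact: b0.
apply: (@line_order_value _ _ _ _ _ v _ _ (phi_frame_unit u q0^p) hc hd).
  by rewrite mulf_neq0 ?orbT ?invr_eq0.
rewrite phi_frame_other // -?qq0 // mul1mx expr1z scale_cv2 /v.
have id (K0 : fieldType) (a b : K0) : b != 0 -> a = b * (a / b).
  by move=> b00; rewrite mulrC divfK.
by congr cv2; exact: (id L _ _ (unif_neq0 hC _)).
Qed.

(** Let l = al + be x and Q = x (de + ep x). The section of the transformed bundle is
    ((Q / y + c q) / (x - t), (l / y + c) / (x - t)). The equations say that Q = zeta l at the
    points 0, 1, lam and Q - q l = ep (x - t) (x - w): the former gives regularity over W, the
    latter restricts the poles at t_1, t_2 to the direction of the line q. The constant c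
    makes the section vanish at q0, of the two points over w. *)
Lemma w_section u q0 (w al be de ep : F) : (val q0).1 = w ->
  w != 0 -> w != 1 -> w != lam -> w != t -> ep != 0 ->
  de + ep = al + be -> lam * (de + ep * lam) = u.1 * (al + be * lam) ->
  de - u.2 * be = - (ep * (t + w)) -> u.2 * al = - (ep * t * w) ->
  al != 0 -> al + be != 0 -> al + be * lam != 0 -> al + be * w != 0 ->
  extension (T_transform (phi lam t u)) (section_div q0) (fun p => - section_div q0 p).
Proof.
move=> q0w w0 w1 wl wt ep0 E1 El Et1 Et0 al0 al1 all alw.
have b0 : (val q0).2 != 0.
  by rewrite -ramified_W W_pts_some q0w !negb_or w0 w1 wl.
set yP := (val q0).2 in b0; pose c := - (al + be * w) / yP.
have c0 : c != 0 by rewrite mulf_neq0 ?oppr_eq0 ?invr_eq0.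
pose l := e al + e be * x; pose Q := x * (e de + e ep * x).
pose v := cv2 ((Q / y + e c * e u.2) / (x - e t)) ((l / y + e c) / (x - e t)).
have xt0 : x - e t != 0 := xt_neq0.
have y0 : y != 0 := @y_neq0 F lam.
have x0 : x != 0 := @x_neq0 F lam.
have xw0 : x - e w != 0 by rewrite subr_eq0 x_neq_cst.
have eep0 : e ep != 0 by rewrite fmorph_eq0.
have QlE : Q - e u.2 * l = e ep * (x - e t) * (x - e w).
  have Et1' : e de = e u.2 * e be - e ep * (e t + e w).
    by rewrite -EC_cstD -!EC_cstM -EC_cstB -Et1 [u.2 * be + _]addrC subrK.
  have Et0' : e u.2 * e al = - (e ep * e t * e w) by rewrite -!EC_cstM -EC_cstN -Et0.
  rewrite /Q /l Et1'.
  have id (K0 : comPzRingType) (r a b m n s d : K0) : d * a = - (m * s * n) ->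
    r * (d * b - m * (s + n) + m * r) - d * (a + b * r) = m * (r - s) * (r - n).
    by move=> h; rewrite [d * (a + b * r)]mulrDr h; ring.
  exact: (id L x (e al) (e be) (e ep) (e w) (e t) (e u.2) Et0').
(* v_1 - q v_2 is the first coordinate in the frame at t *)
have diffE : (Q / y + e c * e u.2) / (x - e t) - e u.2 * ((l / y + e c) / (x - e t))
    = e ep * (x - e w) / y.
  have id (K0 : fieldType) (r a b m s q d : K0) : d != 0 -> r != 0 ->
     a - q * b = m * d * s -> (a / r + q * 0) / d - q * ((b / r + 0) / d) = m * s / r.
    move=> d0 r0 h; have -> : a = q * b + m * d * s by rewrite -h [RHS]addrC subrK.
    by field; split_neq0.
  rewrite -(id L y Q l (e ep) (x - e w) (e u.2) (x - e t) xt0 y0 QlE).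
  have id2 (K0 : comUnitRingType) (A B q d m : K0) :
     (A + m * q) / d - q * ((B + m) / d) = (A + q * 0) / d - q * ((B + 0) / d) by ring.
  exact: id2.
have v0 : v != 0.
  apply/eqP => h; have h1 : (Q / y + e c * e u.2) / (x - e t) = 0.
    by move/matrixP: h => /(_ 0 0); rewrite !mxE.
  have h2 : (l / y + e c) / (x - e t) = 0.
    by move/matrixP: h => /(_ 1 0); rewrite !mxE.
  have : e ep * (x - e w) / y == 0 by rewrite -diffE h1 h2 mulr0 subr0 eqxx.
  by apply/negP; exact: (mulf_neq0 (mulf_neq0 eep0 xw0) (invr_neq0 y0)).
apply: (extension_of_section hC (h := (y * (x - e t))^-1) (v := v)) => //.
- exact: (invr_neq0 (mulf_neq0 y0 xt0)).
- exact: T_det_unit.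
have xtv q : (val q).1 != t -> (x - e t)^-1 ~[q^p] ((val q).1 - t)^-1.
  by move=> h; apply: (valueV hC (value_xt q)); rewrite subr_eq0.
have lv q : l ~[q^p] al + be * (val q).1 by rewrite /l; cvalue_of.
have Qv q : Q ~[q^p] (val q).1 * (de + ep * (val q).1) by rewrite /Q; cvalue_of.
have v1q q : (val q).2 != 0 -> (val q).1 != t -> (Q / y + e c * e u.2) / (x - e t) ~[q^p]
    ((val q).1 * (de + ep * (val q).1) / (val q).2 + c * u.2) / ((val q).1 - t).
  move=> bq atq; apply: (valueM hC _ (xtv q atq)).
  apply: (valueD hC); last by cvalue_of.
  apply: (valueM hC (Qv q)); exact: (valueV hC (EC_value_y lam0 lam1 q) bq).
have v2y q : (val q).2 != 0 -> l / y + e c ~[q^p] (al + be * (val q).1) / (val q).2 + c.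
  move=> bq; apply: (valueD hC _ (value_cst hC _ _)).
  by apply: (valueM hC (lv q)); exact: (valueV hC (EC_value_y lam0 lam1 q) bq).
have v2q q : (val q).2 != 0 -> (val q).1 != t -> (l / y + e c) / (x - e t) ~[q^p]
    ((al + be * (val q).1) / (val q).2 + c) / ((val q).1 - t).
  by move=> bq atq; exact: (valueM hC (v2y q bq) (xtv q atq)).
elim/place_cases => [|q bq|q bq at_|q bq at_].
- rewrite section_div_oo.
  (* the coordinates of (x / y) v in the frame at infinity *)
  pose w1' := (e de * x^-1 + e ep + e c * e u.2 * (y / x ^+ 2)) * (x / (x - e t)).
  pose w0' := ((e al * x^-1 + e be) * (y / x ^+ 2) + e c * (y ^+ 2 / x ^+ 3)) * (x / (x - e t)).
  have vx := EC_value_oo_x lam0 lam1; have vyx := EC_value_oo_yx lam0 lam1.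
  have vc := value_cst hC oo.
  apply: (@line_order_value _ _ _ w0' w1' v (((al * 0 + be) * 0 + c * 1) * 1)
     ((de * 0 + ep + c * u.2 * 0) * 1) (T_frame_unit u oo)).
  + apply: (valueM hC _ value_oo_xt); apply: (valueD hC).
      by apply: (valueM hC _ vyx); apply: (valueD hC _ (vc _)); apply: (valueM hC (vc _) vx).
    exact: (valueM hC (vc _) (EC_value_oo_y2 lam0 lam1)).
  + apply: (valueM hC _ value_oo_xt); apply: (valueD hC).
      by apply: (valueD hC _ (vc _)); apply: (valueM hC (vc _) vx).
    exact: (valueM hC (valueM hC (vc _) (vc _)) vyx).
  + by apply/orP; left; rewrite mulr0 add0r !mulr1.
  rewrite T_frame_oo mul_mx2_cv2 EC_unif_oo scale_cv2 /v /w0' /w1' /l /Q.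
  have id (K0 : fieldType) (r s a b m n d g k : K0) : r != 0 -> s != 0 -> r - d != 0 ->
    ((r * (m + n * r) / s + g * k) / (r - d) = (r / s) ^ (-1) *
      (0 * (((a * r^-1 + b) * (s / r ^+ 2) + g * (s ^+ 2 / r ^+ 3)) * (r / (r - d))) +
       (r / s) ^+ 2 * ((m * r^-1 + n + g * k * (s / r ^+ 2)) * (r / (r - d))))) *
    (((a + b * r) / s + g) / (r - d) = (r / s) ^ (-1) *
      ((r / s) ^+ 3 * (((a * r^-1 + b) * (s / r ^+ 2) + g * (s ^+ 2 / r ^+ 3)) * (r / (r - d))) +
       0 * ((m * r^-1 + n + g * k * (s / r ^+ 2)) * (r / (r - d))))).
    by move=> r0 s0 d0; rewrite exprN1; split; field; split_neq0.
  have [i1 i2] := id L x y (e al) (e be) (e de) (e ep) (e t) (e c) (e u.2) x0 y0 xt0.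
  by congr cv2; [exact: i1|exact: i2].
- have qq0 : q != q0 by apply: contraNneq b0 => qq; rewrite /yP -qq bq.
  rewrite section_div_other //.
  set a := (val q).1; set ze := zeta lam u a.
  have aW : [|| a == 0, a == 1 | a == lam] by rewrite -W_pts_some ramified_W bq.
  have ze0 : a * (de + ep * a) - ze * (al + be * a) = 0.
    move: aW; rewrite /ze /zeta.
    case: eqVneq => [-> _|_]; first by rewrite !mul0r subr0.
    case: eqVneq => [-> _|_]; first by rewrite !mul1r !mulr1 E1 subrr.
    by case: eqVneq => // -> _; rewrite El subrr.
  have la0 : al + be * a != 0.
    by case/or3P: aW => /eqP->; rewrite ?mulr0 ?mulr1 ?addr0.
  have vv : Q - e ze * l ~[q^p] 0.
    by rewrite -ze0; apply: (valueB hC (Qv q)); apply: (valueM hC (value_cst hC _ _) (lv q)).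
  have /(valueP hC)[rr] := regular_div hC vv; rewrite (unif_ramified bq) => hc.
  have at_ := ramified_neq_t bq.
  apply: (@line_order_value _ _ _ (((Q - e ze * l) / y + e c * (e u.2 - e ze)) / (x - e t))
    ((l + e c * y) / (x - e t)) v ((rr + c * (u.2 - ze)) / (a - t))
    ((al + be * a + c * 0) / (a - t)) (T_frame_unit u q^p)).
  + apply: (valueM hC _ (xtv q at_)); apply: (valueD hC hc).
    by apply: (valueM hC (value_cst hC _ _)); apply: (valueB hC); exact: (value_cst hC).
  + apply: (valueM hC _ (xtv q at_)); apply: (valueD hC (lv q)).
    by apply: (valueM hC (value_cst hC _ _)); rewrite -bq; exact: (EC_value_y lam0 lam1).
  + by apply/orP; right; rewrite mulr0 addr0 mulf_neq0 // invr_eq0 subr_eq0.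
  rewrite T_frame_W // mul_mx2_cv2 scale_id // /v.
  have id (K0 : fieldType) (s d A B g m n : K0) : s != 0 -> d != 0 ->
    ((A / s + g * m) / d = 1 * (((A - n * B) / s + g * (m - n)) / d) + n / s * ((B + g * s) / d)) *
    ((B / s + g) / d = 0 * (((A - n * B) / s + g * (m - n)) / d) + s^-1 * ((B + g * s) / d)).
    by move=> s0 d0; split; field; split_neq0.
  have [i1 i2] := id L y (x - e t) Q l (e c) (e u.2) (e ze) y0 xt0.
  by congr cv2; [exact: i1|exact: i2].
- have qq0 : q != q0 by apply: contraNneq wt => qq; rewrite -q0w -qq at_.
  rewrite section_div_other //.
  apply: (@line_order_value _ _ _ (e ep * (x - e w) / y) (l / y + e c) v
    (ep * (t - w) / (val q).2) _ (T_frame_unit u q^p) _ (v2y q bq)).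
  + by rewrite -at_; cvalue_of => //; exact: bq.
  + by apply/orP; left; rewrite !mulf_neq0 ?invr_eq0 // subr_eq0 eq_sym.
  rewrite T_frame_t // mul_mx2_cv2 scale_id // /v -diffE.
  have id (K0 : fieldType) (A B d m : K0) : d != 0 ->
    (A = 1 * (A - m * (B / d)) + m / d * B) *
    (B / d = 0 * (A - m * (B / d)) + d^-1 * B).
    by move=> d0; split; field; split_neq0.
  have [i1 i2] := id L ((Q / y + e c * e u.2) / (x - e t)) (l / y + e c) (x - e t) (e u.2) xt0.
  by congr cv2; [exact: i1|exact: i2].
have vdiff : e ep * (x - e w) / y ~[q^p] ep * ((val q).1 - w) / (val q).2.
  by cvalue_of => //; exact: bq.
have vdiff' := valueB hC (v1q q bq at_) (valueM hC (value_cst hC _ u.2) (v2q q bq at_)).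
have [qq0|qq0] := eqVneq q q0; last first.
  rewrite section_div_other //.
  apply: (@line_order_value _ _ _ _ _ v _ _ (T_frame_unit u q^p) (v1q q bq at_) (v2q q bq at_)).
    have [qw|qw] := eqVneq (val q).1 w.
      apply/orP; right; have bE : (val q).2 = - yP by apply: conj_of_same_fibre => //; rewrite qw.
      rewrite qw bE mulf_neq0 ?invr_eq0 ?subr_eq0 // /c invrN mulrN mulNr -opprD oppr_eq0.
      by rewrite -mulr2n mulrn_eq0 /= mulf_neq0 ?invr_eq0.
    rewrite -negb_and; apply/andP => -[/eqP z1 /eqP z2].
    move: vdiff'; rewrite z1 z2 mulr0 subr0 [X in has_value _ X _]diffE => z3.
    move: (value_uniq hC vdiff z3) => /eqP; apply/negP.
    by rewrite !mulf_neq0 ?invr_eq0 // subr_eq0.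
  by rewrite T_frame_other // mul1mx scale_id.
rewrite qq0 section_div_pt.
rewrite qq0 in bq at_ vdiff vdiff'.
have f2 : (l / y + e c) / (x - e t) ~[q0^p] 0.
  apply: value_eq; [exact: (v2q q0 bq at_)|].
  by rewrite q0w /c mulNr addrN mul0r.
have f1 : (Q / y + e c * e u.2) / (x - e t) ~[q0^p] 0.
  have v12 := valueD hC vdiff (valueM hC (value_cst hC _ u.2) f2).
  rewrite -diffE subrK in v12; apply: value_eq; [exact: v12|].
  by rewrite q0w subrr mulr0 mul0r mulr0 addr0.
have /(valueP hC)[r1 h1] := regular_div hC f1.
have /(valueP hC)[r2 h2] := regular_div hC f2.
have hd : e ep * (x - e w) / y / unif q0^p ~[q0^p] ep / yP.
  rewrite (unif_unramified b0) q0w.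
  have -> : e ep * (x - e w) / y / (x - e w) = e ep * y^-1.
    have id (K0 : fieldType) (a b m : K0) : b != 0 -> a * b / m / b = a * m^-1.
      by move=> b00; rewrite mulrAC mulfK.
    exact: (id L _ _ _ xw0).
  by cvalue_of => //; exact: b0.
apply: (@line_order_value _ _ _ _ _ v _ _ (T_frame_unit u q0^p) h1 h2).
  rewrite -negb_and; apply/andP => -[/eqP z1 /eqP z2].
  have := valueB hC h1 (valueM hC (value_cst hC _ u.2) h2).
  rewrite z1 z2 mulr0 subr0 mulrA -mulrBl [X in has_value _ (X / _) _]diffE => z3.
  move: (value_uniq hC hd z3) => /eqP; apply/negP.
  by rewrite mulf_neq0 ?invr_eq0.
rewrite T_frame_other // mul1mx expr1z scale_cv2 /v.
have id (K0 : fieldType) (a b : K0) : b != 0 -> a = b * (a / b).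
  by move=> b00; rewrite mulrC divfK.
by congr cv2; exact: (id L _ _ (unif_neq0 hC _)).
Qed.

Definition z_u u : F := lam * (1 - u.1) / (lam - u.1).
Definition w_u u : F := lam * u.2 * N1 lam t u / N2 lam t u.

(** With w_section_slope, the linear form l of w_section; these values solve its equations, with
    ep = - N2. *)
Definition w_section_const u : F := lam * t * N1 lam t u.
Definition w_section_slope u : F := - (lam * t * ((1 - u.2) * (1 - lam)))
  + t * (1 - t) * (lam - u.1) + lam * (1 - lam) * (1 - t) * u.2.

(** The conditions of z_section and w_section, with denominators cleared. *)
Definition bundle_generic u := [/\
  [/\ u.1 != 0, u.1 != 1, u.1 != lam & u.2 != 0],
  [/\ N1 lam t u != 0, N2 lam t u != 0 & lam * (1 - u.1) != t * (lam - u.1)],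
  [/\ lam * u.2 != u.1 * t & t * (1 - u.2) * (1 - lam) != (1 - t) * (t - lam * u.2)] &
  [/\ lam * u.2 * N1 lam t u != t * N2 lam t u, lam * u.2 * N1 lam t u != N2 lam t u,
  u.2 * N1 lam t u != N2 lam t u &
  w_section_const u * N2 lam t u + w_section_slope u * (lam * u.2 * N1 lam t u) != 0]].

Lemma div_neq (a b c : F) : b != 0 -> a != c * b -> a / b != c.
Proof. by move=> b0; apply: contraNneq => <-; rewrite divfK. Qed.

Lemma extension_z_coord (E : pbundle C) q : extension E (section_div q) (fun p => - section_div q p) ->
  is_z_coord E (val q).1.
Proof.
move=> h; exists q^p; split=> //; left.
have -> : (fun p => pt_div (@w_oo F lam) p - pt_div q^p p) = (fun p => - section_div q p).
  by apply/funext => p; rewrite /section_div opprB.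
exact: h.
Qed.

Lemma z_coordP (E : pbundle C) z : (forall p, frame E p \in unitmx) ->
  is_z_coord E z -> z_coord E = z.
Proof.
move=> uE hz; rewrite /z_coord; case: xgetP => [z' _ hz'|/(_ z) []//].
exact: (z_coord_unique lam0 lam1 uE hz' hz).
Qed.

Lemma is_z_coord_z u : bundle_generic u -> is_z_coord (phi lam t u) (z_u u).
Proof.
case=> -[p0 p1 pl _] [_ _ zt] _ _.
have [q0 q0z] := point_over lam (z_u u); rewrite -q0z.
have lp : lam - u.1 != 0 by rewrite subr_eq0 eq_sym.
have np : 1 - u.1 != 0 by rewrite subr_eq0 eq_sym.
have l1 : lam - 1 != 0 by rewrite subr_eq0.
apply/extension_z_coord/(z_section (z := z_u u) (be := (lam - u.1) / (u.1 * (lam - 1)))) => //.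
- by rewrite !mulf_neq0 ?invr_eq0.
- apply: div_neq => //; rewrite -subr_eq0.
  have -> : lam * (1 - u.1) - 1 * (lam - u.1) = - (u.1 * (lam - 1)) by ring.
  by rewrite oppr_eq0 mulf_neq0.
- apply: div_neq => //; rewrite -subr_eq0.
  have -> : lam * (1 - u.1) - lam * (lam - u.1) = - (lam * (lam - 1)) by ring.
  by rewrite oppr_eq0 mulf_neq0.
- exact: div_neq.
- by rewrite !mulf_neq0 ?invr_eq0 ?mulf_neq0.
- by rewrite /z_u; field; split_neq0.
by rewrite /z_u; field; split_neq0.
Qed.

Lemma is_z_coord_w u : bundle_generic u -> is_z_coord (T_transform (phi lam t u)) (w_u u).
Proof.
case=> -[_ _ _ u20] [n10 n20 _] [al1 all] [wt w1 wl alw].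
have [q0 q0w] := point_over lam (w_u u); rewrite -q0w.
have l1 : 1 - lam != 0 by rewrite subr_eq0 eq_sym.
have t1' : 1 - t != 0 by rewrite subr_eq0 eq_sym.
pose de := w_section_const u + w_section_slope u + N2 lam t u.
apply/extension_z_coord/(w_section (w := w_u u) (al := w_section_const u) (be := w_section_slope u)
  (de := de) (ep := - N2 lam t u)) => //.
- by rewrite !mulf_neq0 ?invr_eq0.
- by apply: div_neq => //; rewrite mul1r.
- by apply: div_neq => //; rewrite -mulrA (inj_eq (mulfI lam0)).
- exact: div_neq.
- by rewrite oppr_eq0.
- by rewrite /de; ring.
- by rewrite /de /w_section_const /w_section_slope /N1 /N2; ring.
- have -> : - (- N2 lam t u * (t + w_u u)) = N2 lam t u * t + lam * u.2 * N1 lam t u.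
    by rewrite /w_u; field.
  by rewrite /de /w_section_const /w_section_slope /N1 /N2; ring.
- have -> : - (- N2 lam t u * t * w_u u) = t * (lam * u.2 * N1 lam t u).
    by rewrite /w_u; field.
  by rewrite /w_section_const; ring.
- by rewrite /w_section_const !mulf_neq0.
- have -> : w_section_const u + w_section_slope u = (1 - lam) * (1 - t) * (lam * u.2 - u.1 * t).
    by rewrite /w_section_const /w_section_slope /N1; ring.
  by rewrite !mulf_neq0 // subr_eq0.
- have -> : w_section_const u + w_section_slope u * lam = lam * (1 - lam) *
      (t * (1 - u.2) * (1 - lam) - (1 - t) * (t - lam * u.2)).
    by rewrite /w_section_const /w_section_slope /N1; ring.
  by rewrite !mulf_neq0 // subr_eq0.
have -> : w_section_const u + w_section_slope u * w_u u =
    (w_section_const u * N2 lam t u + w_section_slope u * (lam * u.2 * N1 lam t u)) / N2 lam t u.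
  by rewrite /w_u; field.
by rewrite mulf_neq0 ?invr_eq0.
Qed.

Lemma zE u : bundle_generic u -> z lam t u = z_u u.
Proof. by move=> /is_z_coord_z; apply: z_coordP; exact: phi_frame_unit. Qed.

Lemma wE u : bundle_generic u -> w lam t u = w_u u.
Proof. by move=> /is_z_coord_w; apply: z_coordP; exact: T_frame_unit. Qed.

(** * Connections with simple poles over 0, 1, lambda, t *)

Lemma EC_cst_nat n : e n%:R = n%:R. Proof. exact: rmorph_nat. Qed.
Lemma EC_cstX (a : F) n : e (a ^+ n) = e a ^+ n. Proof. exact: rmorphXn. Qed.
Definition EC_cstE := (EC_cst_nat, EC_cstD, EC_cstN, EC_cstM, EC_cst0, EC_cst1, EC_cstV, EC_cstX).

Definition residue_at (r0 r1 rl rt a : F) : F :=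
  if a == 0 then r0 else if a == 1 then r1 else if a == lam then rl else
  if a == t then rt else 0.

(** A function with simple poles over 0, 1, lam, t only. Matrices of such functions contain all
    connections and Higgs fields below. *)
Definition poles (r0 r1 rl rt : F) : L :=
  e r0 / (x - e 0) + e r1 / (x - e 1) + e rl / (x - e lam) + e rt / (x - e t).

Lemma pole_regular q (r b : F) : (val q).1 != b \/ r = 0 -> regular q^p (e r / (x - e b)).
Proof.
case=> [ab|->]; last by rewrite EC_cst0 mul0r; exact: (regular0 hC).
apply: (regularM hC (regular_cst hC _ _)).
have v : x - e b ~[q^p] (val q).1 - b by cvalue_of.
by apply: (value_regular hC (valueV hC v _)); rewrite subr_eq0.
Qed.

Lemma poles_regular q r0 r1 rl rt : residue_at r0 r1 rl rt (val q).1 = 0 ->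
  regular q^p (poles r0 r1 rl rt).
Proof.
set a := (val q).1 => h.
suff [h0 h1 hl ht] : [/\ a != 0 \/ r0 = 0, a != 1 \/ r1 = 0, a != lam \/ rl = 0 & a != t \/ rt = 0].
  by do 3?[apply: (regularD hC)]; apply: pole_regular.
move: h; rewrite /residue_at; have [->|n0] := eqVneq a 0 => [r00|].
  by split; [right|left; rewrite eq_sym oner_eq0|left; rewrite eq_sym|left; rewrite eq_sym].
have [->|n1] := eqVneq a 1 => [r10|].
  by split; [left|right|left; rewrite eq_sym|left; rewrite eq_sym].
have [->|nl] := eqVneq a lam => [rl0|].
  by split; [left|left|right|left; rewrite eq_sym].
by case: eqVneq => [_ rt0|_ _]; split; try (by left); right.
Qed.

Lemma poles_value q r0 r1 rl rt :
  (x - e (val q).1) * poles r0 r1 rl rt ~[q^p] residue_at r0 r1 rl rt (val q).1.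
Proof.
set a := (val q).1.
have pole b r : (x - e a) * (e r / (x - e b)) ~[q^p] (if a == b then r else 0).
  case: eqVneq => [<-|ab].
    have xa : x - e a != 0 by rewrite subr_eq0 x_neq_cst.
    have -> : (x - e a) * (e r / (x - e a)) = e r by rewrite mulrC divfK.
    exact: (value_cst hC).
  have v : x - e a ~[q^p] 0 by apply: value_eq; [repeat cvalue_step|rewrite subrr].
  by apply: (value0M hC v); apply: pole_regular; left.
apply: value_eq; first by rewrite /poles !mulrDr; do 3?[apply: (valueD hC)]; exact: pole.
rewrite /residue_at; case: (eqVneq a 0) => [->|n0].
  by rewrite eq_sym oner_eq0 eq_sym (negbTE lam0) eq_sym (negbTE t0) !addr0.
case: (eqVneq a 1) => [->|n1].
  by rewrite eq_sym (negbTE lam1) eq_sym (negbTE t1) add0r !addr0.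
case: (eqVneq a lam) => [->|nl]; last by rewrite !add0r.
by rewrite eq_sym (negbTE tlam) addr0 !add0r.
Qed.

Lemma poles_oo r0 r1 rl rt : x * poles r0 r1 rl rt ~[oo] r0 + r1 + rl + rt.
Proof.
have pole b r : x * (e r / (x - e b)) ~[oo] r.
  have xb0 : x - e b != 0 by rewrite subr_eq0 x_neq_cst.
  have v := valueB hC (value1 hC oo) (valueM hC (value_cst hC oo b) (EC_value_oo_x lam0 lam1)).
  have v1 : 1 - e b * x^-1 ~[oo] 1 by apply: value_eq; [exact: v|rewrite mulr0 subr0].
  have v2 := valueM hC (value_cst hC oo r) (valueV hC v1 (oner_neq0 F)).
  have -> : x * (e r / (x - e b)) = e r * (1 - e b * x^-1)^-1.
    have id (K0 : fieldType) (f g s : K0) : f != 0 -> f - s != 0 ->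
        f * (g / (f - s)) = g * (1 - s * f^-1)^-1.
      by move=> r00 s0; field; split_neq0.
    exact: (id L x (e r) (e b) (@x_neq0 F lam) xb0).
  by apply: value_eq; [exact: v2|rewrite invr1 mulr1].
by rewrite /poles !mulrDr; do 3?[apply: (valueD hC)]; exact: pole.
Qed.

Lemma poles_oo2 r0 r1 rl rt : r0 + r1 + rl + rt = 0 ->
  regular oo (x ^+ 2 * poles r0 r1 rl rt).
Proof.
move=> rs; have -> : x ^+ 2 * poles r0 r1 rl rt = x * poles 0 r1 (lam * rl) (t * rt).
  have xb b : x - e b != 0 by rewrite subr_eq0 x_neq_cst.
  have r0E : e r0 = - (e r1 + e rl + e rt).
    by rewrite -!EC_cstD -EC_cstN; congr e; apply/eqP; rewrite -addr_eq0 !addrA rs.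
  rewrite /poles r0E !EC_cstM EC_cst0 EC_cst1.
  have id (K0 : fieldType) (f a b d l s : K0) : f - 0 != 0 -> f - 1 != 0 -> f - l != 0 ->
    f - s != 0 ->
    f ^+ 2 * (- (a + b + d) / (f - 0) + a / (f - 1) + b / (f - l) + d / (f - s)) =
    f * (0 / (f - 0) + a / (f - 1) + l * b / (f - l) + s * d / (f - s)).
    by rewrite subr0 => *; field; split_neq0.
  have xb0 := xb 0; have xb1 := xb 1; rewrite EC_cst0 in xb0; rewrite EC_cst1 in xb1.
  exact: (id L x (e r1) (e rl) (e rt) (e lam) (e t) xb0 xb1 (xb lam) (xb t)).
exact: (value_regular hC (poles_oo _ _ _ _)).
Qed.

Lemma polesD r0 r1 rl rt s0 s1 sl st : poles r0 r1 rl rt + poles s0 s1 sl st =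
  poles (r0 + s0) (r1 + s1) (rl + sl) (rt + st).
Proof.
rewrite /poles !EC_cstD; have id (K0 : comPzRingType) (a b c d a' b' c' d' i j k l : K0) :
  a * i + b * j + c * k + d * l + (a' * i + b' * j + c' * k + d' * l) =
  (a + a') * i + (b + b') * j + (c + c') * k + (d + d') * l by ring.
exact: id.
Qed.

Lemma polesZ c r0 r1 rl rt : e c * poles r0 r1 rl rt = poles (c * r0) (c * r1) (c * rl) (c * rt).
Proof. by rewrite /poles !EC_cstM !mulrDr !mulrA. Qed.

Lemma EC_dPE : EC_dP lam = x * (x - 1) + x * (x - e lam) + (x - 1) * (x - e lam).
Proof.
have -> : EC_dP lam = EC_deriv (pull lam (PK lam)).
  by rewrite EC_deriv_pull ratfun_deriv_poly.
have d1 (c : F) : EC_deriv (x - e c) = 1.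
  by rewrite EC_derivD EC_deriv_x EC_derivN EC_deriv_cst oppr0 addr0.
rewrite legendreE // -EC_cst1 !EC_derivM !d1 EC_deriv_x EC_cst1.
have id (K0 : comPzRingType) (f g h : K0) : (1 * g + f * 1) * h + f * g * 1 = f * g + f * h + g * h.
  by ring.
exact: id.
Qed.

Lemma value_dP q : EC_dP lam ~[q^p] (P^`()).[(val q).1].
Proof. exact: (EC_value_poly lam0 lam1 q P^`()). Qed.

(** For P = P1 (X - a) both are equal to P1(a). *)
Lemma ramified_quotient q : (val q).2 = 0 ->
  y ^+ 2 / (x - e (val q).1) ~[q^p] (P^`()).[(val q).1] /\ (P^`()).[(val q).1] != 0.
Proof.
move=> b0; have Pa : P.[(val q).1] = 0 by rewrite -(eqP (valP q)) b0 expr0n.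
have [P1 PE P1a] := legendre_simple_root lam0 lam1 Pa.
have dPE : (P^`()).[(val q).1] = P1.[(val q).1].
  have aux (a : F) (f g : {poly F}) : f = g * ('X - a%:P) -> (f^`()).[a] = g.[a].
    by move=> ->; rewrite derivM derivB derivX derivC subr0 mulr1 !hornerE subrr mulr0 add0r.
  exact: aux PE.
rewrite dPE; split=> //.
have -> : y ^+ 2 / (x - e (val q).1) = pull lam P1%:F.
  rewrite EC_y2 // /PK.
  have -> : (P%:F : ratfun F) = P1%:F * (ratfun_x F - ratfun_cst (val q).1).
    by rewrite -tofracB -tofracM -PE.
  have xa : x - e (val q).1 != 0 by rewrite subr_eq0 x_neq_cst.
  by rewrite pullM pullD pullN mulfK.
exact: (EC_value_poly lam0 lam1 q P1).
Qed.

Lemma deriv_cst_mul (c : F) f : EC_deriv (e c * f) = e c * EC_deriv f.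
Proof. by rewrite EC_derivM EC_deriv_cst mul0r add0r. Qed.

Lemma EC_deriv1 : EC_deriv (1 : L) = 0.
Proof. by rewrite -EC_cst1 EC_deriv_cst. Qed.

Lemma map_ddx (a b c d : L) : map_mx (ddx (c := C)) (mx2 a b c d) =
  mx2 (EC_deriv a) (EC_deriv b) (EC_deriv c) (EC_deriv d).
Proof. exact: map_mx2. Qed.

Lemma dP_neq0 : EC_dP lam != 0.
Proof.
have [q qE] := point_over lam 0.
have b0 : (val q).2 = 0 by apply/eqP; rewrite -ramified_W qE W_pts_some eqxx.
have [_ nz] := ramified_quotient b0; apply: contraNneq nz => h; apply/eqP.
by have := value_dP q; rewrite h => h'; exact: (value_uniq hC h' (value0 hC _)).
Qed.

(** The matrix d + A dx in the frame at a ramification point with line z, with respect to dr for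
    r = y; here D = P'(x) = 2 r dr / dx and s = x - a. *)
Lemma gauge_ramified (K0 : fieldType) (a b c d z r D s : K0) : r != 0 -> D != 0 -> (2%:R : K0) != 0 -> s != 0 ->
    (D / (r *+ 2))^-1 *: (invmx (mx2 1 (z / r) 0 r^-1) *m mx2 a b c d *m mx2 1 (z / r) 0 r^-1 +
     invmx (mx2 1 (z / r) 0 r^-1) *m mx2 0 (z * (- (D / (r *+ 2)) / r ^+ 2)) 0 (- (D / (r *+ 2)) / r ^+ 2)) =
    mx2 ((a - z * c) * (2%:R * r * D^-1)) ((a * z + b - z * (c * z + d)) * (2%:R * D^-1))
       (2%:R * (r ^+ 2 / s) * (s * c) * D^-1)
       ((2%:R * (r ^+ 2 / s) * (s * (c * z + d)) * D^-1 - 1) / r).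
Proof.
move=> r0 D00 n20 s0.
have [_ ->] : mx2 1 (z / r) 0 r^-1 \in unitmx /\ invmx (mx2 1 (z / r) 0 r^-1) = mx2 1 (- z) 0 r.
  apply: invmx_of; rewrite mul_mx2 scalar_mx2 mulVf // divfK //.
  by rewrite !(mul0r, mul1r, mulr0, mulr1, addr0, add0r) addNr.
rewrite -[r *+ 2]mulr_natl; set m := D / (2%:R * r).
have mE : m^-1 = 2%:R * r * D^-1 by rewrite invf_div.
have m0 : m != 0 by rewrite mulf_neq0 ?invr_eq0 ?mulf_neq0.
rewrite !mul_mx2 add_mx2 scale_mx2 mE; congr mx2; last first.
- have -> : 2%:R * (r ^+ 2 / s) * (s * (c * z + d)) * D^-1 = r * (m^-1 * (c * z + d)).
    by rewrite mE; field; split_neq0.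
  by rewrite -mE; move: m m0 {mE} => m m0; field; split_neq0.
- by field; split_neq0.
- by move: m {mE m0} => m; field; split_neq0.
by ring.
Qed.

(** The residue of A at a acts on the line (ze, 1) by 1/2 and has eigenvalues 1/2 and 0: this is
    the content of the first, second and fourth hypotheses. The pull back doubles the
    eigenvalues, to 1 and 0, and the elementary transformation lowers the first one to 0. *)
Lemma local_conn_W u (a b c d : L) q : (val q).2 = 0 ->
  let ze := e (zeta lam u (val q).1) in
  regular q^p (a - ze * c) -> regular q^p (a * ze + b - ze * (c * ze + d)) ->
  regular q^p ((x - e (val q).1) * c) ->
  (x - e (val q).1) * (c * ze + d) ~[q^p] 2%:R^-1 ->
  mx_regular q^p (local_conn (phi lam t u) (mx2 a b c d) q^p).
Proof.
move=> b0 ze r1 r2 r3 v4.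
have y0 : y != 0 := @y_neq0 F lam.
have n2 : (2%:R : L) != 0 := nat2_neq0 lam.
have xa0 : x - e (val q).1 != 0 by rewrite subr_eq0 x_neq_cst.
have D0 := dP_neq0.
pose D := EC_dP lam; pose s := y ^+ 2 / (x - e (val q).1).
have [vs P'0] := ramified_quotient b0.
have vD' := valueV hC (value_dP q) P'0.
have rD := value_regular hC vD'.
have r2' : regular q^p (2%:R : L) by rewrite -EC_cst_nat; exact: (regular_cst hC).
have ry := value_regular hC (EC_value_y lam0 lam1 q).
have eqn : local_conn (phi lam t u) (mx2 a b c d) q^p =
   mx2 ((a - ze * c) * (2%:R * y * D^-1)) ((a * ze + b - ze * (c * ze + d)) * (2%:R * D^-1))
       (2%:R * s * ((x - e (val q).1) * c) * D^-1)
       ((2%:R * s * ((x - e (val q).1) * (c * ze + d)) * D^-1 - 1) / y).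
  rewrite /local_conn (phi_frame_W u b0) (unif_ramified b0) -/ze.
  rewrite map_ddx deriv_cst_mul (EC_derivV y0) EC_deriv1 EC_deriv0 EC_deriv_y.
  rewrite (_ : ddx (y : ffield C) = EC_dP lam / (y *+ 2)) -/D /s; last exact: EC_deriv_y.
  exact: (gauge_ramified a b c d ze y0 D0 n2 xa0).
rewrite eqn; apply: mx2_forall; rewrite mx2E.
- by apply: (regularM hC r1); apply: (regularM hC _ rD); exact: (regularM hC r2' ry).
- by apply: (regularM hC r2); exact: (regularM hC r2' rD).
- apply: (regularM hC _ rD); apply: (regularM hC _ r3); apply: (regularM hC r2').
  exact: (value_regular hC vs).
rewrite -(unif_ramified b0); apply: (regular_div hC).
have v2 : (2%:R : L) ~[q^p] 2%:R by rewrite -EC_cst_nat; exact: (value_cst hC).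
have vv := valueB hC (valueM hC (valueM hC (valueM hC v2 vs) v4) vD') (value1 hC q^p).
apply: value_eq; first exact: vv.
by field; split_neq0; rewrite pnatr_eq0.
Qed.

Lemma local_conn_other u (A : 'M[L]_2) q : (val q).2 != 0 -> (val q).1 != t ->
  mx_regular q^p A -> mx_regular q^p (local_conn (phi lam t u) A q^p).
Proof.
move=> b0 at_ rA; rewrite /local_conn phi_frame_other // (unif_unramified b0).
have -> : ddx (x - e (val q).1 : ffield C) = 1.
  by rewrite /= EC_derivD EC_deriv_x EC_derivN EC_deriv_cst oppr0 addr0.
have -> : map_mx (ddx (c := C)) (1%:M : 'M[L]_2) = 0.
  rewrite scalar_mx2 map_ddx EC_deriv1 EC_deriv0.
  by apply: mx2P; rewrite !mxE.
by rewrite mulmx0 addr0 invr1 scale1r invmx1 mul1mx mulmx1.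
Qed.

Lemma conj_line (K0 : pzRingType) (a b c d z : K0) :
  mx2 0 1 1 (- z) *m mx2 a b c d *m mx2 z 1 1 0 + mx2 0 1 1 (- z) *m mx2 0 0 0 0 =
  mx2 (c * z + d) c (a * z + b - z * (c * z + d)) (a - z * c).
Proof.
rewrite !mul_mx2 add_mx2; congr mx2; rewrite !(mul0r, mul1r, mulr0, mulr1, addr0, add0r) //.
  by rewrite mulrDl !mulNr mulrDr opprD [z * (c * z)]mulrA addrACA.
by rewrite mulNr.
Qed.

(** The equations say that the residue at t has (q, 1) as eigenvector, with eigenvalue n, and
    that its other eigenvalue is - n. *)
Lemma local_conn_t u (a b c d : L) q (ra rb rc rd n : F) : (val q).2 != 0 -> (val q).1 = t ->
  (x - e t) * a ~[q^p] ra -> (x - e t) * b ~[q^p] rb ->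
  (x - e t) * c ~[q^p] rc -> (x - e t) * d ~[q^p] rd ->
  rc * u.2 + rd = n -> ra - u.2 * rc = - n -> ra * u.2 + rb = u.2 * n ->
  log_pole q^p (local_conn (phi lam t u) (mx2 a b c d) q^p) n (- n).
Proof.
move=> b0 at_ va vb vc vd E1 E2 E3.
pose Q := e u.2.
have eqn : local_conn (phi lam t u) (mx2 a b c d) q^p =
   mx2 (c * Q + d) c (a * Q + b - Q * (c * Q + d)) (a - Q * c).
  rewrite /local_conn phi_frame_t // (unif_unramified b0).
  have -> : ddx (x - e (val q).1 : ffield C) = 1.
    by rewrite /= EC_derivD EC_deriv_x EC_derivN EC_deriv_cst oppr0 addr0.
  rewrite map_ddx EC_deriv_cst EC_deriv1 EC_deriv0.
  rewrite invr1 scale1r invmx_line -/Q.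
  exact: conj_line.
rewrite /log_pole eqn scale_mx2 !mx2E (unif_unramified b0) at_.
have vQ := value_cst hC q^p u.2.
have id1 (s f g h : L) : s * (f * h + g) = s * f * h + s * g.
  by rewrite mulrDr mulrA.
have id2 (s f g h : L) : s * (f - h * g) = s * f - h * (s * g).
  by rewrite mulrBr mulrCA.
have v00 : (x - e t) * (c * Q + d) ~[q^p] n.
  by rewrite id1 -E1; exact: (valueD hC (valueM hC vc vQ) vd).
split.
- exact: (value_regular hC vc).
- apply/(vanishesP hC); rewrite id2 id1; apply: value_eq.
    exact: (valueB hC (valueD hC (valueM hC va vQ) vb) (valueM hC vQ v00)).
  by rewrite E3 subrr.
- exact: v00.
by rewrite id2 -E2; exact: (valueB hC va (valueM hC vQ vc)).
Qed.

(** The frame at infinity has columns p ^ 2 e_2 and p e_1, with p = x / y. *)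
Lemma gauge_oo (K0 : fieldType) (a b c d p p' : K0) : p != 0 -> p' != 0 ->
  p'^-1 *: (invmx (mx2 0 p (p ^+ 2) 0) *m mx2 a b c d *m mx2 0 p (p ^+ 2) 0 +
    invmx (mx2 0 p (p ^+ 2) 0) *m mx2 0 p' (p' * p + p * p') 0) =
  mx2 (d * p'^-1 + 2%:R / p) (c / p * p'^-1) (b * p * p'^-1) (a * p'^-1 + 1 / p).
Proof.
move=> p0 p'0.
have [_ ->] : mx2 0 p (p ^+ 2) 0 \in unitmx /\
    invmx (mx2 0 p (p ^+ 2) 0) = mx2 0 (p ^- 2) p^-1 0.
  apply: invmx_of; rewrite mul_mx2 scalar_mx2 !(mul0r, mulr0, addr0, add0r).
  by rewrite !mulfV // expf_neq0.
by rewrite !mul_mx2 add_mx2 scale_mx2; congr mx2; field; split_neq0.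
Qed.

(** As x behaves like (x / y) ^ -2 at infinity, dx / d(x / y) is - 2 y times a unit with value 1. *)
Lemma ddx_unif_oo : let kap := (y * ddx (unif oo))^-1 in
  [/\ ddx (unif oo) != 0, kap ~[oo] - 2%:R & (ddx (unif oo))^-1 = y * kap].
Proof.
have y0 : y != 0 := @y_neq0 F lam.
have x0 : x != 0 := @x_neq0 F lam.
have n2 : (2%:R : L) != 0 := nat2_neq0 lam.
set f := y * _.
have fE : f = (2%:R * (y ^+ 2 / x ^+ 3) - EC_dP lam / x ^+ 2) / (2%:R * (y ^+ 2 / x ^+ 3)).
  have -> : f = y * (y^-1 + x * (- (EC_dP lam / (y *+ 2)) / y ^+ 2)).
    rewrite /f EC_unif_oo (_ : ddx (x / y : ffield C) = EC_deriv (x / y)) // EC_derivM EC_deriv_x (EC_derivV y0).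
    by rewrite EC_deriv_y mul1r.
  have id (K0 : fieldType) (r s D : K0) : r != 0 -> s != 0 -> (2%:R : K0) != 0 ->
      s * (s^-1 + r * (- (D / (s *+ 2)) / s ^+ 2)) =
      (2%:R * (s ^+ 2 / r ^+ 3) - D / r ^+ 2) / (2%:R * (s ^+ 2 / r ^+ 3)).
    by move=> r0 s0 n20; rewrite -[s *+ 2]mulr_natl; field; split_neq0.
  exact: (id L x y (EC_dP lam) x0 y0 n2).
have v2 : (2%:R : L) ~[oo] 2%:R by rewrite -EC_cst_nat; exact: (value_cst hC).
have v2y := valueM hC v2 (EC_value_oo_y2 lam0 lam1).
have vD : EC_dP lam / x ^+ 2 ~[oo] 3%:R.
  have := @EC_value_oo_poly F lam lam0 lam1 P^`() 2.
  rewrite coef_deriv legendre_coef3 //; apply.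
  by rewrite (leq_trans (size_poly _ _)) // size_legendre_poly.
have n20 : 2%:R * 1 != 0 :> F by rewrite mulr1 pnatr_eq0.
have vf := valueM hC (valueB hC v2y vD) (valueV hC v2y n20).
rewrite -fE in vf.
(* 2 and 3 are the orders of the poles of x and y at infinity *)
have f1 : (2%:R * 1 - 3%:R) / (2%:R * 1) = - 2%:R^-1 :> F.
  by rewrite mulr1; have n20' : 2%:R != 0 :> F by []; field.
rewrite f1 in vf.
have f2 : - 2%:R^-1 != 0 :> F by rewrite oppr_eq0 invr_eq0 pnatr_eq0.
have vk := valueV hC vf f2; rewrite invrN invrK in vk.
have [f0 _ _] := unit_of_value hC vf f2.
have d0 : ddx (unif oo) != 0.
  by apply: contraNneq f0 => h; rewrite /f h mulr0.
split=> //.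
have id (K0 : fieldType) (r s : K0) : r != 0 -> s^-1 = r * (r * s)^-1.
  by move=> r0; rewrite invfM mulrA mulfV // mul1r.
exact: (id L y (ddx (unif oo)) y0).
Qed.

(** In terms of 1 / x the columns p ^ 2 e_2 and p e_1 of the frame, p = x / y, have exponents 1
    and 1/2, which must be the values of x d and x a. The entry c is divided by p ^ 4, that is by
    1 / x ^ 2 up to a unit. *)
Lemma local_conn_oo u (a b c d : L) : x * a ~[oo] 2%:R^-1 -> x * d ~[oo] 1 ->
  regular oo (x * b) -> regular oo (x ^+ 2 * c) ->
  mx_regular oo (local_conn (phi lam t u) (mx2 a b c d) oo).
Proof.
move=> va vd rb rc.
have y0 : y != 0 := @y_neq0 F lam.
have x0 : x != 0 := @x_neq0 F lam.
have xy0 : x / y != 0 := mulf_neq0 x0 (invr_neq0 y0).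
have [d0 vk dV] := ddx_unif_oo; set kap := (_^-1) in vk dV.
have eqn : local_conn (phi lam t u) (mx2 a b c d) oo =
  mx2 ((x * d * kap + 2%:R) / unif oo) (x ^+ 2 * c * (y ^+ 2 / x ^+ 3) * kap)
      (x * b * kap) ((x * a * kap + 1) / unif oo).
  have d0' := d0; have dV' := dV.
  have dE : ddx (x / y : ffield C) = EC_deriv (x / y) by [].
  rewrite EC_unif_oo dE in d0' dV'.
  have sqr (f : L) : EC_deriv (f ^+ 2) = EC_deriv f * f + f * EC_deriv f by rewrite expr2 EC_derivM.
  rewrite /local_conn phi_frame_oo EC_unif_oo map_ddx EC_deriv0 dE sqr.
  rewrite (gauge_oo a b c d xy0 d0') dV'.
  have id (K0 : fieldType) (f g h r s m n : K0) : r != 0 -> s != 0 ->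
    [/\ h * (s * m) + n / (r / s) = (r * h * m + n) / (r / s),
        g / (r / s) * (s * m) = r ^+ 2 * g * (s ^+ 2 / r ^+ 3) * m &
        f * (r / s) * (s * m) = r * f * m].
    by move=> r0 s0; split; field; split_neq0.
  have [i1 i2 i3] := id L b c d x y kap 2%:R x0 y0.
  have [i4 _ _] := id L b c a x y kap 1 x0 y0.
  by rewrite i1 i2 i3 i4.
rewrite eqn; apply: mx2_forall; rewrite mx2E.
- apply: (regular_div hC); apply: value_eq.
    apply: (valueD hC (valueM hC vd vk)); rewrite -EC_cst_nat; exact: (value_cst hC).
  by rewrite mul1r addNr.
- apply: (regularM hC _ (value_regular hC vk)); apply: (regularM hC rc).
  exact: (value_regular hC (EC_value_oo_y2 lam0 lam1)).
- exact: (regularM hC rb (value_regular hC vk)).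
apply: (regular_div hC); apply: value_eq.
  exact: (valueD hC (valueM hC va vk) (value1 hC _)).
by rewrite mulrN mulVf ?pnatr_eq0 // addNr.
Qed.

Variable nu : F.

Definition conn_of u d1 d2 : 'M[ratfun F]_2 :=
  nabla0 lam t nu u + ratfun_cst d1 *: Theta1 t u + ratfun_cst d2 *: Theta2 lam u.

Lemma map_conn_theta (K0 K1 : fieldType) (f : {rmorphism K0 -> K1}) (s l r a b n c d : K0) :
  map_mx f (conn_mx s l r a b n + c *: theta_mx s r b + d *: theta_mx s l a) =
  conn_mx (f s) (f l) (f r) (f a) (f b) (f n) + f c *: theta_mx (f s) (f r) (f b)
    + f d *: theta_mx (f s) (f l) (f a).
Proof.
rewrite /conn_mx /theta_mx !scale_mx2 !add_mx2 map_mx2.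
by congr mx2; rewrite !(rmorphD, rmorphN, rmorphM, fmorphV, rmorphXn, rmorph_nat, rmorph1, rmorph0).
Qed.

Lemma conn_theta_sum (K0 : fieldType) (s l r a b n d1 d2 : K0) :
  s != 0 -> s - 1 != 0 -> s - l != 0 -> s - r != 0 -> 2%:R != 0 :> K0 -> 4%:R != 0 :> K0 ->
  conn_mx s l r a b n + d1 *: theta_mx s r b + d2 *: theta_mx s l a
    + (4%:R^-1 * (s^-1 + (s - 1)^-1 + (s - l)^-1))%:M =
  mx2 (0 / (s - 0) + (2%:R^-1 + (n + d1 * b + d2 * a)) / (s - 1) + - (d2 * a) / (s - l)
          + (- n + - (d1 * b)) / (s - r))
      (0 / (s - 0) + - (n + d1 * b + d2 * a) / (s - 1)
          + (2%:R^-1 * a + d2 * a ^+ 2) / (s - l) + (2%:R * n * b + d1 * b ^+ 2) / (s - r))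
      ((- 2%:R^-1 + - n + d1 * (1 + - b) + d2 * (1 + - a)) / (s - 0)
          + (2%:R^-1 + (n + d1 * b + d2 * a)) / (s - 1) + - d2 / (s - l) + - d1 / (s - r))
      (2%:R^-1 / (s - 0) + - (n + d1 * b + d2 * a) / (s - 1) + (2%:R^-1 + d2 * a) / (s - l)
          + (n + d1 * b) / (s - r)).
Proof.
move=> s0 s1 sl sr n2 n4; rewrite subr0 /conn_mx /theta_mx scalar_mx2 !scale_mx2 !add_mx2.
by congr mx2; field; split_neq0.
Qed.

Lemma pull_conn_of u (d1 d2 : F) : let m := nu + d1 * u.2 + d2 * u.1 in
  Phi_conn lam (conn_of u d1 d2) =
  mx2 (poles 0 (2%:R^-1 + m) (- (d2 * u.1)) (- nu - d1 * u.2))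
      (poles 0 (- m) (2%:R^-1 * u.1 + d2 * u.1 ^+ 2) (2%:R * nu * u.2 + d1 * u.2 ^+ 2))
      (poles (- 2%:R^-1 - nu + d1 * (1 - u.2) + d2 * (1 - u.1)) (2%:R^-1 + m) (- d2) (- d1))
      (poles 2%:R^-1 (- m) (2%:R^-1 + d2 * u.1) (nu + d1 * u.2)).
Proof.
move=> m; rewrite /Phi_conn /Phi_higgs /conn_of nabla0_mx Theta1_mx Theta2_mx.
have E : map_mx (pull lam) (conn_mx (ratfun_x F) (ratfun_cst lam) (ratfun_cst t) (ratfun_cst u.1)
      (ratfun_cst u.2) (ratfun_cst nu) + ratfun_cst d1 *: theta_mx (ratfun_x F) (ratfun_cst t)
      (ratfun_cst u.2) + ratfun_cst d2 *: theta_mx (ratfun_x F) (ratfun_cst lam) (ratfun_cst u.1)) =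
    conn_mx x (e lam) (e t) (e u.1) (e u.2) (e nu) + e d1 *: theta_mx x (e t) (e u.2)
      + e d2 *: theta_mx x (e lam) (e u.1).
  exact: (map_conn_theta (pull lam)).
rewrite E.
have -> : pull lam (ratfun_cst 4%:R^-1 * (dlog 0 + dlog 1 + dlog lam)) =
   4%:R^-1 * ((x - 0)^-1 + (x - 1)^-1 + (x - e lam)^-1).
  rewrite /dlog pullM !pullD !pullV !pullD !pullN -![pull lam (ratfun_cst _)]/(e _).
  by rewrite EC_cst0 EC_cst1 EC_cstV EC_cst_nat.
rewrite subr0.
rewrite /poles /m !EC_cstE.
have xb b : x - e b != 0 by rewrite subr_eq0 x_neq_cst.
have xb0 := xb 0; have xb1 := xb 1; rewrite EC_cst0 subr0 in xb0; rewrite EC_cst1 in xb1.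
have n4 : 4%:R != 0 :> L by rewrite (_ : 4 = 2 * 2)%N // natrM; exact: (mulf_neq0 (nat2_neq0 lam) (nat2_neq0 lam)).
exact: (@conn_theta_sum L x (e lam) (e t) (e u.1) (e u.2) (e nu) (e d1) (e d2) xb0 xb1 (xb lam) (xb t)
  (nat2_neq0 lam) n4).
Qed.

Lemma residue_at_0 r0 r1 rl rt : residue_at r0 r1 rl rt 0 = r0.
Proof. by rewrite /residue_at eqxx. Qed.
Lemma residue_at_1 r0 r1 rl rt : residue_at r0 r1 rl rt 1 = r1.
Proof. by rewrite /residue_at eqxx oner_eq0. Qed.
Lemma residue_at_lam r0 r1 rl rt : residue_at r0 r1 rl rt lam = rl.
Proof. by rewrite /residue_at eqxx (negbTE lam0) (negbTE lam1). Qed.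
Lemma residue_at_t r0 r1 rl rt : residue_at r0 r1 rl rt t = rt.
Proof. by rewrite /residue_at eqxx (negbTE t0) (negbTE t1) (negbTE tlam). Qed.

Lemma zetaE u : [/\ zeta lam u 0 = 0, zeta lam u 1 = 1 & zeta lam u lam = u.1].
Proof. by rewrite /zeta !eqxx oner_eq0 (negbTE lam0) (negbTE lam1). Qed.

Lemma polesN r0 r1 rl rt : - poles r0 r1 rl rt = poles (- r0) (- r1) (- rl) (- rt).
Proof. by rewrite -mulN1r -EC_cst1 -EC_cstN polesZ !mulN1r. Qed.

Lemma polesB r0 r1 rl rt s0 s1 sl st : poles r0 r1 rl rt - poles s0 s1 sl st =
  poles (r0 - s0) (r1 - s1) (rl - sl) (rt - st).
Proof. by rewrite polesN polesD. Qed.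

Lemma ramified_cases q : (val q).2 = 0 -> [\/ (val q).1 = 0, (val q).1 = 1 | (val q).1 = lam].
Proof.
move=> b0; have := ramified_W q; rewrite b0 eqxx W_pts_some.
by case/or3P => /eqP ->; [constructor 1|constructor 2|constructor 3].
Qed.

Lemma conn_of_regular u d1 d2 p : ~~ ppts (phi lam t u) p ->
  mx_regular p (local_conn (phi lam t u) (Phi_conn lam (conn_of u d1 d2)) p).
Proof.
rewrite phi_ppts pull_conn_of; set m := nu + _ + _.
have n2 : 2%:R != 0 :> F by rewrite pnatr_eq0.
have [z0 z1 zl] := zetaE u.
elim/place_cases: p => [|q b0|q b0 at_|q b0 at_] ppt.
- apply: local_conn_oo.
  + by apply: value_eq; [exact: poles_oo|rewrite /m; ring].
  + by apply: value_eq; [exact: poles_oo|rewrite /m; field].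
  + exact: (value_regular hC (poles_oo _ _ _ _)).
  by apply: poles_oo2; rewrite /m; ring.
- apply: local_conn_W => //.
  + rewrite polesZ polesB; apply: poles_regular; case: (ramified_cases b0) => ->.
    * by rewrite residue_at_0 z0; ring.
    * by rewrite residue_at_1 z1; ring.
    by rewrite residue_at_lam zl; ring.
  + rewrite [in X in regular _ X]mulrC [_ * e _ in X in regular _ X]mulrC.
    rewrite !(polesZ, polesD, polesB); apply: poles_regular; case: (ramified_cases b0) => ->.
    * by rewrite residue_at_0 z0; ring.
    * by rewrite residue_at_1 z1; ring.
    by rewrite residue_at_lam zl; field.
  + exact: (value_regular hC (poles_value _ _ _ _ _)).
  rewrite [poles _ _ _ _ * e _]mulrC polesZ polesD; apply: value_eq; first exact: poles_value.
  case: (ramified_cases b0) => ->.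
    + by rewrite residue_at_0 z0; ring.
    + by rewrite residue_at_1 z1; ring.
    by rewrite residue_at_lam zl; ring.
- by move: ppt; rewrite /= at_ eqxx.
apply: local_conn_other => //.
have rg r0 r1 rl rt : regular q^p (poles r0 r1 rl rt).
  apply: poles_regular; move: (b0); rewrite -ramified_W W_pts_some !negb_or => /and3P[n0 n1 nl].
  by rewrite /residue_at (negbTE n0) (negbTE n1) (negbTE nl) (negbTE at_).
by apply: mx2_forall; rewrite mx2E; exact: rg.
Qed.

Lemma conn_of_log_pole u d1 d2 p : ppts (phi lam t u) p ->
  log_pole p (local_conn (phi lam t u) (Phi_conn lam (conn_of u d1 d2)) p) nu (- nu).
Proof.
rewrite phi_ppts; case: p => [q|//] /eqP[at_].
have b0 : (val q).2 != 0 by rewrite -ramified_W at_ W_pts_t.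
have pv r0 r1 rl rt : (x - e t) * poles r0 r1 rl rt ~[q^p] rt.
  by have := poles_value q r0 r1 rl rt; rewrite at_ residue_at_t.
rewrite pull_conn_of; apply: local_conn_t => //; try exact: pv; by ring.
Qed.

Lemma conn_of_trace u d1 d2 :
  \tr (Phi_conn lam (conn_of u d1 d2)) * y^-1 + ddx (y^-1 : ffield C) = 0.
Proof.
have y0 : y != 0 := @y_neq0 F lam.
rewrite pull_conn_of tr_mx2 !mx2E polesD.
rewrite (_ : ddx (y^-1 : ffield C) = - (EC_dP lam / (y *+ 2)) / y ^+ 2); last first.
  by rewrite -EC_deriv_y -EC_derivV.
have -> : poles (0 + 2%:R^-1) (2%:R^-1 + (nu + d1 * u.2 + d2 * u.1) - (nu + d1 * u.2 + d2 * u.1))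
   (- (d2 * u.1) + (2%:R^-1 + d2 * u.1)) (- nu - d1 * u.2 + (nu + d1 * u.2)) =
   poles 2%:R^-1 2%:R^-1 2%:R^-1 0.
  by congr poles; ring.
rewrite /poles EC_dPE EC_cstV EC_cst_nat EC_cst0 EC_cst1.
have xb b : x - e b != 0 by rewrite subr_eq0 x_neq_cst.
have xb0 := xb 0; have xb1 := xb 1; rewrite EC_cst0 subr0 in xb0; rewrite EC_cst1 in xb1.
have id (K0 : fieldType) (r s l w : K0) : r != 0 -> r - 1 != 0 -> r - l != 0 -> s != 0 ->
  2%:R != 0 :> K0 -> s ^+ 2 = r * (r - 1) * (r - l) ->
  (2%:R^-1 / (r - 0) + 2%:R^-1 / (r - 1) + 2%:R^-1 / (r - l) + 0 / w) * s^-1 +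
  - ((r * (r - 1) + r * (r - l) + (r - 1) * (r - l)) / (s *+ 2)) / s ^+ 2 = 0.
  move=> r0 r1 rl s0 n2 sE; rewrite subr0 mul0r addr0 -[s *+ 2]mulr_natl sE.
  by field; split_neq0.
exact: (id L x y (e lam) _ xb0 xb1 (xb lam) y0 (nat2_neq0 lam) (y2E lam)).
Qed.

Lemma local_connD (X : curve F) (E : pbundle X) A Th p :
  local_conn E (A + Th) p - local_conn E A p = local_higgs E Th p.
Proof.
rewrite /local_conn /local_higgs -scalerBr; congr (_ *: _).
by rewrite mulmxDr mulmxDl opprD addrACA [X in _ + X]subrr addr0 addrC addKr.
Qed.

Lemma log_poleB p (B B' : 'M[L]_2) (a a' d d' : F) : log_pole (p : place C) B a d ->
  log_pole p B' a' d' -> log_pole p (B - B') (a - a') (d - d').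
Proof.
case=> r01 v10 v00 v11 [r01' v10' v00' v11'].
have id (K0 : comPzRingType) (f h h' c c' : K0) :
  f * (h - h') - (c - c') = (f * h - c) - (f * h' - c') by ring.
split; rewrite !mxE.
- rewrite mulrBr; rewrite !mxE in r01 r01'; exact: (regularB hC).
- rewrite mulrBr; rewrite !mxE in v10 v10'; exact: (vanishesB hC).
- rewrite (cstB hC) id; rewrite !mxE in v00 v00'; exact: (vanishesB hC).
by rewrite (cstB hC) id; rewrite !mxE in v11 v11'; exact: (vanishesB hC).
Qed.

Lemma sub_mxE (V : zmodType) m n (A B : 'M[V]_(m, n)) i j : (A - B) i j = A i j - B i j.
Proof. by rewrite !mxE. Qed.

Lemma Phi_connD (A Th : 'M[ratfun F]_2) :
  Phi_conn lam (A + Th) = Phi_conn lam A + Phi_higgs lam Th.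
Proof. by rewrite /Phi_conn /Phi_higgs map_mxD addrAC. Qed.

(** The difference of two parabolic connections on the same bundle is a parabolic Higgs field. *)
Lemma is_Higgs_theta u d1 d2 : is_Higgs_field (phi lam t u)
  (Phi_higgs lam (ratfun_cst d1 *: Theta1 t u + ratfun_cst d2 *: Theta2 lam u)).
Proof.
set Th := Phi_higgs _ _.
have E : Phi_conn lam (conn_of u d1 d2) = Phi_conn lam (conn_of u 0 0) + Th.
  rewrite -Phi_connD; congr Phi_conn.
  have id (V : lmodType (ratfun F)) (f g h : V) c d :
      f + c *: g + d *: h = f + 0 *: g + 0 *: h + (c *: g + d *: h).
    by rewrite !scale0r !addr0 addrA.
  by rewrite /conn_of (ratfun_cst0 F); exact: id.
split.
- have y0 : y^-1 != 0 := invr_neq0 (@y_neq0 F lam).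
  have := conn_of_trace u d1 d2; rewrite -[RHS](conn_of_trace u 0 0) E mxtraceD.
  by move=> /addIr /(mulIf y0) /(canRL (addKr _)); rewrite addNr.
- move=> p ppt; rewrite -(local_connD _ (Phi_conn lam (conn_of u 0 0))) -E => i j.
  rewrite sub_mxE; apply: (regularB hC); exact: conn_of_regular.
move=> p ppt; rewrite -(local_connD _ (Phi_conn lam (conn_of u 0 0))) -E.
have := log_poleB (conn_of_log_pole d1 d2 ppt) (conn_of_log_pole 0 0 ppt).
rewrite (subrr nu) (subrr (- nu)); exact.
Qed.

(** The fibre is the orbit of one point under the involution. *)
Lemma fibre_finite (a : F) : finite_set [set p : place C | EC_proj p = Some a].
Proof.
have [q qa] := point_over lam a.
apply: (@sub_finite_set _ _ [set q^p; (conj_point q)^p]); last first.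
  by rewrite finite_setU; split; exact: finite_set1.
move=> [q'|//] [q'a] /=; rewrite -qa in q'a.
by have [->|->] := fibre_points q'a; [left|right].
Qed.

Lemma phi_is_pbundle u : is_pbundle (phi lam t u).
Proof.
split.
- by move=> p; rewrite -unitmx2; exact: phi_frame_unit.
- apply: (@sub_finite_set _ _ ([set oo] `|` [set p : place C | EC_proj p = Some 0]
     `|` [set p : place C | EC_proj p = Some 1] `|` [set p : place C | EC_proj p = Some lam]
     `|` [set p : place C | EC_proj p = Some t])); last first.
    by rewrite !finite_setU; do !split; try exact: fibre_finite; exact: finite_set1.
  elim/place_cases => [_|q b0 _|q b0 at_ _|q b0 at_ nGL].
  + by do 4!left.
  + case: (ramified_cases b0) => aE; [do 3!left; right|do 2!left; right|left; right] => /=.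
    * by rewrite aE.
    * by rewrite aE.
    by rewrite aE.
  + by right; rewrite /= at_.
  exfalso; have : ~ GL2_at q^p (frame (phi lam t u) q^p) by exact: nGL.
  apply.
  rewrite phi_frame_other //; split.
    move=> i j; rewrite mxE; case: (i == j); [exact: (regular1 hC)|exact: (regular0 hC)].
  by rewrite det1; exact: (unit_of_value hC (value1 hC _) (oner_neq0 _)).
apply: (sub_finite_set _ (fibre_finite t)) => p /=.
by rewrite -[D_pts _ _ _ && _]/(ppts (phi lam t u) p) phi_ppts => /eqP.
Qed.

Lemma is_Con_conn_of (mu : F) u d1 d2 : pb_stable mu (phi lam t u) ->
  is_Con mu nu (phi lam t u) (Phi_conn lam (conn_of u d1 d2)).
Proof.
move=> st; split.
- exact: phi_is_pbundle.
- exists y^-1; split; [exact: (invr_neq0 (@y_neq0 F lam))|exact: phi_det_unit|].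
  exact: conn_of_trace.
- by move=> p ppt; exact: conn_of_regular.
- by move=> p ppt; exact: conn_of_log_pole.
by move=> v r v0 _ /(st v r v0) /ltW.
Qed.

(** * Gradients of the coordinates *)

Ltac grad_base := match goal with
  | |- has_grad (fun u => @?f u + @?g u) _ _ _ => apply: (@has_gradD _ f g)
  | |- has_grad (fun u => - @?f u) _ _ _ => apply: (@has_gradN _ f)
  | |- has_grad (fun u => @?f u * @?g u) _ _ _ => apply: (@has_gradM _ f g)
  | |- has_grad (fun u => (@?f u)^-1) _ _ _ => apply: (@has_gradV _ f)
  | |- has_grad (fun u => u.1) _ _ _ => exact: has_grad_fst
  | |- has_grad (fun u => u.2) _ _ _ => exact: has_grad_snd
  | |- has_grad (fun u => ?c) _ _ _ => exact: (has_grad_cst c)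
  end.

Lemma grad_N1 u : has_grad (N1 lam t) u (1 - t) (- (1 - lam)).
Proof.
rewrite /N1; apply: has_grad_eq; first by repeat grad_base.
- by rewrite /=; ring.
by rewrite /=; ring.
Qed.

Lemma grad_N2 u : has_grad (N2 lam t) u (dN2p lam t u) (dN2q lam t u).
Proof.
rewrite /N2; apply: has_grad_eq; first by repeat grad_base.
- by rewrite /dN2p /=; ring.
by rewrite /dN2q /=; ring.
Qed.

Definition d2N2 : F := lam * (1 - t) - t * (1 - lam).

Lemma grad_dN2p u : has_grad (dN2p lam t) u 0 d2N2.
Proof.
rewrite /dN2p; apply: has_grad_eq; first by repeat grad_base.
- by rewrite /=; ring.
by rewrite /d2N2 /=; ring.
Qed.

Lemma grad_dN2q u : has_grad (dN2q lam t) u d2N2 0.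
Proof.
rewrite /dN2q; apply: has_grad_eq; first by repeat grad_base.
- by rewrite /d2N2 /=; ring.
by rewrite /=; ring.
Qed.

Ltac grad_step := match goal with
  | |- has_grad (fun u => N1 lam t u) _ _ _ => exact: grad_N1
  | |- has_grad (fun u => N2 lam t u) _ _ _ => exact: grad_N2
  | |- has_grad (fun u => dN2p lam t u) _ _ _ => exact: grad_dN2p
  | |- has_grad (fun u => dN2q lam t u) _ _ _ => exact: grad_dN2q
  | |- _ => grad_base
  end.

Definition z_p u : F := lam * (1 - lam) * ((lam - u.1)^-1 * (lam - u.1)^-1).
Definition w_p u : F :=
  lam * u.2 * ((1 - t) * N2 lam t u - N1 lam t u * dN2p lam t u) * ((N2 lam t u)^-1 * (N2 lam t u)^-1).
Definition w_q u : F :=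
  lam * ((N1 lam t u - u.2 * (1 - lam)) * N2 lam t u - u.2 * N1 lam t u * dN2q lam t u) *
  ((N2 lam t u)^-1 * (N2 lam t u)^-1).

Lemma grad_z u : u.1 != lam -> has_grad z_u u (z_p u) 0.
Proof.
rewrite eq_sym -subr_eq0 => pl; rewrite /z_u; apply: has_grad_eq.
  by repeat grad_step; exact: pl.
- by rewrite /z_p /=; field.
by rewrite /=; field.
Qed.

Lemma grad_zp u : u.1 != lam -> exists a, has_grad z_p u a 0.
Proof.
rewrite eq_sym -subr_eq0 => pl; rewrite /z_p; eexists; apply: has_grad_eq.
- by repeat grad_step; exact: pl.
- by [].
by rewrite /=; field.
Qed.

Lemma grad_w u : N2 lam t u != 0 -> has_grad w_u u (w_p u) (w_q u).
Proof.
move=> n0; rewrite /w_u; apply: has_grad_eq; first by repeat grad_step; exact: n0.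
- by rewrite /w_p /=; field.
by rewrite /w_q /=; field.
Qed.

(** The middle value b is shared: the second derivatives of w commute. *)
Lemma grad_wp_wq u : N2 lam t u != 0 -> exists a b c,
  has_grad w_p u a b /\ has_grad w_q u b c.
Proof.
move=> n0; rewrite /w_p /w_q; do 3!eexists; split.
  by repeat grad_step; exact: n0.
apply: has_grad_eq; first by repeat grad_step; exact: n0.
- by rewrite /d2N2 /=; field.
by [].
Qed.

(** The value a is shared: the form psi_c1 du_t + psi_c2 du_lam is closed. *)
Lemma grad_psi_c u : u.1 != 0 -> u.1 != 1 -> u.1 != lam -> N2 lam t u != 0 -> exists a b c,
  has_grad (psi_c1 lam t nu) u a b /\ has_grad (psi_c2 lam t nu) u c a.
Proof.
rewrite -(subr_eq0 _ 1) -(subr_eq0 _ lam) => p0 p1 pl n0; rewrite /psi_c1 /psi_c2.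
do 3!eexists; split.
  by repeat grad_step; exact: n0.
apply: has_grad_eq; first by repeat grad_step; first [exact: n0|exact: p0|exact: p1|exact: pl].
- by [].
by rewrite /d2N2 /=; field; split_neq0.
Qed.

Ltac polynomial_step := match goal with
  | |- polynomial (fun u => @?f u + @?g u) => apply: (@polynomialD _ f g)
  | |- polynomial (fun u => - @?f u) => apply: (@polynomialN _ f)
  | |- polynomial (fun u => @?f u * @?g u) => apply: (@polynomialM _ f g)
  | |- polynomial (fun u => u.1) => exact: polynomial_fst
  | |- polynomial (fun u => u.2) => exact: polynomial_snd
  | |- polynomial (fun u => ?c) => exact: (polynomial_cst c)
  end.

Lemma generically_neq (f g : F * F -> F) u0 : polynomial (fun u => f u - g u) ->
  f u0 - g u0 != 0 -> generically (fun u => f u != g u).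
Proof.
move=> hp h0; apply: generically_imply (generically_neq0 hp h0) => u.
by rewrite subr_eq0.
Qed.

(** Each condition is a polynomial in u that is nonzero at (0, 0), (1, 0) or (0, 1). *)
Lemma bundle_generically : generically (fun u => bundle_generic u /\ w_q u != 0).
Proof.
have t1' : 1 - t != 0 by rewrite subr_eq0 eq_sym.
have l1' : 1 - lam != 0 by rewrite subr_eq0 eq_sym.
have tl' : t - lam != 0 by rewrite subr_eq0.
have g1 : generically (fun u : F * F => u.1 != 0).
  by apply: (@generically_neq0 _ _ (1, 0)); [exact: polynomial_fst|exact: oner_neq0].
have g2 : generically (fun u : F * F => u.1 != 1).
  apply: (@generically_neq _ _ (0, 0)); first by repeat polynomial_step.
  by rewrite /= sub0r oppr_eq0 oner_eq0.
have g3 : generically (fun u : F * F => u.1 != lam).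
  apply: (@generically_neq _ _ (0, 0)); first by repeat polynomial_step.
  by rewrite /= sub0r oppr_eq0.
have g4 : generically (fun u : F * F => u.2 != 0).
  by apply: (@generically_neq0 _ _ (0, 1)); [exact: polynomial_snd|exact: oner_neq0].
have g5 : generically (fun u : F * F => N1 lam t u != 0).
  apply: (@generically_neq0 _ _ (0, 1)); first by rewrite /N1; repeat polynomial_step.
  by rewrite /N1 /= subrr mul0r subr0 mul1r sub0r oppr_eq0.
have N2E : N2 lam t (1, 0) = t * (1 - lam) by rewrite /N2 /=; ring.
have N2E' : N2 lam t (0, 1) = - (lam * (1 - t)) by rewrite /N2 /=; ring.
have N1E' : N1 lam t (0, 1) = - (1 - t) by rewrite /N1 /=; ring.
have N1E : N1 lam t (1, 0) = 1 - lam by rewrite /N1 /=; ring.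
have g6 : generically (fun u : F * F => N2 lam t u != 0).
  apply: (@generically_neq0 _ _ (1, 0)); first by rewrite /N2; repeat polynomial_step.
  by rewrite N2E mulf_neq0.
have g7 : generically (fun u : F * F => lam * (1 - u.1) != t * (lam - u.1)).
  apply: (@generically_neq _ _ (1, 0)); first by repeat polynomial_step.
  rewrite /= (_ : _ - _ = t * (1 - lam)); last by ring.
  by rewrite mulf_neq0.
have g8 : generically (fun u : F * F => lam * u.2 != u.1 * t).
  apply: (@generically_neq _ _ (0, 1)); first by repeat polynomial_step.
  by rewrite /= mul0r subr0 mulr1.
have g9 : generically (fun u : F * F => t * (1 - u.2) * (1 - lam) != (1 - t) * (t - lam * u.2)).
  apply: (@generically_neq _ _ (0, 1)); first by repeat polynomial_step.
  by rewrite /= subrr mulr0 mul0r sub0r oppr_eq0 mulr1 mulf_neq0.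
have gw1 : generically (fun u : F * F => lam * u.2 * N1 lam t u != t * N2 lam t u).
  apply: (@generically_neq _ _ (0, 1)); first by rewrite /N1 /N2; repeat polynomial_step.
  rewrite /= N1E' N2E' (_ : _ - _ = - (lam * ((1 - t) * (1 - t)))); last by ring.
  by rewrite oppr_eq0 !mulf_neq0.
have gw2 : generically (fun u : F * F => lam * u.2 * N1 lam t u != N2 lam t u).
  apply: (@generically_neq _ _ (1, 0)); first by rewrite /N1 /N2; repeat polynomial_step.
  by rewrite /= N2E mulr0 mul0r sub0r oppr_eq0 mulf_neq0.
have gw3 : generically (fun u : F * F => u.2 * N1 lam t u != N2 lam t u).
  apply: (@generically_neq _ _ (1, 0)); first by rewrite /N1 /N2; repeat polynomial_step.
  by rewrite /= N2E mul0r sub0r oppr_eq0 mulf_neq0.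
have gw4 : generically (fun u : F * F =>
    w_section_const u * N2 lam t u + w_section_slope u * (lam * u.2 * N1 lam t u) != 0).
  apply: (@generically_neq0 _ _ (1, 0)).
    by rewrite /w_section_const /w_section_slope /N1 /N2; repeat polynomial_step.
  by rewrite /w_section_const N1E N2E /= mulr0 mul0r mulr0 addr0 !mulf_neq0.
have gj : generically (fun u : F * F =>
    (N1 lam t u - u.2 * (1 - lam)) * N2 lam t u - u.2 * N1 lam t u * dN2q lam t u != 0).
  apply: (@generically_neq0 _ _ (1, 0)).
    by rewrite /N1 /N2 /dN2q; repeat polynomial_step.
  by rewrite N1E N2E /= !mul0r !subr0 !mulf_neq0.
have := generically_and (generically_and (generically_and (generically_and g1 g2)
  (generically_and g3 g4)) (generically_and (generically_and g5 g6) (generically_and g7 g8)))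
  (generically_and (generically_and g9 gw1) (generically_and (generically_and gw2 gw3)
  (generically_and gw4 gj))).
apply: generically_imply => u.
move=> [[[[h1 h2] [h3 h4]] [[h5 h6] [h7 h8]]] [[h9 k1] [[k2 k3] [k4 hj]]]].
split; last by rewrite /w_q !mulf_neq0 // invr_eq0.
by split; split.
Qed.

(** * The Kodaira-Spencer class *)

Lemma is_fderive_affine (g : L) (a b : F) : is_fderive (X := C) (fun s => e (a + s * b) * g) 0 (e b * g).
Proof.
exists 1%N, (fun=> g), (fun _ s => a + s * b), (fun=> b); split.
- by move=> _; exact: is_derive1_affine.
- by exists 1; [exact: ltr01|move=> s _; rewrite big_ord1].
by rewrite big_ord1.
Qed.

Lemma is_fderive_poles (r0 r1 rl rt : F -> F) (d0 d1 dl dt : F) (f : F -> L) :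
  (\forall s \near (0 : F), f s = poles (r0 s) (r1 s) (rl s) (rt s)) ->
  is_derive (0 : F) (1 : F) r0 d0 -> is_derive (0 : F) (1 : F) r1 d1 ->
  is_derive (0 : F) (1 : F) rl dl -> is_derive (0 : F) (1 : F) rt dt ->
  is_fderive (X := C) f 0 (poles d0 d1 dl dt).
Proof.
move=> fE h0 h1 hl ht.
exists 4%N, (tnth [tuple (x - e 0)^-1; (x - e 1)^-1; (x - e lam)^-1; (x - e t)^-1]),
  (tnth [tuple r0; r1; rl; rt]), (tnth [tuple d0; d1; dl; dt]); split.
- by move=> [[|[|[|[|]]]] //= i4]; rewrite !(tnth_nth 0) /=.
- apply: filterS fE => s ->; rewrite !big_ord_recl big_ord0 addr0 /=.
  by rewrite /poles !addrA.
by rewrite !big_ord_recl big_ord0 addr0 /= /poles !addrA.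
Qed.

Lemma is_fderive_cst (f : F -> L) (g : L) : f =1 (fun=> g) -> is_fderive (X := C) f 0 0.
Proof.
move=> /funext ->; have := is_fderive_affine g 1 0.
rewrite EC_cst0 mul0r; congr is_fderive.
by apply/funext => s; rewrite mulr0 addr0 EC_cst1 mul1r.
Qed.

(** The deformation of phi u along v moves only the lines over lam and t. In the frame of
    P1_bundle, with first column (zeta, 1), the derivative of zeta is the action of E_12. *)
Definition lines_variation v (p : place C) : 'M[L]_2 :=
  mx2 0 (e (if EC_proj p == Some lam then v.1 else if EC_proj p == Some t then v.2 else 0)) 0 0.

Lemma zeta_line u v s a : zeta lam (line u v s) a =
  zeta lam u a + s * (if a == lam then v.1 else if [|| a == 0 | a == 1] then 0 else v.2).
Proof.
rewrite /zeta; case: eqVneq => [->|a0]; first by rewrite eq_sym (negbTE lam0) /= add0r mulr0.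
case: eqVneq => [->|a1]; first by rewrite eq_sym (negbTE lam1) /= mulr0 addr0.
by case: eqVneq.
Qed.

Lemma mx2_0 (V : nmodType) : mx2 (0 : V) 0 0 0 = 0.
Proof. by apply: mx2P; rewrite !mxE. Qed.

Lemma lines_variation_oo v : lines_variation v oo = 0.
Proof. by rewrite -[LHS]/(mx2 0 (e 0) 0 0) EC_cst0 mx2_0. Qed.

Definition line_speed v (a : F) : F := if a == lam then v.1 else if a == t then v.2 else 0.

Lemma lines_variationE v q : lines_variation v q^p = mx2 0 (e (line_speed v (val q).1)) 0 0.
Proof. by []. Qed.

Lemma mul_nilpotent (K0 : pzRingType) (r a b c d : K0) :
  mx2 0 r 0 0 *m mx2 a b c d = mx2 (r * c) (r * d) 0 0.
Proof. by rewrite mul_mx2 !(mul0r, add0r). Qed.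

Lemma line_speed_W v q : (val q).2 = 0 ->
  line_speed v (val q).1 = if (val q).1 == lam then v.1 else 0.
Proof. by rewrite /line_speed => /ramified_neq_t/negbTE ->. Qed.

Lemma line_speed_other v q : (val q).2 != 0 -> (val q).1 != t -> line_speed v (val q).1 = 0.
Proof.
rewrite -ramified_W W_pts_some !negb_or => /and3P[_ _ al] at_.
by rewrite /line_speed (negbTE al) (negbTE at_).
Qed.

Lemma line_speed_t v : line_speed v t = v.2.
Proof. by rewrite /line_speed (negbTE tlam) eqxx. Qed.

Lemma frame_variation_W u v q : (val q).2 = 0 -> lines_variation v q^p *m frame (phi lam t u) q^p
  = mx2 0 (e (line_speed v (val q).1) * y^-1) 0 0.
Proof. by move=> b0; rewrite (phi_frame_W u b0) lines_variationE mul_nilpotent mulr0. Qed.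

Lemma frame_variation_t u v q : (val q).1 = t -> lines_variation v q^p *m frame (phi lam t u) q^p
  = mx2 (e v.2 * 1) 0 0 0.
Proof.
by move=> at_; rewrite (phi_frame_t u at_) lines_variationE at_ line_speed_t mul_nilpotent mulr0.
Qed.

Lemma frame_variation_oo u v : lines_variation v oo *m frame (phi lam t u) oo = 0.
Proof. by rewrite lines_variation_oo mul0mx. Qed.

Lemma frame_variation_other u v q : (val q).2 != 0 -> (val q).1 != t ->
  lines_variation v q^p *m frame (phi lam t u) q^p = 0.
Proof.
by move=> b0 at_; rewrite lines_variationE line_speed_other // EC_cst0 mx2_0 mul0mx.
Qed.

Lemma zeta_line_W u v q s : (val q).2 = 0 ->
  zeta lam (line u v s) (val q).1 = zeta lam u (val q).1 + s * line_speed v (val q).1.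
Proof.
move=> b0; rewrite zeta_line (line_speed_W v b0); case: (ramified_cases b0) => ->.
- by rewrite eqxx.
- by rewrite eqxx orbT.
by rewrite eqxx.
Qed.

Lemma ord2_forall (A : 'I_2 -> 'I_2 -> Prop) :
  A 0 0 -> A 0 1 -> A 1 0 -> A 1 1 -> forall i j, A i j.
Proof. by move=> h00 h01 h10 h11 i j; case: (ord2E i) => ->; case: (ord2E j) => ->. Qed.

Lemma lines_variation_ks u v :
  is_kodaira_spencer (fun s => phi lam t (line u v s)) 0 (lines_variation v).
Proof.
move=> p; rewrite line0; elim/place_cases: p => [|q b0|q b0 at_|q b0 at_].
- move=> i j; rewrite frame_variation_oo [X in is_fderive _ _ X]mxE.
  by apply: (is_fderive_cst (g := mx2 0 (x / y) ((x / y) ^+ 2) 0 i j)) => s; rewrite phi_frame_oo.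
- rewrite (frame_variation_W u v b0); set d := line_speed _ _.
  have fr s : frame (phi lam t (line u v s)) q^p =
      mx2 1 (e (zeta lam u (val q).1 + s * d) * y^-1) 0 y^-1.
    by rewrite (phi_frame_W _ b0) zeta_line_W.
  apply: ord2_forall; rewrite mx2E.
  + by apply: (is_fderive_cst (g := 1)) => s; rewrite fr mx2E.
  + have -> : (fun s => frame (phi lam t (line u v s)) q^p 0 1) =
        (fun s => e (zeta lam u (val q).1 + s * d) * y^-1).
      by apply/funext => s; rewrite fr mx2E.
    exact: is_fderive_affine.
  + by apply: (is_fderive_cst (g := 0)) => s; rewrite fr mx2E.
  by apply: (is_fderive_cst (g := y^-1)) => s; rewrite fr mx2E.
- rewrite (frame_variation_t u v at_); apply: ord2_forall; rewrite mx2E.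
  + have -> : (fun s => frame (phi lam t (line u v s)) q^p 0 0) = (fun s => e (u.2 + s * v.2) * 1).
      by apply/funext => s; rewrite (phi_frame_t _ at_) mx2E mulr1.
    exact: is_fderive_affine.
  + by apply: (is_fderive_cst (g := 1)) => s; rewrite (phi_frame_t _ at_) mx2E.
  + by apply: (is_fderive_cst (g := 1)) => s; rewrite (phi_frame_t _ at_) mx2E.
  by apply: (is_fderive_cst (g := 0)) => s; rewrite (phi_frame_t _ at_) mx2E.
move=> i j; rewrite (frame_variation_other u v b0 at_) [X in is_fderive _ _ X]mxE.
by apply: (is_fderive_cst (g := (1%:M : 'M[L]_2) i j)) => s; rewrite phi_frame_other.
Qed.

(** * Residues and Serre duality *)

Lemma EC_deriv_xB (c : F) : EC_deriv (x - e c) = 1.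
Proof. by rewrite EC_derivD EC_deriv_x EC_derivN EC_deriv_cst oppr0 addr0. Qed.

Lemma ddx_unif_ramified q : (val q).2 = 0 -> ddx (unif q^p) = EC_dP lam / (2%:R * y).
Proof.
by move=> b0; rewrite (unif_ramified b0) -[LHS]/(EC_deriv y) EC_deriv_y mulr_natl.
Qed.

Lemma ddx_unif_unramified q : (val q).2 != 0 -> ddx (unif q^p) = 1.
Proof. by move=> b0; rewrite (unif_unramified b0); exact: EC_deriv_xB. Qed.

Lemma ddx_unif_neq0 (p : place C) : ddx (unif p) != 0.
Proof.
elim/place_cases: p => [|q b0|q b0 _|q b0 _].
- by case: ddx_unif_oo.
- rewrite (ddx_unif_ramified b0).
  exact: (mulf_neq0 dP_neq0 (invr_neq0 (mulf_neq0 (nat2_neq0 lam) (@y_neq0 F lam)))).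
- by rewrite (ddx_unif_unramified b0) oner_eq0.
by rewrite (ddx_unif_unramified b0) oner_eq0.
Qed.

(** The factor 2 comes from dx = 2 y dy / P'(x). *)
Lemma residue_ramified q r0 r1 rl rt (c : F) : (val q).2 = 0 ->
  residue q^p (poles r0 r1 rl rt * e c) = 2%:R * residue_at r0 r1 rl rt (val q).1 * c.
Proof.
move=> b0; apply: (residue_simple_pole hC (ddx_unif_neq0 _)).
have [vs P'0] := ramified_quotient b0.
have v2 : (2%:R : L) ~[q^p] 2%:R by rewrite -EC_cst_nat; exact: (value_cst hC).
have vr := valueM hC (poles_value q r0 r1 rl rt) (value_cst hC q^p c).
have vv := valueM hC (valueM hC (valueM hC v2 vs) (valueV hC (value_dP q) P'0)) vr.
have y0 : y != 0 := @y_neq0 F lam.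
have n2 : (2%:R : L) != 0 := nat2_neq0 lam.
have xa0 : x - e (val q).1 != 0 by rewrite subr_eq0 x_neq_cst.
have D0 := dP_neq0.
rewrite (ddx_unif_ramified b0) (unif_ramified b0).
have -> : y * (poles r0 r1 rl rt * e c) / (EC_dP lam / (2%:R * y)) =
  2%:R * (y ^+ 2 / (x - e (val q).1)) / EC_dP lam * ((x - e (val q).1) * poles r0 r1 rl rt * e c).
  have id (K0 : fieldType) (r f g D s n : K0) : D != 0 -> n * r != 0 -> s != 0 ->
     r * (f * g) / (D / (n * r)) = n * (r ^+ 2 / s) / D * (s * f * g).
    move=> D00; rewrite mulf_eq0 negb_or => /andP[n0 r00] s0; field; split_neq0.
  exact: (id L y _ (e c) _ _ 2%:R D0 (mulf_neq0 n2 y0) xa0).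
apply: value_eq; first exact: vv.
by field.
Qed.

Lemma residue_unramified q r0 r1 rl rt (c : F) : (val q).2 != 0 ->
  residue q^p (poles r0 r1 rl rt * e c) = residue_at r0 r1 rl rt (val q).1 * c.
Proof.
move=> b0; apply: (residue_simple_pole hC (ddx_unif_neq0 _)).
rewrite (ddx_unif_unramified b0) (unif_unramified b0) divr1 mulrA.
exact: (valueM hC (poles_value q r0 r1 rl rt) (value_cst hC q^p c)).
Qed.

Lemma tr_mul_nilpotent (K0 : pzRingType) (a b c d r : K0) :
  \tr (mx2 a b c d *m mx2 0 r 0 0) = c * r.
Proof. by rewrite mul_mx2 tr_mx2 !mx2E !mulr0 !add0r addr0. Qed.

(** The three places that contribute are w_lam, with residue 2 rl v.1, and the two points over t,
    each with residue rt v.2. *)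
Lemma serre_poles (a b d : L) r0 r1 rl rt v :
  serre_pairing (fun=> mx2 a b (poles r0 r1 rl rt) d : 'M[ffield C]_2) (lines_variation v)
  = - (2%:R * (rl * v.1 + rt * v.2)).
Proof.
have [ql qlE] := point_over lam lam; have [qt qtE] := point_over lam t.
have bl : (val ql).2 = 0.
  by apply/eqP; rewrite -ramified_W qlE W_pts_some eqxx !orbT.
have bt : (val qt).2 != 0 by rewrite -ramified_W qtE W_pts_t.
have ct : (val (conj_point qt)).1 = t by rewrite -qtE.
have bt' : (val (conj_point qt)).2 != 0 by rewrite /= oppr_eq0.
rewrite /serre_pairing; congr (- _).
have trE p : \tr (mx2 a b (poles r0 r1 rl rt) d *m lines_variation v p) =
  poles r0 r1 rl rt * lines_variation v p 0 1.
  rewrite /lines_variation mx2E; exact: tr_mul_nilpotent.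
under eq_fsbigr do rewrite trE.
have tl : qt != ql by apply: contraNneq tlam => h; rewrite -qtE h qlE.
have tl' : conj_point qt != ql by apply: contraNneq tlam => h; rewrite -ct h qlE.
have tt : qt != conj_point qt.
  apply: contraNneq bt => /(congr1 (fun q => (val q).2)) /= /eqP.
  by rewrite -addr_eq0 -mulr2n mulrn_eq0.
rewrite (fsbigE [:: ql^p; qt^p; (conj_point qt)^p]) //; last 2 first.
- have uniq3 (T : eqType) (i j k : T) : j != i -> k != i -> j != k -> uniq [:: i; j; k].
    by move=> ji ki jk; rewrite /= !inE negb_or eq_sym ji eq_sym ki jk.
  exact: (uniq3 _ _ _ _ (neq_point tl) (neq_point tl') (neq_point tt)).
- move=> p _; rewrite !inE !negb_or => /and3P[nl nt nt'].
  suff -> : lines_variation v p 0 1 = 0.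
    by rewrite mulr0; exact: (residue0 hC (ddx_unif_neq0 _)).
  case: p nl nt nt' => [q|] nl nt nt'; last by rewrite lines_variation_oo mxE.
  rewrite lines_variationE mx2E /line_speed.
  case: eqVneq => [ql'|_].
    case: (fibre_points (etrans ql' (esym qlE))) => qE.
      by rewrite qE eqxx in nl.
    have : q = ql.
      by rewrite qE; apply: val_inj; rewrite [RHS]surjective_pairing bl /= bl oppr0.
    by move=> h; rewrite h eqxx in nl.
  case: eqVneq => [qt'|_]; last by rewrite EC_cst0.
  case: (fibre_points (etrans qt' (esym qtE))) => qE.
    by rewrite qE eqxx in nt.
  by rewrite qE eqxx in nt'.
have hl : residue ql^p (poles r0 r1 rl rt * lines_variation v ql^p 0 1) = 2%:R * rl * v.1.
  rewrite lines_variationE mx2E (residue_ramified _ _ _ _ _ bl) qlE residue_at_lam.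
  by rewrite /line_speed eqxx.
have ht q : (val q).1 = t -> (val q).2 != 0 ->
    residue q^p (poles r0 r1 rl rt * lines_variation v q^p 0 1) = rt * v.2.
  move=> qE b0; rewrite lines_variationE mx2E (residue_unramified _ _ _ _ _ b0) qE.
  by rewrite residue_at_t line_speed_t.
rewrite !big_cons big_nil !in_setT hl (ht _ qtE bt) (ht _ ct bt').
by rewrite /=; ring.
Qed.

(** * Higgs fields, tangent vectors and the symplectic form *)

Lemma pull_theta u d1 d2 : exists a b d,
  Phi_higgs lam (ratfun_cst d1 *: Theta1 t u + ratfun_cst d2 *: Theta2 lam u) =
  mx2 a b (poles (d1 * (1 - u.2) + d2 * (1 - u.1)) (d1 * u.2 + d2 * u.1) (- d2) (- d1)) d.
Proof.
set Th := _ + _.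
have E : Phi_higgs lam Th = Phi_conn lam (conn_of u d1 d2) - Phi_conn lam (conn_of u 0 0).
  have -> : conn_of u d1 d2 = conn_of u 0 0 + Th.
    have id (V : lmodType (ratfun F)) (f g h : V) c d :
        f + c *: g + d *: h = f + 0 *: g + 0 *: h + (c *: g + d *: h).
      by rewrite !scale0r !addr0 addrA.
    by rewrite /conn_of (ratfun_cst0 F); exact: id.
  have id (V : zmodType) (f g : V) : g = f + g - f by rewrite addrC addKr.
  by rewrite Phi_connD; exact: id.
rewrite E !pull_conn_of.
have id (V : zmodType) (a b c d a' b' c' d' : V) :
    mx2 a b c d - mx2 a' b' c' d' = mx2 (a - a') (b - b') (c - c') (d - d').
  by apply: mx2P; rewrite !mxE.
rewrite id; do 3!eexists; congr (mx2 _ _ _ _).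
by rewrite polesB; congr poles; ring.
Qed.

Lemma Theta_ofE (f : F * F -> F) u a b : has_grad f u a b -> Theta_of lam t f u =
  ratfun_cst (2%:R^-1 * b) *: Theta1 t u + ratfun_cst (2%:R^-1 * a) *: Theta2 lam u.
Proof.
move=> hf; have fb : diff_dir f u (0, 1) = b by rewrite (diff_dirE _ hf) /= mul0r mul1r add0r.
have fa : diff_dir f u (1, 0) = a by rewrite (diff_dirE _ hf) /= mul0r mul1r addr0.
rewrite /Theta_of fa fb.
have id (K0 : pzRingType) (V : lmodType K0) (A B : V) (h c d : K0) :
  h *: (c *: A + d *: B) = (h * c) *: A + (h * d) *: B by rewrite scalerDr !scalerA.
by rewrite id -!ratfun_cstM.
Qed.

Lemma corresponds_grad (f : F * F -> F) u a b : has_grad f u a b ->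
  corresponds lam t f u (Phi_higgs lam (Theta_of lam t f u)).
Proof.
move=> hf; rewrite (Theta_ofE hf); split; first exact: is_Higgs_theta.
move=> v; exists (lines_variation v); first exact: lines_variation_ks.
have [r [s [d ->]]] := pull_theta u (2%:R^-1 * b) (2%:R^-1 * a).
rewrite serre_poles; apply: (is_derive1_eq (hf v)).
have n2 : 2%:R != 0 :> F by rewrite pnatr_eq0.
by field.
Qed.

Lemma grad_z_coord u : bundle_generic u -> (forall v, \forall s \near (0 : F), bundle_generic (line u v s)) ->
  has_grad (z lam t) u (z_p u) 0.
Proof.
move=> gu gn; apply: (@has_grad_near _ z_u).
  by move=> v; apply: filterS (gn v) => s gs; rewrite zE.
by apply: grad_z; case: gu => -[].
Qed.

Lemma grad_w_coord u : bundle_generic u -> (forall v, \forall s \near (0 : F), bundle_generic (line u v s)) ->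
  has_grad (w lam t) u (w_p u) (w_q u).
Proof.
move=> gu gn; apply: (@has_grad_near _ w_u).
  by move=> v; apply: filterS (gn v) => s gs; rewrite wE.
by apply: grad_w; case: gu => _ [].
Qed.

Lemma Phi_conn_affine (A B D : 'M[ratfun F]_2) (c d : F) :
  Phi_conn lam A + cst C c *: Phi_higgs lam B + cst C d *: Phi_higgs lam D =
  Phi_conn lam (A + ratfun_cst c *: B + ratfun_cst d *: D).
Proof.
have phiZ b Th : cst C b *: Phi_higgs lam Th = Phi_higgs lam (ratfun_cst b *: Th).
  by apply/matrixP => i j; rewrite !mxE pullM.
by rewrite !phiZ -!Phi_connD.
Qed.

(** The connection is half the sum of nabla_0 and Psi nabla_0 (psi u); h is one half. *)
Lemma average_combination (K0 : pzRingType) (V : lmodType K0) (A B D : V)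
    (h k1 k2 c1 c2 za zb wa wb : K0) : h + h = 1 ->
  (forall k, k * h = h * k) ->
  h *: (A + (A + c1 *: B + c2 *: D)) + k1 *: ((h * zb) *: B + (h * za) *: D) +
    k2 *: ((h * wb) *: B + (h * wa) *: D) =
  A + (h * (c1 + k1 * zb + k2 * wb)) *: B + (h * (c2 + k1 * za + k2 * wa)) *: D.
Proof.
move=> hh hC; have -> : A + (A + c1 *: B + c2 *: D) = (A + A) + c1 *: B + c2 *: D by rewrite !addrA.
rewrite !mulrDr !scalerDl !scalerDr !scalerA -[h *: A + h *: A]scalerDl hh scale1r.
rewrite !mulrA !hC -!addrA; congr (A + (_ + _)).
rewrite addrCA; congr (_ + _).
by rewrite [in LHS](addrCA (_ *: D) (_ *: B)) [LHS]addrCA.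
Qed.

Lemma universal_connE u (k : F * F) za zb wa wb : psi_generic lam t u ->
  has_grad (z lam t) u za zb -> has_grad (w lam t) u wa wb ->
  universal_conn lam t nu u k = Phi_conn lam (conn_of u
    (2%:R^-1 * (psi_c1 lam t nu u + k.1 * zb + k.2 * wb))
    (2%:R^-1 * (psi_c2 lam t nu u + k.1 * za + k.2 * wa))).
Proof.
move=> gu hz hw; have Ez := Theta_ofE hz; have Ew := Theta_ofE hw.
rewrite /universal_conn /Theta_z Ez /Theta_w Ew.
apply: etrans; first exact: Phi_conn_affine.
apply: (f_equal (Phi_conn lam)).
rewrite /nabla0_psi (Psi_nabla0E lam0 lam1 t0 t1 tlam nu gu) /conn_of.
rewrite !(ratfun_cstM, ratfun_cstD); apply: average_combination; last by move=> f; exact: mulrC.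
rewrite -ratfun_cstD -(ratfun_cst1 F); congr ratfun_cst.
have n2 : 2%:R != 0 :> F by rewrite pnatr_eq0.
by field.
Qed.

Lemma is_fderive_near (f g : F -> L) (g' : L) : (\forall s \near (0 : F), f s = g s) ->
  is_fderive (X := C) g 0 g' -> is_fderive (X := C) f 0 g'.
Proof.
move=> fg [n [b [c [c' [hc gE g'E]]]]]; exists n, b, c, c'; split=> //.
by apply: filterS2 fg gE => s -> ->.
Qed.

Definition derivable_at0 (f : F -> F) := exists d, is_derive (0 : F) (1 : F) f d.

Lemma derivable_at0_cst c : derivable_at0 (fun=> c).
Proof. by exists 0; exact: is_derive1_cst. Qed.
Lemma derivable_at0D (f g : F -> F) : derivable_at0 f -> derivable_at0 g -> derivable_at0 (fun s => f s + g s).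
Proof. by move=> [a ha] [b hb]; exists (a + b); exact: is_derive1D. Qed.
Lemma derivable_at0N (f : F -> F) : derivable_at0 f -> derivable_at0 (fun s => - f s).
Proof. by move=> [a ha]; exists (- a); exact: is_derive1N. Qed.
Lemma derivable_at0M (f g : F -> F) : derivable_at0 f -> derivable_at0 g -> derivable_at0 (fun s => f s * g s).
Proof. by move=> [a ha] [b hb]; exists (f 0 * b + g 0 * a); exact: is_derive1M. Qed.

Ltac derivable_step := match goal with
  | h : derivable_at0 ?f |- derivable_at0 ?f => exact: h
  | |- derivable_at0 (fun s => @?f s + @?g s) => apply: (@derivable_at0D f g)
  | |- derivable_at0 (fun s => - @?f s) => apply: (@derivable_at0N f)
  | |- derivable_at0 (fun s => @?f s * @?g s) => apply: (@derivable_at0M f g)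
  | |- derivable_at0 (fun s => ?c) => exact: derivable_at0_cst
  end.

Lemma is_fderive_ex (r0 r1 rl rt : F -> F) : derivable_at0 r0 -> derivable_at0 r1 ->
  derivable_at0 rl -> derivable_at0 rt ->
  exists g, is_fderive (X := C) (fun s => poles (r0 s) (r1 s) (rl s) (rt s)) 0 g.
Proof.
move=> [a ha] [b hb] [c hc] [d hd]; exists (poles a b c d).
by apply: is_fderive_poles ha hb hc hd; exists 1; [exact: ltr01|].
Qed.

(** Only the residues of the lower left entry over lam and t are recorded, as they are all that
    the Serre pairing sees. *)
Lemma conn_of_variation u v (D1 D2 : F -> F) (E1 E2 : F) :
  is_derive (0 : F) (1 : F) D1 E1 -> is_derive (0 : F) (1 : F) D2 E2 ->
  exists a b r0 r1 d, forall i j,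
    is_fderive (X := C) (fun s => Phi_conn lam (conn_of (line u v s) (D1 s) (D2 s)) i j) 0
      (mx2 a b (poles r0 r1 (- E2) (- E1)) d i j).
Proof.
move=> h1 h2.
have hp : is_derive (0 : F) (1 : F) (fun s => (line u v s).1) v.1 := is_derive1_affine 0 u.1 v.1.
have hq : is_derive (0 : F) (1 : F) (fun s => (line u v s).2) v.2 := is_derive1_affine 0 u.2 v.2.
have g1 : derivable_at0 (fun s => D1 s) by exists E1.
have g2 : derivable_at0 (fun s => D2 s) by exists E2.
have gp : derivable_at0 (fun s => (line u v s).1) by exists v.1.
have gq : derivable_at0 (fun s => (line u v s).2) by exists v.2.
have E s : Phi_conn lam (conn_of (line u v s) (D1 s) (D2 s)) = _ := pull_conn_of _ _ _.
have [a ha] := @is_fderive_ex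
  (fun=> 0) (fun s => 2%:R^-1 + (nu + D1 s * (line u v s).2 + D2 s * (line u v s).1))
  (fun s => - (D2 s * (line u v s).1)) (fun s => - nu - D1 s * (line u v s).2)
  ltac:(repeat derivable_step) ltac:(repeat derivable_step) ltac:(repeat derivable_step)
  ltac:(repeat derivable_step).
have [b hb] := @is_fderive_ex
  (fun=> 0) (fun s => - (nu + D1 s * (line u v s).2 + D2 s * (line u v s).1))
  (fun s => 2%:R^-1 * (line u v s).1 + D2 s * ((line u v s).1 * (line u v s).1))
  (fun s => 2%:R * nu * (line u v s).2 + D1 s * ((line u v s).2 * (line u v s).2))
  ltac:(repeat derivable_step) ltac:(repeat derivable_step) ltac:(repeat derivable_step)
  ltac:(repeat derivable_step).
have [d hd] := @is_fderive_ex
  (fun=> 2%:R^-1) (fun s => - (nu + D1 s * (line u v s).2 + D2 s * (line u v s).1))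
  (fun s => 2%:R^-1 + D2 s * (line u v s).1) (fun s => nu + D1 s * (line u v s).2)
  ltac:(repeat derivable_step) ltac:(repeat derivable_step) ltac:(repeat derivable_step)
  ltac:(repeat derivable_step).
have [r0 hr0] : derivable_at0 (fun s => - 2%:R^-1 - nu + D1 s * (1 - (line u v s).2)
    + D2 s * (1 - (line u v s).1)) by repeat derivable_step.
have [r1 hr1] : derivable_at0 (fun s => 2%:R^-1 + (nu + D1 s * (line u v s).2
    + D2 s * (line u v s).1)) by repeat derivable_step.
exists a, b, r0, r1, d.
have nearE (f g : F -> L) : f =1 g -> \forall s \near (0 : F), f s = g s.
  by move=> fg; exists 1; [exact: ltr01|move=> s _; exact: fg].
apply: ord2_forall; rewrite mx2E.
- by apply: is_fderive_near ha; apply: nearE => s; rewrite E mx2E.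
- by apply: is_fderive_near hb; apply: nearE => s; rewrite E mx2E !expr2.
- apply: (is_fderive_poles _ hr0 hr1 (is_derive1N h2) (is_derive1N h1)).
  by apply: nearE => s; rewrite E mx2E.
by apply: is_fderive_near hd; apply: nearE => s; rewrite E mx2E.
Qed.

(** For multiples of E_12 all terms of nabla (eta) eta' are off-diagonal or contain E_12 E_12. *)
Lemma tr_nabla_nilpotent (A : 'M[L]_2) (r s : F) :
  \tr (nabla_End (X := C) A (mx2 0 (e r) 0 0) *m mx2 0 (e s) 0 0) = 0.
Proof.
rewrite /nabla_End map_ddx EC_deriv_cst EC_deriv0 mx2_0 add0r.
rewrite [A]mx2_eta; move: (A 0 0) (A 0 1) (A 1 0) (A 1 1) => a b c d.
have id (K0 : comPzRingType) (f g h l m n : K0) :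
    \tr ((mx2 f g h l *m mx2 0 m 0 0 - mx2 0 m 0 0 *m mx2 f g h l) *m mx2 0 n 0 0) = 0.
  by rewrite mulmxBl linearB /= !mul_mx2 !tr_mx2 !mx2E; ring.
exact: id.
Qed.

Lemma serre_nabla (A : 'M[L]_2) (v v' : F * F) :
  serre_pairing (fun p : place C => nabla_End (X := C) A (lines_variation v p)) (lines_variation v') = 0.
Proof.
rewrite /serre_pairing fsbig1 ?oppr0 // => p _.
by rewrite tr_nabla_nilpotent; exact: (residue0 hC (ddx_unif_neq0 _)).
Qed.

Lemma darboux_gradE (f g : F * F -> F) u (V V' : (F * F) * (F * F)) a b c d :
  has_grad f u a b -> has_grad g u c d ->
  (V.2.1 * diff_dir f u V'.1 - V'.2.1 * diff_dir f u V.1)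
  + (V.2.2 * diff_dir g u V'.1 - V'.2.2 * diff_dir g u V.1) =
  (V.2.1 * (V'.1.1 * a + V'.1.2 * b) - V'.2.1 * (V.1.1 * a + V.1.2 * b))
  + (V.2.2 * (V'.1.1 * c + V'.1.2 * d) - V'.2.2 * (V.1.1 * c + V.1.2 * d)).
Proof. by move=> hf hg; rewrite !(diff_dirE _ hf) !(diff_dirE _ hg). Qed.

(** E1 and E2 are the derivatives along (V.1, V.2) of the parameters d1 and d2 of the universal
    connection. The form is 2 (dd1 /\ du_t + dd2 /\ du_lam), in which the derivatives of
    psi_c1, psi_c2 cancel by closedness and the second derivatives of z and w by symmetry. *)
Lemma omega_darboux u (k : F * F) : bundle_generic u ->
  (forall v, \forall s \near (0 : F), bundle_generic (line u v s)) ->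
  (forall v, \forall s \near (0 : F), has_grad (z lam t) (line u v s) (z_p (line u v s)) 0) ->
  (forall v, \forall s \near (0 : F),
     has_grad (w lam t) (line u v s) (w_p (line u v s)) (w_q (line u v s))) ->
  omega_is_darboux lam t nu u k.
Proof.
move=> gu gn nz nw.
have [[p0 p1 pl _] [_ n0 _] _ _] := gu.
have hz := grad_z_coord gu gn; have hw := grad_w_coord gu gn.
have [a [b [c [hc1 hc2]]]] := grad_psi_c p0 p1 pl n0.
have [za hzp] := grad_zp pl.
have [wa [wb [wc [hwp hwq]]]] := grad_wp_wq n0.
pose E1 (V : (F * F) * (F * F)) := 2%:R^-1 * ((V.1.1 * a + V.1.2 * b)
  + (k.2 * (V.1.1 * wb + V.1.2 * wc) + w_q u * V.2.2)).
pose E2 (V : (F * F) * (F * F)) := 2%:R^-1 * ((V.1.1 * c + V.1.2 * a)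
  + (k.1 * (V.1.1 * za + V.1.2 * 0) + z_p u * V.2.1)
  + (k.2 * (V.1.1 * wa + V.1.2 * wb) + w_p u * V.2.2)).
have tangent (V : (F * F) * (F * F)) : exists a b r0 r1 d, is_tangent
    (fun s => phi lam t (line u V.1 s))
    (fun s => universal_conn lam t nu (line u V.1 s) (line k V.2 s)) 0
    (lines_variation V.1, mx2 a b (poles r0 r1 (- E2 V) (- E1 V)) d : 'M[ffield C]_2).
  pose D1 s := 2%:R^-1 * (psi_c1 lam t nu (line u V.1 s) + (line k V.2 s).2 * w_q (line u V.1 s)).
  pose D2 s := 2%:R^-1 * (psi_c2 lam t nu (line u V.1 s) + (line k V.2 s).1 * z_p (line u V.1 s)
     + (line k V.2 s).2 * w_p (line u V.1 s)).
  have hk1 : is_derive (0 : F) (1 : F) (fun s => (line k V.2 s).1) V.2.1.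
    exact: (is_derive1_affine 0 k.1 V.2.1).
  have hk2 : is_derive (0 : F) (1 : F) (fun s => (line k V.2 s).2) V.2.2.
    exact: (is_derive1_affine 0 k.2 V.2.2).
  have h1 : is_derive (0 : F) (1 : F) D1 (E1 V).
    have h := is_derive1M (is_derive1_cst 0 2%:R^-1) (is_derive1D (hc1 V.1)
        (is_derive1M hk2 (hwq V.1))).
    apply: (is_derive1_eq h).
    by rewrite /E1 !line0; ring.
  have h2 : is_derive (0 : F) (1 : F) D2 (E2 V).
    have h := is_derive1M (is_derive1_cst 0 2%:R^-1) (is_derive1D (is_derive1D (hc2 V.1)
        (is_derive1M hk1 (hzp V.1))) (is_derive1M hk2 (hwp V.1))).
    apply: (is_derive1_eq h).
    by rewrite /E2 !line0; ring.
  have [A [B [r0 [r1 [D hA]]]]] := conn_of_variation u V.1 h1 h2.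
  exists A, B, r0, r1, D; split; first exact: lines_variation_ks.
  move=> i j; apply: is_fderive_near (hA i j).
  apply: filterS3 (gn V.1) (nz V.1) (nw V.1) => s gs zs ws.
  have ps : psi_generic lam t (line u V.1 s) by case: gs => -[? ? ? _] [_ ? _] _ _.
  by rewrite (universal_connE _ ps zs ws) mulr0 addr0.
move=> V V'.
have [A [B [r0 [r1 [D hT]]]]] := tangent V; have [A' [B' [r0' [r1' [D' hT']]]]] := tangent V'.
do 2!eexists; split; [exact: hT|exact: hT'|].
rewrite /atiyah_bott serre_nabla !serre_poles addr0.
rewrite /darboux (darboux_gradE V V' hz hw) /E1 /E2.
have n2 : 2%:R != 0 :> F by rewrite pnatr_eq0.
by field.
Qed.

Lemma jacobianE (f g : F * F -> F) u a b c d : has_grad f u a b -> has_grad g u c d ->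
  diff_dir f u (1, 0) * diff_dir g u (0, 1) - diff_dir f u (0, 1) * diff_dir g u (1, 0)
  = a * d - b * c.
Proof. by move=> hf hg; rewrite !(diff_dirE _ hf) !(diff_dirE _ hg) /=; ring. Qed.

Lemma zw_darboux_coordinates (mu : F) : exists2 Q : {poly {poly F}}, Q != 0 &
  forall u : F * F, Q.[(u.2)%:P].[u.1] != 0 -> pb_stable mu (phi lam t u) ->
  [/\ zw_chart lam t u, corresponds lam t (z lam t) u (Theta_z lam t u),
      corresponds lam t (w lam t) u (Theta_w lam t u)
    & forall k : F * F, is_Con mu nu (phi lam t u) (universal_conn lam t nu u k) /\
        omega_is_darboux lam t nu u k].
Proof.
have [Q Q0 hQ] := bundle_generically; exists Q => // u Qu st.
have near_generic u' : value2 Q u' != 0 ->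
    forall v, \forall s \near (0 : F), bundle_generic (line u' v s).
  by move=> Qu' v; apply: filterS (near_value2_neq0 v Qu') => s /hQ[].
have [gu wq0] := hQ u Qu.
have gn := near_generic u Qu.
have hz := grad_z_coord gu gn; have hw := grad_w_coord gu gn.
have nz v : \forall s \near (0 : F), has_grad (z lam t) (line u v s) (z_p (line u v s)) 0.
  apply: filterS (near_value2_neq0 v Qu) => s Qs.
  exact: grad_z_coord (hQ _ Qs).1 (near_generic _ Qs).
have nw v : \forall s \near (0 : F),
    has_grad (w lam t) (line u v s) (w_p (line u v s)) (w_q (line u v s)).
  apply: filterS (near_value2_neq0 v Qu) => s Qs.
  exact: grad_w_coord (hQ _ Qs).1 (near_generic _ Qs).
have [[p0 p1 pl _] [_ n0 _] _ _] := gu.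
split.
- split.
  + by rewrite (zE gu); exact: is_z_coord_z.
  + by rewrite (wE gu); exact: is_z_coord_w.
  rewrite (jacobianE hz hw) mul0r subr0 mulf_neq0 //.
  have l1' : 1 - lam != 0 by rewrite subr_eq0 eq_sym.
  have pl' : lam - u.1 != 0 by rewrite subr_eq0 eq_sym.
  by rewrite /z_p !mulf_neq0 ?invr_eq0.
- exact: corresponds_grad hz.
- exact: corresponds_grad hw.
move=> k; split; last exact: omega_darboux.
have ps : psi_generic lam t u by [].
by rewrite (universal_connE _ ps hz hw); exact: is_Con_conn_of.
Qed.

End DoubleCover.

Local Open Scope complex_scope.

Theorem corollary7p5 (R : realType) (lam t nu : R[i]) (mu : R)
    (hlam0 : lam != 0) (hlam1 : lam != 1)
    (ht0 : t != 0) (ht1 : t != 1) (htlam : t != lam)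
    (hnu : forall m : int, 2%:R * nu != m%:~R)
    (hmu0 : 0 < mu) (hmu1 : mu < 1) :
  exists2 Q : {poly {poly R[i]}}, Q != 0 &
  forall u : R[i] * R[i], Q.[(u.2)%:P].[u.1] != 0 ->
    pb_stable mu%:C (phi lam t u) ->
  [/\ zw_chart lam t u,
      corresponds lam t (z lam t) u (Theta_z lam t u),
      corresponds lam t (w lam t) u (Theta_w lam t u)
    & forall k : R[i] * R[i],
        is_Con mu%:C nu (phi lam t u) (universal_conn lam t nu u k) /\
        omega_is_darboux lam t nu u k].
Proof. exact: zw_darboux_coordinates. Qed.
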